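(* For every $p>1$ there exist positive constants $C,c$ depending only on $p$ such that for every non-negative function $V\in L^1_{loc}(\mathbb{R}^2)$ $$\mathrm{Neg}(V,\mathbb{R}^2)\le 1+C\sum_{\{n\in\mathbb{Z}:\,A_n>c\}}\sqrt{A_n}+C\sum_{\{n\in\mathbb{Z}:\,B_n>c\}}B_n ,$$ where, for $n\in\mathbb{Z}$, $$A_n=\int_{U_n}V(x)\,(1+|\ln|x||)\,dx,\qquad B_n=\Big(\int_{W_n}V^p(x)\,|x|^{2(p-1)}\,dx\Big)^{1/p}.$$ (The quantities $A_n,B_n$ and both sides of the inequality may be $+\infty$.)
   Context: The annuli are $U_n=\{x\in\mathbb{R}^2: e^{2^{n-1}}<|x|<e^{2^n}\}$ for $n\ge1$, $U_0=\{e^{-1}<|x|<e\}$, $U_n=\{e^{-2^{|n|}}<|x|<e^{-2^{|n|-1}}\}$ for $n\le-1$, and $W_n=\{x\in\mathbb{R}^2: e^n<|x|<e^{n+1}\}$ for all $n\in\mathbb{Z}$. A potential in an open set $\Omega\subset\mathbb{R}^2$ is a non-negative function $V\in L^1_{loc}(\Omega)$. For a potential $V$ in $\Omega$ put $$\mathcal{F}_{V,\Omega}=\Big\{f\in L^2_{loc}(\Omega):\ \int_\Omega|\nabla f|^2dx<\infty,\ \int_\Omega Vf^2dx<\infty\Big\}$$ (real-valued functions, $\nabla f$ the distributional gradient) and $\mathcal{E}_{V,\Omega}(f)=\int_\Omega|\nabla f|^2dx-\int_\Omega Vf^2dx$. Then $\mathrm{Neg}(V,\Omega)\in\{0,1,2,\dots,\infty\}$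 is the supremum of $\dim\mathcal{V}$ over all linear subspaces $\mathcal{V}$ of $\mathcal{F}_{V,\Omega}$ such that $\mathcal{E}_{V,\Omega}(f)\le0$ for all $f\in\mathcal{V}$. (It plays the role of the number of non-positive eigenvalues, with multiplicity, of $-\Delta-V$.) *)

(* Defs.v *)
From HB Require Import structures.
From mathcomp Require Import all_boot all_order all_algebra.
From mathcomp Require Import all_classical all_reals all_analysis.

Set Implicit Arguments.
Unset Strict Implicit.
Unset Printing Implicit Defensive.

Import Order.TTheory GRing.Theory Num.Theory.
Import numFieldNormedType.Exports.

Local Open Scope classical_set_scope.
Local Open Scope ring_scope.

Section Plane.
Context {R : realType}.
Implicit Types (D : set (R * R)) (x : R * R) (phi f V : R * R -> R).

(* [measurableTypeR R * measurableTypeR R] is [R * R] with the Borel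
   sigma-algebra carried by the library's product measure. *)
Definition plane_measure :
    set (measurableTypeR R * measurableTypeR R) -> \bar R :=
  (@lebesgue_measure R \x @lebesgue_measure R)%E.

(* The library norm on [R * R] is the sup norm, hence a separate Euclidean
   norm.  Both induce the same topology. *)
Definition euclid x : R := Num.sqrt (x.1 ^+ 2 + x.2 ^+ 2).

Definition plane_measurable D f : Prop :=
  @measurable_fun _ _ (measurableTypeR R * measurableTypeR R)%type R D f.

Definition loc_integrable D f : Prop :=
  [/\ plane_measurable D f, open D &
      forall K, K `<=` D -> compact K ->
        (\int[plane_measure]_(x in K) `|f x|%:E < +oo)%E].

Definition loc_square_integrable D f : Prop :=
  [/\ plane_measurable D f, open D &
      forall K, K `<=` D -> compact K ->
        (\int[plane_measure]_(x in K) (f x ^+ 2)%:E < +oo)%E].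

Definition partial1 phi : R * R -> R := fun x => 'D_((1, 0) : R * R) phi x.
Definition partial2 phi : R * R -> R := fun x => 'D_((0, 1) : R * R) phi x.

Fixpoint Ck (k : nat) phi : Prop :=
  continuous phi /\
  (if k is k'.+1 then
     [/\ (forall x, derivable phi x ((1, 0) : R * R)),
         (forall x, derivable phi x ((0, 1) : R * R)),
         Ck k' (partial1 phi) & Ck k' (partial2 phi)]
   else True).

Definition test_function D phi : Prop :=
  [/\ forall k, Ck k phi,
      compact (closure [set x | phi x != 0]) &
      closure [set x | phi x != 0] `<=` D].

(* [g x] is the pair of partial derivatives at [x]. *)
Definition is_weak_gradient D f (g : R * R -> R * R) : Prop :=
  [/\ loc_integrable D (fun x => (g x).1),
      loc_integrable D (fun x => (g x).2) &
      forall phi, test_function D phi ->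
        (\int[plane_measure]_(x in D) (f x * partial1 phi x)%:E =
         - \int[plane_measure]_(x in D) ((g x).1 * phi x)%:E)%E /\
        (\int[plane_measure]_(x in D) (f x * partial2 phi x)%:E =
         - \int[plane_measure]_(x in D) ((g x).2 * phi x)%:E)%E].

(* A chosen representative; the weak gradient is unique almost everywhere on
   [D], so integrals of it do not depend on the choice.  The value is arbitrary
   when no weak gradient exists. *)
Definition weak_gradient D f : R * R -> R * R :=
  xget (fun=> (0, 0)) [set g | is_weak_gradient D f g].

Definition dirichlet D f : \bar R :=
  (\int[plane_measure]_(x in D) (euclid (weak_gradient D f x) ^+ 2)%:E)%E.

Definition potential_energy V D f : \bar R :=
  (\int[plane_measure]_(x in D) (V x * f x ^+ 2)%:E)%E.

Definition potential D V : Prop :=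
  (forall x, D x -> 0 <= V x) /\ loc_integrable D V.

Definition form_domain V D : set (R * R -> R) :=
  [set f | [/\ loc_square_integrable D f,
               exists g, is_weak_gradient D f g,
               (dirichlet D f < +oo)%E &
               (potential_energy V D f < +oo)%E]].

Definition energy V D f : \bar R := (dirichlet D f - potential_energy V D f)%E.

Definition linear_subspace (S : set (R * R -> R)) : Prop :=
  S 0 /\ forall (a : R) f g, S f -> S g -> S (a *: f + g).

Definition ae_independent D (n : nat) (f : 'I_n -> R * R -> R) : Prop :=
  forall a : 'I_n -> R,
    (\sum_(i < n) a i *: f i) = 0 %[ae plane_measure in D] ->
    forall i, a i = 0.

(* Dimension of the space of classes, modulo almost everywhere equality on
   [D], of the functions in [S]. *)
Definition ae_dim D (S : set (R * R -> R)) : \bar R :=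
  ereal_sup [set y | exists n (f : 'I_n -> R * R -> R),
    [/\ forall i, S (f i), ae_independent D f & y = n%:R%:E]].

Definition Neg V D : \bar R :=
  ereal_sup [set ae_dim D S | S in
    [set S | [/\ linear_subspace S, S `<=` form_domain V D &
                 forall f, S f -> (energy V D f <= 0)%E]]].

(* [Negz k] is the integer [- k.+1]. *)
Definition annulusU (n : int) : set (R * R) :=
  match n with
  | Posz 0 => [set x | expR (-1) < euclid x < expR 1]
  | Posz k.+1 => [set x | expR (2 ^+ k) < euclid x < expR (2 ^+ k.+1)]
  | Negz k => [set x | expR (- 2 ^+ k.+1) < euclid x < expR (- 2 ^+ k)]
  end.

Definition annulusW (n : int) : set (R * R) :=
  [set x | expR n%:~R < euclid x < expR (n + 1)%:~R].

Definition logWeightA V (n : int) : \bar R :=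
  (\int[plane_measure]_(x in annulusU n)
    (V x * (1 + `|ln (euclid x)|))%:E)%E.

Definition powerNormB (p : R) V (n : int) : \bar R :=
  ((\int[plane_measure]_(x in annulusW n)
    (V x `^ p * euclid x `^ (2 * (p - 1)))%:E) `^ (p^-1))%E.

End Plane.

Arguments plane_measure : clear implicits.

(* Main.v *)
Require Import Defs.
From HB Require Import structures.
From mathcomp Require Import all_boot all_order all_algebra.
From mathcomp Require Import all_classical all_reals all_analysis.
From mathcomp Require Import measurable_realfun.
From mathcomp Require Import ring lra zify.
Import Order.TTheory GRing.Theory Num.Theory.
Import numFieldNormedType.Exports.
Local Open Scope classical_set_scope.
Local Open Scope ring_scope.

(** Let V be a potential.  Neg(V) is at most m as soon as m linear functionals
    have the following property: if all of them vanish at a function F of the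
    form domain, then the potential energy of F is at most one half of its
    Dirichlet integral, and F = 0 almost everywhere if the latter is zero.
    Indeed, among more than m independent functions of a subspace on which the
    form is non-positive some non-trivial combination F is killed by all the
    functionals; the form then makes the Dirichlet integral of F vanish, so
    F = 0 almost everywhere, against independence ([dim_bound], [Neg_le]).  The
    proof constructs such functionals, all of them means of F over rectangles,
    and counts them ([plane_functionals]).

    The plane without the origin is cut into the square rings between the
    squares of half-sides e^k and e^(k+1).  They replace the annuli W_k because
    a ring is a union of eight rectangles ([tile]).  The only property of F that
    is used is [tame]: the means of F over two rectangles of a strip differ by
    at most a multiple of the square root of the energy in the strip.  It comes
    from testing the weak gradient against products of one-variable functions
    ([step_integral]).

    Inside a ring, F splits into its deviation from a mean and that mean.  The
    deviation is controlled by a weighted Sobolev inequality on rectangles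
    ([sobolev]), obtained by summing the jumps of dyadic means over generations:
    the weight of a rectangle in the Hoelder bound [Jp] decays geometrically
    from one generation to the next.  If B is small on a ring no functional is
    spent there.  Otherwise the tiles are subdivided until the weight of each
    piece is small, and the mean over each piece is a functional; the weight
    being superadditive, this costs O(B) functionals ([stopping],
    [ring_functionals]).

    The means over the successive rings form a sequence indexed by Z with
    increments controlled by the energy of two neighbouring rings.  The problem
    that remains for each of the half-lines of positive and of negative indices
    is discrete: bound a sum of v_j x_j^2, where v_j is the mass of V on the
    ring, by the sum of the squared increments, with x_0 = 0 paid for by one
    functional.  On a dyadic block of indices where 2^n times the mass is small,
    Hardy's inequality suffices.  On the other blocks points where x vanishes are
    chosen greedily, and the superadditivity of the square root of length times
    mass bounds their number by the square root of 2^n times the mass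
    ([greedy], [half_line_functionals]).  In terms of the logarithm of |x| such a
    block is an annulus U_n up to bounded overlap, so that its cost is
    O(sqrt A_n) ([badcount_le]). *)

Set Implicit Arguments.
Unset Strict Implicit.
Unset Printing Implicit Defensive.

(** * Smooth functions of one variable and cut-offs *)
Section SmoothLine.
Context {R : realType}.
Implicit Types (a b : R -> R) (P Q : {poly R}).

(** The one-variable counterpart of [Ck], used to build test functions as
    products. *)
Fixpoint CkR (k : nat) a : Prop :=
  if k is k'.+1 then (forall x, derivable a x 1) /\ CkR k' ('D_1 a)
  else continuous a.

Lemma derivable_cont a : (forall x, derivable a x 1) -> continuous a.
Proof. by move=> h x; apply/differentiable_continuous/derivable1_diffP. Qed.

Lemma CkRS k a a' : (forall x : R, is_derive x (1 : R) a (a' x)) -> CkR k a' -> CkR k.+1 a.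
Proof.
move=> h ca' /=; split=> [x|]; first exact: ex_derive.
by rewrite (_ : 'D_1 a = a')//; apply/funext => x; exact: derive_val.
Qed.

Lemma CkR_pred k a : CkR k.+1 a -> CkR k a.
Proof.
elim: k a => [a [h _]|k IH a [h1 h2]]; first exact: derivable_cont.
by split=> //; exact: IH.
Qed.

Lemma CkRD k a b : CkR k a -> CkR k b -> CkR k (fun x => a x + b x).
Proof.
elim: k a b => [a b ca cb x|k IH a b [da ca] [db cb]].
  by apply: cvgD; [exact: ca|exact: cb].
apply: (@CkRS k (fun x => a x + b x) (fun x => 'D_1 a x + 'D_1 b x)); last exact: IH.
by move=> x; apply: is_deriveD; exact: derivableP.
Qed.

Lemma CkRM k a b : CkR k a -> CkR k b -> CkR k (fun x => a x * b x).
Proof.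
elim: k a b => [a b ca cb x|k IH a b ha hb].
  by apply: cvgM; [exact: ca|exact: cb].
have [da ca] := ha; have [db cb] := hb.
apply: (@CkRS k (fun x => a x * b x) (fun x => a x * 'D_1 b x + b x * 'D_1 a x)).
  by move=> x; apply: is_deriveM; exact: derivableP.
by apply: CkRD; apply: IH => //; exact: CkR_pred.
Qed.

Lemma CkR_cst k c : CkR k (fun=> c).
Proof.
elim: k c => [c|k IH c]; first exact: cst_continuous.
by apply: (@CkRS _ _ (fun=> 0)) => // x; exact: is_derive_cst.
Qed.

Lemma CkR_affine k a c d : CkR k a -> CkR k (fun x => a (c * x + d)).
Proof.
elim: k a => [a ca x|k IH a [da ca]].
  have h : {for x, continuous (fun x => c * x + d)}.
    by apply: cvgD; [apply: cvgM; [exact: cvg_cst|exact: cvg_id]|exact: cvg_cst].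
  exact: (continuous_comp h (ca _)).
apply: (@CkRS k (fun x => a (c * x + d)) (fun x => 'D_1 a (c * x + d) * c)); last first.
  by apply: CkRM; [exact: (IH _ ca)|exact: CkR_cst].
move=> x; apply: (@is_derive1_comp _ a (fun x => c * x + d)).
  exact: derivableP.
rewrite -[X in is_derive _ _ _ X](_ : c *: 1 + 0 = c); last first.
  by rewrite addr0 /GRing.scale /= mulr1.
by apply: is_deriveD; apply: is_deriveZ.
Qed.

(** The class of all functions P(1/t) exp(-1/t), extended by 0, is closed under
    differentiation; smoothness of exp(-1/t) at 0 is an induction inside this
    class. *)
Definition flat P (t : R) : R := if 0 < t then P.[t^-1] * expR (- t^-1) else 0.

(** The bound comes from u^(i+2) <= (i+2)! exp(u), used for each monomial. *)
Lemma poly_exp_bound P : exists2 C, 0 <= C &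
  forall u, 0 <= u -> `|P.[u]| * u ^+ 2 * expR (- u) <= C.
Proof.
exists (\sum_(i < size P) `|P`_i| * (i.+2)`!%:R).
  by apply: sumr_ge0 => i _; rewrite mulr_ge0.
move=> u u0; rewrite horner_coef.
apply: (@le_trans _ _ (\sum_(i < size P) `|P`_i| * u ^+ i * u ^+ 2 * expR (- u))).
  rewrite -!mulr_suml ler_wpM2r ?expR_ge0// ler_wpM2r ?exprn_ge0//.
  rewrite (le_trans (ler_norm_sum _ _ _))// ler_sum// => i _.
  by rewrite normrM (@ger0_norm _ (u ^+ i)) ?exprn_ge0.
apply: ler_sum => i _; rewrite -!mulrA ler_wpM2l//.
rewrite !mulrA -!exprSr expRN ler_pdivrMr ?expR_gt0//.
have := @expR_ge1Dxn R u i.+1 u0; set f := _`!%:R => h.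
have f0 : 0 < f by rewrite ltr0n fact_gt0.
rewrite -ler_pdivrMl// mulrC; apply: le_trans h; by rewrite lerDr.
Qed.

(** The quadratic order of vanishing makes every function of the class
    differentiable at 0, with derivative 0. *)
Lemma flat_bound P : exists2 C, 0 <= C & forall t, `|flat P t| <= C * t ^+ 2.
Proof.
have [C C0 h] := poly_exp_bound P; exists C => // t; rewrite /flat.
case: ifPn => t0; last by rewrite normr0 mulr_ge0// sqr_ge0.
have := h t^-1; rewrite invr_ge0 ltW// => /(_ isT).
rewrite normrM (ger0_norm (expR_ge0 _)) -mulrA mulrCA exprVn.
by rewrite mulrC ler_pdivrMr ?exprn_gt0.
Qed.

Lemma is_derive_flat P x :
  is_derive (x : R) (1 : R) (flat P) (flat ((P - P^`()) * 'X^2) x).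
Proof.
have [x0|x0|->] := ltgtP x 0.
- rewrite [X in is_derive _ _ _ X]/flat ltNge (ltW x0) /=.
  apply: (@near_eq_is_derive _ _ _ (cst 0)).
  near=> y; rewrite /flat ifN// -leNgt ltW//.
  by near: y; exact: lt_nbhsl.
- rewrite [X in is_derive _ _ _ X]/flat x0 !hornerE.
  apply: (@near_eq_is_derive _ _ _ (fun t : R => P.[t^-1] * expR (- t^-1) : R)); last first.
  have dV : is_derive x 1 (fun t : R => t^-1) (- x ^- 2).
    have := @is_deriveV _ (@id R) x 1 1 (lt0r_neq0 x0) (is_derive_id _ _).
    by rewrite /GRing.scale /= mulr1.
  have d1 : is_derive x 1 (fun t => P.[t^-1]) (P^`().[x^-1] * - x ^- 2).
    apply: (@is_derive1_comp _ (horner P) (fun t : R => t^-1)).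
  have d2 : is_derive x 1 (fun t => expR (- t^-1)) (expR (- x^-1) * (- - x ^- 2)).
    by apply: (@is_derive1_comp _ expR (fun t : R => - t^-1)).
  have := is_deriveM d1 d2; rewrite /GRing.scale /=.
  move=> hd; apply: is_derive_eq hd _; rewrite -!exprVn; ring.
  by near=> y; rewrite /flat ifT//; near: y; exact: lt_nbhsr.
- rewrite [X in is_derive _ _ _ X]/flat ltxx.
  have [C C0 h] := flat_bound P.
  have f0 : flat P 0 = 0 by rewrite /flat ltxx.
  suff hc : h^-1 *: (flat P (h *: 1 + 0) - flat P 0) @[h --> 0^'] --> (0 : R).
    apply: DeriveDef; first by apply/cvg_ex; exists 0; exact: hc.
    by apply/cvg_lim => //; exact: Rhausdorff.
  apply/cvgr0Pnorm_le => e e0.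
  near=> t; rewrite f0 subr0 addr0 /GRing.scale /= mulr1 normrM normfV.
  have t0 : t != 0 by near: t; exact: nbhs_dnbhs_neq.
  rewrite mulrC ler_pdivrMr ?normr_gt0//; apply: (le_trans (h t)).
  rewrite -[t ^+ 2]real_normK ?num_real// expr2 mulrA ler_wpM2r//.
  apply: (@le_trans _ _ ((C + 1) * `|t|)); first by rewrite ler_wpM2r// lerDl.
  rewrite mulrC -ler_pdivlMr ?ltr_wpDl//.
  near: t; apply: dnbhs0_le; rewrite divr_gt0// ltr_wpDl//.
Unshelve. all: by end_near. Qed.

Lemma CkR_flat k P : CkR k (flat P).
Proof.
elim: k P => [P|k IH P].
  by apply: derivable_cont => x; exact: (@ex_derive _ _ _ _ _ _ _ (is_derive_flat P x)).
by apply: CkRS (IH _) => x; exact: is_derive_flat.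
Qed.

Lemma flat1_ge0 t : 0 <= flat 1 t.
Proof. by rewrite /flat; case: ifP => // _; rewrite hornerE mul1r expR_ge0. Qed.

Lemma flat1_le1 t : flat 1 t <= 1.
Proof.
rewrite /flat; case: ifP => // t0; rewrite hornerE mul1r expR_le1 oppr_le0.
by rewrite invr_ge0 ltW.
Qed.

Lemma flat_le0 P t : t <= 0 -> flat P t = 0.
Proof. by move=> t0; rewrite /flat ifN// -leNgt. Qed.

(** A smooth approximation of the indicator of the interval from s to t that
    never exceeds it; it converges pointwise without any normalisation. *)
Definition cutoff (s t : R) (n : nat) (u : R) : R :=
  flat 1 (n.+1%:R * (u - s)) * flat 1 (n.+1%:R * (t - u)).

Lemma cutoff_ge0 s t n u : 0 <= cutoff s t n u.
Proof. by rewrite mulr_ge0 ?flat1_ge0. Qed.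

Lemma cutoff_le1 s t n u : cutoff s t n u <= 1.
Proof. by rewrite mulr_ile1 ?flat1_ge0 ?flat1_le1. Qed.

Lemma cutoff_out s t n u : ~ (s < u < t) -> cutoff s t n u = 0.
Proof.
move=> /negP; rewrite negb_and -!leNgt => /orP[us|tu]; rewrite /cutoff.
  by rewrite [X in X * _]flat_le0 ?mul0r// mulr_ge0_le0// subr_le0.
by rewrite [X in _ * X]flat_le0 ?mulr0// mulr_ge0_le0// subr_le0.
Qed.

Lemma CkR_cutoff k s t n : CkR k (cutoff s t n).
Proof.
apply: (@CkRM _ (fun u => flat 1 (n.+1%:R * (u - s)))
                (fun u => flat 1 (n.+1%:R * (t - u)))).
  have := @CkR_affine k _ n.+1%:R (- (n.+1%:R * s)) (CkR_flat k 1).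
  by congr CkR; apply/funext => u; rewrite mulrBr.
have := @CkR_affine k _ (- n.+1%:R) (n.+1%:R * t) (CkR_flat k 1).
by congr CkR; apply/funext => u; rewrite mulrBr mulNr addrC.
Qed.

Lemma cutoff_cont s t n : continuous (cutoff s t n).
Proof. exact: (CkR_cutoff 0). Qed.

Lemma flat1_cvg t : 0 < t -> flat 1 (n.+1%:R * t) @[n --> \oo] --> (1 : R).
Proof.
move=> t0; rewrite (_ : (fun n => _) = (fun n => expR (- (n.+1%:R^-1 * t^-1)))).
  have h : - (n.+1%:R^-1 * t^-1) @[n --> \oo] --> - (0 * t^-1).
    by apply: cvgN; apply: (@cvgM _ _ _ _ (@harmonic R) (fun=> t^-1));
      [exact: cvg_harmonic|exact: cvg_cst].
  have := cvg_comp _ _ h (@continuous_expR R _).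
  by rewrite mul0r oppr0 expR0.
by apply/funext => n; rewrite /flat mulr_gt0// hornerE mul1r invfM.
Qed.

Lemma cutoff_cvg s t u : s < u < t -> cutoff s t n u @[n --> \oo] --> (1 : R).
Proof.
move=> /andP[su ut]; rewrite -[1]mulr1; apply: cvgM.
  by apply: flat1_cvg; rewrite subr_gt0.
by apply: flat1_cvg; rewrite subr_gt0.
Qed.

Notation mu1 := (@lebesgue_measure R).

Lemma cutoff_measurable s t n D : measurable_fun D (cutoff s t n).
Proof.
by apply: measurable_funTS; apply: continuous_measurable_fun; exact: cutoff_cont.
Qed.

Lemma cutoff_integrable s t n : mu1.-integrable setT (EFin \o cutoff s t n).
Proof.
have h : mu1.-integrable `[s, t] (EFin \o cutoff s t n).
  apply: continuous_compact_integrable; first exact: segment_compact.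
  by apply: continuous_subspaceT; exact: cutoff_cont.
rewrite (_ : EFin \o _ = (EFin \o cutoff s t n) \_ `[s, t]); last first.
  apply/funext => u; rewrite /= patchE; case: ifPn => //.
  rewrite notin_setE /= in_itv/= => /negP h'; congr EFin; apply/cutoff_out.
  by apply/negP; apply: contra h' => /andP[/ltW -> /ltW ->].
exact: (integrable_mkcond _ _).1 h.
Qed.

Definition mass s t n : R := \int[mu1]_u cutoff s t n u.

(** Since [cutoff] is only an approximate indicator, its primitive reaches
    [mass] and not the length of the interval. *)
Definition prim s t n (x : R) : R := \int[mu1]_(u in `]-oo, x]) cutoff s t n u.

Lemma cutoff_integrableS s t n D : measurable D ->
  mu1.-integrable D (EFin \o cutoff s t n).
Proof. by move=> mD; apply: integrableS (cutoff_integrable s t n). Qed.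

Lemma is_derive_prim s t n (x : R) :
  is_derive x (1 : R) (prim s t n) (cutoff s t n x).
Proof.
have := @continuous_FTC1 R (cutoff s t n) -oo%O x (x + 1).
rewrite ltrDl => /(_ ltr01 (cutoff_integrableS _ _ _ (measurable_itv _)))/=.
move=> /(_ (ltNyr _) (@cutoff_cont s t n _))[d <-].
apply: DeriveDef; first exact: d.
by rewrite -derive1E.
Qed.

Lemma CkR_prim k s t n : CkR k (prim s t n).
Proof.
apply: CkR_pred; apply: CkRS (CkR_cutoff _ _ _ _) => x; exact: is_derive_prim.
Qed.

Lemma prim_ge0 s t n x : 0 <= prim s t n x.
Proof. by apply: Rintegral_ge0 => u _; exact: cutoff_ge0. Qed.

Lemma prim_left s t n x : x <= s -> prim s t n x = 0.
Proof.
move=> xs; rewrite /prim (@eq_Rintegral _ _ _ mu1 _ (fun=> 0)) ?Rintegral_cst ?mul0r//.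
move=> u; rewrite inE /= in_itv /= => ux; apply: cutoff_out => /andP[su _].
by move: (lt_le_trans su ux); rewrite ltNge xs.
Qed.

Lemma prim_le_mass s t n x : prim s t n x <= mass s t n.
Proof.
rewrite /prim Rintegral_mkcond; apply: le_Rintegral => //.
- have mI : measurable (`]-oo, x] : set (measurableTypeR R)) by exact: measurable_itv.
  have := (integrable_mkcond _ mI).1 (cutoff_integrableS s t n mI).
  by congr (integrable _ _ _); apply/funext => u; rewrite /= !patchE; case: ifP.
- exact: cutoff_integrable.
by move=> u _; rewrite patchE; case: ifP => // _; exact: cutoff_ge0.
Qed.

Lemma prim_right s t n x : t <= x -> prim s t n x = mass s t n.
Proof.
move=> tx; rewrite /prim Rintegral_mkcond; apply: eq_Rintegral => u _.
rewrite patchE; case: ifPn => //.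
rewrite notin_setE /= in_itv/= => /negP; rewrite -ltNge => xu.
apply/esym/cutoff_out => /andP[_ ut].
by move: (lt_trans (lt_le_trans ut tx) xu); rewrite ltxx.
Qed.

Lemma mass_ge0 s t n : 0 <= mass s t n.
Proof. by apply: Rintegral_ge0 => u _; exact: cutoff_ge0. Qed.

Lemma mass_mkcond s t n : mass s t n = \int[mu1]_(u in `]s, t[) cutoff s t n u.
Proof.
rewrite [RHS]Rintegral_mkcond; apply: eq_Rintegral => u _; rewrite patchE.
case: ifPn => //; rewrite notin_setE /= in_itv/= => /negP h.
by apply: cutoff_out; exact/negP.
Qed.

Let one_integrable (s t : R) :
  mu1.-integrable `]s, t[ (EFin \o (fun=> 1 : R)).
Proof.
apply: (@integrableS _ _ _ mu1 `[s, t]) => //; first exact: subset_itv_oo_cc.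
apply: continuous_compact_integrable; first exact: segment_compact.
by apply: continuous_subspaceT => x; exact: cvg_cst.
Qed.

Lemma mass_le s t n : s <= t -> mass s t n <= t - s.
Proof.
move=> st; rewrite mass_mkcond.
apply: (@le_trans _ _ (\int[mu1]_(u in `]s, t[) 1)).
  apply: le_Rintegral => //; first exact: cutoff_integrableS.
  by move=> u _; exact: cutoff_le1.
rewrite Rintegral_cst//= mul1r lebesgue_measure_itv /= lte_fin.
by case: ifP => //=; rewrite subr_ge0.
Qed.

Lemma mass_cvg s t : s <= t -> mass s t n @[n --> \oo] --> (t - s : R).
Proof.
move=> st; have -> : mass s t = fun n => \int[mu1]_(u in `]s, t[) cutoff s t n u.
  by apply/funext => n; rewrite mass_mkcond.
have -> : t - s = fine (\int[mu1]_(u in `]s, t[) (1 : R)%:E).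
  rewrite integral_cst//= mul1e lebesgue_measure_itv /= lte_fin.
  case: ifPn => //=; rewrite -leNgt => ts.
  by apply/eqP; rewrite subr_eq0 eq_le ts st.
have i1 := one_integrable s t.
apply: fine_cvg; rewrite fineK; last exact: integrable_fin_num.
apply: (@dominated_cvg _ _ _ mu1 `]s, t[ _ _ _ (EFin \o (fun=> 1))) => //.
- by move=> n; apply/measurable_EFinP; exact: cutoff_measurable.
- move=> u; rewrite /= in_itv/= => h; apply: cvg_EFin; last exact: cutoff_cvg.
  by apply: nearW => n.
- by move=> n u _; rewrite /= lee_fin ger0_norm ?cutoff_ge0// cutoff_le1.
Qed.

End SmoothLine.

(** * Products of smooth functions are test functions *)
Section TestFunctions.
Context {R : realType}.
Implicit Types (a b : R -> R).

Definition tensor a b : R * R -> R := fun x => a x.1 * b x.2.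

Lemma is_derive_tensor1 a b (x : R * R) : derivable a x.1 1 ->
  is_derive x ((1, 0) : R * R) (tensor a b) (tensor ('D_1 a) b x).
Proof.
move=> da.
have h : h^-1 *: (tensor a b (h *: ((1, 0) : R * R) + x) - tensor a b x)
   @[h --> 0^'] --> tensor ('D_1 a) b x.
  rewrite (_ : (fun h => _) = (fun h => h^-1 *: (a (h *: 1 + x.1) - a x.1) * b x.2)).
    by apply: cvgM; [exact: da|exact: cvg_cst].
  apply/funext => h; rewrite /tensor /GRing.scale /= /GRing.scale /=. rewrite mulr0 add0r; ring.
apply: DeriveDef; first by apply/cvg_ex; eexists; exact: h.
by apply/cvg_lim => //; exact: Rhausdorff.
Qed.

Lemma is_derive_tensor2 a b (x : R * R) : derivable b x.2 1 ->
  is_derive x ((0, 1) : R * R) (tensor a b) (tensor a ('D_1 b) x).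
Proof.
move=> da.
have h : h^-1 *: (tensor a b (h *: ((0, 1) : R * R) + x) - tensor a b x)
   @[h --> 0^'] --> tensor a ('D_1 b) x.
  rewrite (_ : (fun h => _) = (fun h => a x.1 * (h^-1 *: (b (h *: 1 + x.2) - b x.2)))).
    by apply: cvgM; [exact: cvg_cst|exact: da].
  apply/funext => h; rewrite /tensor /GRing.scale /= /GRing.scale /=. rewrite mulr0 add0r; ring.
apply: DeriveDef; first by apply/cvg_ex; eexists; exact: h.
by apply/cvg_lim => //; exact: Rhausdorff.
Qed.

Lemma tensor_cont a b : continuous a -> continuous b -> continuous (tensor a b).
Proof.
move=> ca cb x; apply: cvgM.
  exact: (cvg_comp fst a cvg_fst (ca _)).
exact: (cvg_comp snd b cvg_snd (cb _)).
Qed.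

Lemma CkR_cont k a : CkR k a -> continuous a.
Proof. by case: k => [|k []] // h _; exact: derivable_cont. Qed.

Lemma Ck_tensor k a b : CkR k a -> CkR k b -> Ck k (tensor a b).
Proof.
elim: k a b => [|k IH] a b ha hb.
  by split => //; exact: tensor_cont.
split; first by apply: tensor_cont; [exact: CkR_cont ha|exact: CkR_cont hb].
have [da ca] := ha; have [db cb] := hb; split.
- by move=> x; apply: ex_derive; apply: is_derive_tensor1.
- by move=> x; apply: ex_derive; apply: is_derive_tensor2.
- rewrite (_ : partial1 _ = tensor ('D_1 a) b); first by apply: IH => //; exact: CkR_pred.
  by apply/funext => x; apply: derive_val; apply: is_derive_tensor1.
- rewrite (_ : partial2 _ = tensor a ('D_1 b)); first by apply: IH => //; exact: CkR_pred.
  by apply/funext => x; apply: derive_val; apply: is_derive_tensor2.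
Qed.

Lemma test_tensor a b s t s' t' :
  (forall k, CkR k a) -> (forall k, CkR k b) ->
  (forall x, a x != 0 -> s <= x <= t) -> (forall x, b x != 0 -> s' <= x <= t') ->
  test_function setT (tensor a b).
Proof.
move=> ca cb sa sb.
have cK : compact (`[s, t] `*` `[s', t']).
  by apply: compact_setX; exact: segment_compact.
split => //; first by move=> k; exact: Ck_tensor.
apply: (subclosed_compact _ cK); first exact: closed_closure.
have clK : closed (`[s, t] `*` `[s', t']).
  by apply: compact_closed => //; exact: norm_hausdorff.
rewrite [X in _ `<=` X](closure_id _).1//; apply: closure_subset => x /=.
rewrite /tensor mulf_eq0 negb_or => /andP[/sa h1 /sb h2].
by split; rewrite /= in_itv.
Qed.

End TestFunctions.

HB.instance Definition _ (R : realType) := Measure.copy (@plane_measure R)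
  ((@lebesgue_measure R \x @lebesgue_measure R)%E).

Section Plane.
Context {R : realType}.
Local Notation mu := (plane_measure R).
Local Notation leb := (@lebesgue_measure R).
Local Notation T2 := (measurableTypeR R * measurableTypeR R)%type.

(** The boolean selects a coordinate, so that each estimate is proved once for
    horizontal and vertical strips. *)
Definition coord (pr : bool) (x : R * R) : R := if pr then x.1 else x.2.

Definition box pr (I J : set R) : set T2 :=
  [set x | I (coord pr x) /\ J (coord (~~ pr) x)].

Lemma boxE pr I J : box pr I J = if pr then I `*` J else J `*` I.
Proof. by case: pr => //; rewrite eqEsubset; split => x [? ?]; split. Qed.

Lemma measurable_coord pr : measurable_fun (setT : set T2) (coord pr : T2 -> measurableTypeR R).
Proof. by case: pr; [exact: measurable_fst|exact: measurable_snd]. Qed.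

Lemma box_measurable pr (I J : set (measurableTypeR R)) :
  measurable I -> measurable J -> measurable (box pr I J).
Proof. by move=> mI mJ; rewrite boxE; case: pr; exact: measurableX. Qed.

Lemma box_measure pr (I J : set (measurableTypeR R)) :
  measurable I -> measurable J -> mu (box pr I J) = (leb I * leb J)%E.
Proof.
move=> mI mJ; rewrite boxE; case: pr; rewrite /plane_measure product_measure1E//.
by rewrite muleC.
Qed.

Lemma box_compact pr s t s' t' : compact (box pr `[s, t] `[s', t'] : set (R * R)).
Proof.
by rewrite boxE; case: pr; apply: compact_setX; exact: segment_compact.
Qed.

Lemma cbox_fin pr s t s' t' : (mu (box pr `[s, t] `[s', t']) < +oo)%E.
Proof.
rewrite box_measure// !lebesgue_measure_itv/= !lte_fin.
by case: ifP => _; case: ifP => _; rewrite ?mul0e ?mule0 ?ltry// -!EFinB -EFinM ltry.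
Qed.

Lemma cst_integrable_fin D (c : R) : measurable D -> (mu D < +oo)%E ->
  mu.-integrable D (EFin \o fun=> c).
Proof.
move=> mD fD; apply/integrableP; split; first exact/measurable_EFinP.
rewrite integral_cst// lte_mul_pinfty//.
Qed.

Lemma loc_square_integrable_box f pr s t s' t' : loc_square_integrable setT f ->
  mu.-integrable (box pr `[s, t] `[s', t']) (EFin \o f).
Proof.
move=> [mf _ fK]; set K := box _ _ _.
have mK : measurable K by apply: box_measurable; exact: measurable_itv.
have h2 : mu.-integrable K (EFin \o (fun x => 1 + f x ^+ 2)).
  apply: (@integrableD _ _ _ mu K mK (EFin \o fun=> 1) (EFin \o fun x => f x ^+ 2)).
    exact: (cst_integrable_fin _ mK (cbox_fin _ _ _ _ _)).
  apply/integrableP; split.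
    apply/measurable_EFinP; apply: measurable_funX.
    exact: measurable_funTS.
  under eq_integral => x _ do rewrite /= ger0_norm ?sqr_ge0//.
  by apply: fK => //; exact: box_compact.
apply: le_integrable h2 => //.
  by apply/measurable_EFinP; exact: measurable_funTS.
move=> x _ /=; rewrite lee_fin [leRHS]ger0_norm ?addr_ge0 ?sqr_ge0//.
rewrite -[f x ^+ 2]real_normK ?num_real//.
have := sqr_ge0 (`|f x| - 1); have := normr_ge0 (f x); nra.
Qed.

Lemma loc_integrable_box f pr s t s' t' : loc_integrable setT f ->
  mu.-integrable (box pr `[s, t] `[s', t']) (EFin \o f).
Proof.
move=> [mf _ fK]; apply/integrableP; split.
  by apply/measurable_EFinP; exact: measurable_funTS.
by apply: fK => //; exact: box_compact.
Qed.

Lemma box_sub pr I J I' J' : I `<=` I' -> J `<=` J' -> box pr I J `<=` box pr I' J'.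
Proof. by move=> h h' x [/h ? /h' ?]. Qed.

End Plane.

(** * Means over shifted boxes and the weak gradient *)
Section Step.
Context {R : realType}.
Local Notation mu := (plane_measure R).
Local Notation leb := (@lebesgue_measure R).
Local Notation T2 := (measurableTypeR R * measurableTypeR R)%type.

Lemma weak_tensor (f : R * R -> R) g pr (a b : R -> R) s t s' t' :
  is_weak_gradient setT f g ->
  (forall k, CkR k a) -> (forall k, CkR k b) ->
  (forall x, a x != 0 -> s <= x <= t) -> (forall x, b x != 0 -> s' <= x <= t') ->
  (\int[mu]_x (f x * ('D_1 a (coord pr x) * b (coord (~~ pr) x)))%:E =
   - \int[mu]_x (coord pr (g x) * (a (coord pr x) * b (coord (~~ pr) x)))%:E)%E.
Proof.
move=> [_ _ h] ca cb sa sb; case: pr => /=.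
  have [h1 _] := h _ (test_tensor ca cb sa sb).
  rewrite -h1; apply: eq_integral => x _; congr (_ * _)%:E; apply/esym.
  apply: (@derive_val _ _ _ _ _ _ _ (is_derive_tensor1 _ _)).
  by have [] := ca 1%N.
have [_ h1] := h _ (test_tensor cb ca sb sa).
transitivity (\int[mu]_x (f x * partial2 (tensor b a) x)%:E)%E.
  apply: eq_integral => x _; congr (_ * _)%:E; rewrite [LHS]mulrC; apply/esym.
  apply: (@derive_val _ _ _ _ _ _ _ (is_derive_tensor2 _ _)).
  by have [] := ca 1%N.
rewrite h1; congr (- _)%E; apply: eq_integral => x _; congr (_ * _)%:E.
by rewrite /tensor /= mulrC.
Qed.

Lemma cross_bound (x y m1 m2 : R) : 0 <= x -> x <= m1 -> 0 <= y -> y <= m2 ->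
  `|m2 * x - m1 * y| <= m1 * m2.
Proof. by move=> x0 xm y0 ym; rewrite ler_norml; apply/andP; split; nra. Qed.

(** A combination of the primitives of two cut-offs, weighted so that it returns
    to zero to the right of both intervals, is compactly supported in the strip.
    Its product with a cut-off in the other variable is a test function whose
    derivative tends to a combination of two indicators. *)
Lemma step_integral (f : R * R -> R) g pr a1 b1 a2 b2 c d h0 h1 :
  is_weak_gradient setT f g -> loc_square_integrable setT f ->
  h0 <= a1 -> a1 <= b1 -> b1 <= h1 -> h0 <= a2 -> a2 <= b2 -> b2 <= h1 ->
  `| (b2 - a2) * \int[mu]_(x in box pr `]a1, b1[ `]c, d[) f x -
     (b1 - a1) * \int[mu]_(x in box pr `]a2, b2[ `]c, d[) f x |
  <= (b1 - a1) * (b2 - a2) *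
     \int[mu]_(x in box pr `]h0, h1[ `]c, d[) `|coord pr (g x)|.
Proof.
move=> wg lf ha1 hab1 hb1 ha2 hab2 hb2.
pose Z1 n := mass a1 b1 n; pose Z2 n := mass a2 b2 n.
(* With these weights A vanishes to the right of both intervals. *)
pose A n (u : R) := Z2 n * prim a1 b1 n u - Z1 n * prim a2 b2 n u.
pose A' n (u : R) := Z2 n * cutoff a1 b1 n u - Z1 n * cutoff a2 b2 n u.
pose B n (u : R) := cutoff c d n u.
have dA n x : is_derive (x : R) (1 : R) (A n) (A' n x).
  have d1 := is_derive_prim a1 b1 n x; have d2 := is_derive_prim a2 b2 n x.
  have e1 : is_derive x (1 : R) (Z2 n *: prim a1 b1 n : R -> R) (Z2 n *: cutoff a1 b1 n x).
    by apply: is_deriveZ.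
  have e2 : is_derive x (1 : R) (Z1 n *: prim a2 b2 n : R -> R) (Z1 n *: cutoff a2 b2 n x).
    by apply: is_deriveZ.
  exact: (is_deriveB e1 e2).
have A'E n : 'D_1 (A n) = A' n by apply/funext => x; exact: derive_val.
have cA n k : CkR k (A n).
  have e : A n = (fun u => (fun u => Z2 n * prim a1 b1 n u) u + (fun u => (- Z1 n) * prim a2 b2 n u) u).
    by apply/funext => u; rewrite /A mulNr.
  by rewrite e; apply: CkRD; apply: CkRM; (exact: CkR_cst || exact: CkR_prim).
have cB n k : CkR k (B n) by exact: CkR_cutoff.
have A0 n x : ~ (h0 < x < h1) -> A n x = 0.
  move/negP; rewrite negb_and -!leNgt => /orP[xh|xh]; rewrite /A.
    by rewrite !prim_left ?mulr0 ?subrr// (le_trans xh).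
  by rewrite !prim_right ?(le_trans _ xh)// /Z1 /Z2 mulrC subrr.
have sA n x : A n x != 0 -> h0 <= x <= h1.
  by move=> h; apply: contrapT => h'; move/eqP: h; apply; apply: A0 => /andP[/ltW p /ltW q];
    apply: h'; rewrite p q.
have sB n x : B n x != 0 -> c <= x <= d.
  by move=> h; apply: contrapT => h'; move/eqP: h; apply; apply: cutoff_out => /andP[/ltW p /ltW q];
    apply: h'; rewrite p q.
have key n := @weak_tensor f g pr _ _ _ _ _ _ wg (cA n) (cB n) (sA n) (sB n).
have Zge n : 0 <= Z1 n <= b1 - a1 by rewrite mass_ge0 mass_le.
have Zge2 n : 0 <= Z2 n <= b2 - a2 by rewrite mass_ge0 mass_le.
have Abd n x : `|A n x| <= (b1 - a1) * (b2 - a2).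
  have /andP[z1 z1'] := Zge n; have /andP[z2 z2'] := Zge2 n.
  apply: (@le_trans _ _ (Z1 n * Z2 n)); last exact: ler_pM.
  by apply: cross_bound; [exact: prim_ge0|exact: prim_le_mass|exact: prim_ge0|exact: prim_le_mass].
set L := b2 - a2; set M := b1 - a1.
have mD : measurable (box pr `]h0, h1[ `]c, d[) by apply: box_measurable; exact: measurable_itv.
have ig : mu.-integrable (box pr `]h0, h1[ `]c, d[) (EFin \o (fun x => coord pr (g x))).
  have [g1 g2 _] := wg.
  apply: (@integrableS _ _ _ mu (box pr `[h0, h1] `[c, d])) => //.
  - by apply: box_measurable; exact: measurable_itv.
  - by apply: box_sub; exact: subset_itv_oo_cc.
  - by case: (pr); [exact: (loc_integrable_box _ _ _ _ _ g1)|exact: (loc_integrable_box _ _ _ _ _ g2)].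
have mAB n : measurable_fun setT (fun x : T2 => A n (coord pr x) * B n (coord (~~ pr) x)).
  apply: measurable_funM.
    apply: (@measurableT_comp _ _ _ _ _ _ (A n) _ (coord pr)); last exact: measurable_coord.
    by apply: continuous_measurable_fun; exact: (cA n 0).
  apply: (@measurableT_comp _ _ _ _ _ _ (B n) _ (coord (~~ pr))); last exact: measurable_coord.
  by apply: continuous_measurable_fun; exact: (cB n 0).
have mg : measurable_fun setT (fun x : T2 => coord pr (g x)).
  by have [[mg1 _ _] [mg2 _ _] _] := wg; case: (pr).
set G := \int[mu]_(x in box pr `]h0, h1[ `]c, d[) `|coord pr (g x)|.
have bound n : (`| \int[mu]_x (f x * (A' n (coord pr x) * B n (coord (~~ pr) x)))%:E | <= (M * L * G)%:E)%E.
  rewrite -A'E key abseN.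
  apply: (le_trans (le_abse_integral _ _ _)) => //.
    by apply/measurable_EFinP; exact: measurable_funM.
  rewrite /G /Rintegral EFinM fineK; last first.
    apply: integrable_fin_num => //; exact: (integrable_norm ig).
  rewrite -ge0_integralZl//; last 2 first.
  - by apply/measurable_EFinP; apply: measurableT_comp => //; exact: measurable_funTS.
  - by rewrite lee_fin mulr_ge0// subr_ge0.
  rewrite [leRHS]integral_mkcond; apply: ge0_le_integral => //.
  - by apply: measurableT_comp => //; apply/measurable_EFinP; exact: measurable_funM.
  - apply/(measurable_restrictT _ mD); apply/measurable_EFinP; apply: measurable_funM => //.
    by apply: measurableT_comp => //; exact: measurable_funTS.
  move=> x _; rewrite patchE; case: ifPn => /=.
    move=> _; rewrite -EFinM lee_fin (normrM (coord pr (g x))) (normrM (A n _)) [leRHS]mulrC ler_wpM2l//.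
    rewrite -[leRHS]mulr1 ler_pM// ?Abd//.
    by rewrite /B ger0_norm ?cutoff_ge0// cutoff_le1.
  rewrite notin_setE /= lee_fin => hx.
  have [h|h] := pselect (h0 < coord pr x < h1); last by rewrite A0// mul0r mulr0 normr0.
  rewrite /B (@cutoff_out _ c d) ?mulr0 ?normr0// => h'; apply: hx; split; rewrite /= in_itv/=; [exact: h|exact: h'].
(* The pointwise limit of f times the partial derivative of the test function. *)
pose F x := f x * ((L * (\1_`]a1, b1[ (coord pr x) : R) - M * \1_`]a2, b2[ (coord pr x)) * \1_`]c, d[ (coord (~~ pr) x)).
set K := box pr `[h0, h1] `[c, d].
have mK : measurable K by apply: box_measurable; exact: measurable_itv.
have iK : mu.-integrable K (EFin \o f) by exact: loc_square_integrable_box.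
have mf : measurable_fun setT (f : T2 -> R) by case: lf.
have indM (i : interval R) q : measurable_fun setT (fun x : T2 => \1_[set` i] (coord q x) : R).
  apply: (@measurableT_comp _ _ _ _ _ _ (\1_[set` i] : measurableTypeR R -> R) _ (coord q)); last exact: measurable_coord.
  by apply: measurable_indic; exact: measurable_itv.
have mF : measurable_fun setT (F : T2 -> R).
  by apply: measurable_funM => //; apply: measurable_funM => //; apply: measurable_funB;
    apply: measurable_funM.
have bcvg (s t u : R) : cutoff s t n u @[n --> \oo] --> (\1_`]s, t[ u : R).
  have [h|h] := pselect (s < u < t).
    by rewrite indicE mem_set/= ?in_itv//=; exact: cutoff_cvg.
  rewrite indicE memNset/=; last by rewrite /= in_itv.
  by rewrite (_ : (fun n => _) = fun=> 0); [exact: cvg_cst|apply/funext => n; rewrite cutoff_out].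
have lim : (\int[mu]_x (f x * (A' n (coord pr x) * B n (coord (~~ pr) x)))%:E @[n --> \oo] -->
   \int[mu]_x (F x)%:E)%E.
  apply: (@dominated_cvg _ _ _ mu setT measurableT _ _ ((EFin \o (fun x => (L + M) * `|f x|)) \_ K)).
  - move=> n; rewrite -A'E; apply/measurable_EFinP; apply: measurable_funM => //.
    apply: measurable_funM.
      apply: (@measurableT_comp _ _ _ _ _ _ ('D_1 (A n)) _ (coord pr)); last exact: measurable_coord.
      by apply: continuous_measurable_fun; have [_ hh] := cA n 1%N; exact: hh.
    apply: (@measurableT_comp _ _ _ _ _ _ (B n) _ (coord (~~ pr))); last exact: measurable_coord.
    by apply: continuous_measurable_fun; exact: (cB n 0).
  - move=> x _; apply: cvg_EFin; first exact: nearW.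
    apply: cvgM; first exact: cvg_cst.
    apply: cvgM; last exact: bcvg.
    by apply: cvgB; apply: cvgM; (exact: mass_cvg || exact: bcvg).
  - by move=> x _; rewrite patchE; case: ifP.
  - apply/(integrable_mkcond _ mK).1.
    exact: (integrableZl mK (L + M) (integrable_norm iK)).
  move=> n x _; rewrite patchE; case: ifPn => [_|] /=.
    rewrite lee_fin (normrM (f x)) mulrC ler_wpM2r// (normrM (A' n _)) -[leRHS]mulr1 ler_pM//; last first.
      by rewrite /B ger0_norm ?cutoff_ge0// cutoff_le1.
    rewrite (le_trans (ler_normB _ _))// (normrM (Z2 n)) (normrM (Z1 n)).
    have /andP[z1 z1'] := Zge n; have /andP[z2 z2'] := Zge2 n.
    rewrite !(ger0_norm z1, ger0_norm z2, ger0_norm (cutoff_ge0 _ _ _ _)).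
    by apply: lerD; rewrite -[leRHS]mulr1; apply: ler_pM; rewrite ?cutoff_ge0 ?cutoff_le1.
  rewrite notin_setE /= lee_fin => hx.
  have [h|h] := pselect (h0 <= coord pr x <= h1); last first.
    rewrite /A' !cutoff_out ?mulr0 ?subrr ?mul0r ?mulr0 ?normr0//.
      by move=> /andP[p q]; apply: h; rewrite (le_trans ha2 (ltW p)) (le_trans (ltW q)).
    by move=> /andP[p q]; apply: h; rewrite (le_trans ha1 (ltW p)) (le_trans (ltW q)).
  rewrite /B (@cutoff_out _ c d) ?mulr0 ?normr0// => /andP[/ltW p /ltW q].
  by apply: hx; split; rewrite /= in_itv/= ?p.
have iS (s t : R) : h0 <= s -> t <= h1 -> mu.-integrable (box pr `]s, t[ `]c, d[) (EFin \o f).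
  move=> hs ht; apply: (@integrableS _ _ _ mu K) => //.
    by apply: box_measurable; exact: measurable_itv.
  apply: box_sub; last exact: subset_itv_oo_cc.
  by move=> u /=; rewrite !in_itv/= => /andP[p q]; rewrite (le_trans hs (ltW p)) (le_trans (ltW q)).
have FE : (\int[mu]_x (F x)%:E)%E = (L * \int[mu]_(x in box pr `]a1, b1[ `]c, d[) f x -
     M * \int[mu]_(x in box pr `]a2, b2[ `]c, d[) f x)%:E.
  have m1 : measurable (box pr `]a1, b1[ `]c, d[) by apply: box_measurable; exact: measurable_itv.
  have m2 : measurable (box pr `]a2, b2[ `]c, d[) by apply: box_measurable; exact: measurable_itv.
  have i1 := iS _ _ ha1 hb1; have i2 := iS _ _ ha2 hb2.
  rewrite EFinB !EFinM !fineK; try exact: integrable_fin_num.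
  rewrite -!integralZl//.
  rewrite [X in (X - _)%E]integral_mkcond [X in (_ - X)%E]integral_mkcond.
  rewrite -integralB//; last 2 first.
  - apply/(integrable_mkcond _ m1).1; exact: (integrableZl m1).
  - apply/(integrable_mkcond _ m2).1; exact: (integrableZl m2).
  apply: eq_integral => x _; rewrite !patchE /F !indicE.
  have mb s t : (x \in box pr `]s, t[ `]c, d[) = (coord pr x \in `]s, t[%classic) && (coord (~~ pr) x \in `]c, d[%classic).
    apply/idP/andP; rewrite !inE; first by move=> [].
    by move=> [? ?]; split.
  rewrite !mb; case: (coord (~~ pr) x \in _); rewrite ?andbT ?andbF/= ?mulr0 ?mulr1 ?sube0//.
  case: (_ \in _); case: (_ \in _); rewrite /= ?mulr0 ?mulr1 ?subr0 ?sub0r ?mulr0 ?sube0 ?add0e ?adde0 -?EFinM -?EFinN -?EFinD; congr (_%:E); ring.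
have h2 := cvg_abse lim; rewrite FE /= in h2; have {}h2 := h2 (@eventually_filter).
rewrite -lee_fin -(cvg_lim _ h2)//.
by apply: lime_le; [apply/cvg_ex; eexists; exact: h2|exact: nearW].
Qed.

End Step.

(** * Rectangles, means and energies *)
Section Rect.
Context {R : realType}.
Local Notation mu := (plane_measure R).
Local Notation leb := (@lebesgue_measure R).
Local Notation T2 := (measurableTypeR R * measurableTypeR R)%type.

Lemma Rint_mono (A B : set T2) (u : R * R -> R) : measurable A -> measurable B ->
  A `<=` B -> mu.-integrable B (EFin \o u) -> (forall x, 0 <= u x) ->
  \int[mu]_(x in A) u x <= \int[mu]_(x in B) u x.
Proof.
move=> mA mB AB iu u0; apply: fine_le.
- by apply: integrable_fin_num => //; exact: integrableS iu.
- exact: integrable_fin_num.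
apply: ge0_subset_integral => //; first by have [] := integrableP _ _ _ iu.
by move=> x _; rewrite lee_fin.
Qed.

(** The Cauchy-Schwarz inequality follows from its linearisation in a free
    parameter, here optimised. *)
Lemma sqr_le_of_amgm (x m G : R) : 0 <= x -> 0 <= m -> 0 <= G ->
  (forall l, 0 < l -> 2 * x <= l * m + l^-1 * G) -> x ^+ 2 <= m * G.
Proof.
move=> x0 m0 G0 h; have [->|xp] := eqVneq x 0; first by rewrite expr0n/= mulr_ge0.
have {}xp : 0 < x by rewrite lt_neqAle eq_sym xp.
have [mE|mp] := eqVneq m 0.
  (* For m = 0 any parameter larger than G / (2 x) is contradictory. *)
  have lp : 0 < G / x + 1 by rewrite ltr_wpDl// divr_ge0.
  have := h _ lp; rewrite mE mulr0 add0r mul0r => h1.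
  exfalso; move: h1; rewrite leNgt => /negP; apply.
  rewrite mulrC ltr_pdivrMr//.
  have -> : 2 * x * (G / x + 1) = 2 * G + 2 * x by field; rewrite gt_eqF.
  lra.
have {}mp : 0 < m by rewrite lt_neqAle eq_sym mp.
(* The optimal parameter is x / m. *)
have lp : 0 < x / m by rewrite divr_gt0.
have := h _ lp; have -> : x / m * m = x by field; rewrite gt_eqF.
rewrite invf_div => h1.
have h2 : x <= m / x * G by lra.
by rewrite expr2 -ler_pdivlMr//; move: h2; rewrite mulrAC.
Qed.

Lemma cauchy_schwarz_fin (D : set T2) (v u : R * R -> R) : measurable D ->
  (mu D < +oo)%E -> mu.-integrable D (EFin \o v) -> mu.-integrable D (EFin \o u) ->
  (forall x, v x ^+ 2 <= u x) ->
  (\int[mu]_(x in D) `|v x|) ^+ 2 <= fine (mu D) * \int[mu]_(x in D) u x.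
Proof.
move=> mD fD iv iu vu.
have u0 x : 0 <= u x by rewrite (le_trans _ (vu x))// sqr_ge0.
apply: sqr_le_of_amgm.
- by apply: Rintegral_ge0 => x _.
- by rewrite fine_ge0.
- by apply: Rintegral_ge0 => x _.
move=> l l0.
have i1 : mu.-integrable D (EFin \o fun=> l) by exact: cst_integrable_fin.
have iav : mu.-integrable D (EFin \o fun x => `|v x|) by exact: integrable_norm.
have i2 : mu.-integrable D (EFin \o fun x => l^-1 * u x).
  exact: (integrableZl mD l^-1 iu).
rewrite -(@Rintegral_cst _ _ _ mu D mD).
rewrite -(RintegralZl l^-1 mD iu) -(RintegralZl 2 mD iav) -(RintegralD mD i1 i2).
apply: le_Rintegral => //.
- exact: (integrableZl mD 2 iav).
- exact: (integrableD mD i1 i2).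
move=> x _.
have h := vu x; rewrite -real_normK ?num_real// in h.
have h2 : l^-1 * `|v x| ^+ 2 <= l^-1 * u x by rewrite ler_pM2l// invr_gt0.
apply: le_trans (lerD (lexx l) h2).
have -> : l + l^-1 * `|v x| ^+ 2 = 2 * `|v x| + l^-1 * (l - `|v x|) ^+ 2.
  by field; rewrite gt_eqF.
by rewrite lerDl mulr_ge0 ?sqr_ge0// invr_ge0 ltW.
Qed.

Record rect := Rect { rl : R ; rr : R ; rb : R ; rt : R }.
Implicit Types Q : rect.

(** Half-open, so that the four halves of a rectangle partition it exactly. *)
Definition rset Q : set T2 := `[rl Q, rr Q[ `*` `[rb Q, rt Q[.
Definition wd Q := rr Q - rl Q.
Definition ht Q := rt Q - rb Q.
Definition area Q := wd Q * ht Q.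
Definition proper Q := rl Q < rr Q /\ rb Q < rt Q.
Definition avg (f : R * R -> R) Q : R := (\int[mu]_(x in rset Q) f x) / area Q.
Definition En (u : R * R -> R) Q : R := \int[mu]_(x in rset Q) u x.

Lemma rsetE Q : rset Q = box true `[rl Q, rr Q[ `[rb Q, rt Q[.
Proof. by rewrite boxE. Qed.

Lemma rset_measurable Q : measurable (rset Q).
Proof. by apply: measurableX; exact: measurable_itv. Qed.

Lemma rset_measure Q : proper Q -> mu (rset Q) = (area Q)%:E.
Proof.
move=> [h1 h2]; rewrite rsetE box_measure ?lebesgue_measure_itv/= ?lte_fin ?h1 ?h2//.
Qed.

Lemma area_gt0 Q : proper Q -> 0 < area Q.
Proof. by move=> [h1 h2]; rewrite mulr_gt0 ?subr_gt0. Qed.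

Lemma line_null pr (a : R) : mu (box pr [set a] setT) = 0%E.
Proof. by rewrite box_measure// lebesgue_measure_set1 mul0e. Qed.

Lemma Rint_open_box f pr a b c d :
  mu.-integrable (box pr `[a, b[ `[c, d[) (EFin \o f) ->
  \int[mu]_(x in box pr `[a, b[ `[c, d[) f x = \int[mu]_(x in box pr `]a, b[ `]c, d[) f x.
Proof.
move=> fi; rewrite /Rintegral; congr fine.
have m1 (q : bool) (s : R) : measurable (box q [set s] setT) by apply: box_measurable.
pose N := box pr [set a] setT `|` box (~~ pr) [set c] setT.
have mN : measurable N by exact: measurableU.
rewrite (negligible_integral mN _ fi); last 2 first.
- by apply: box_measurable; exact: measurable_itv.
- by apply/null_set_setU => //; exact: line_null.
congr (integral _ _ _); apply/seteqP; split => x.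
  move=> [[]] /=; rewrite !in_itv/= => /andP[h1 h1'] /andP[h2 h2'] h.
  split; rewrite /= in_itv/= ?h1' ?h2' andbT lt_neqAle ?h1 ?h2 andbT; apply/eqP => e; apply: h.
    by left; split => //=.
  by right; split => //=.
move=> [] /=; rewrite !in_itv/= => /andP[h1 h2] /andP[h3 h4]; split.
  by split; rewrite /= in_itv/= ?(ltW h1) ?(ltW h3).
by move=> [[/= e _]|[/= e _]]; [rewrite e ltxx in h1|rewrite e ltxx in h3].
Qed.

(** What the proof needs to know about a function f with |grad f|^2 = u: its
    means over two rectangles of the same strip differ by at most the energy of
    the strip, up to the shape of the strip.  Derivatives do not occur, and both
    directions are listed. *)
Definition tame (f u : R * R -> R) : Prop :=
  [/\ measurable_fun (setT : set T2) f /\ (forall x, 0 <= u x),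
      (forall s t s' t', mu.-integrable (box true `[s, t] `[s', t']) (EFin \o f)),
      mu.-integrable setT (EFin \o u),
      (forall a1 b1 a2 b2 c d h0 h1, h0 <= a1 -> a1 < b1 -> b1 <= h1 ->
        h0 <= a2 -> a2 < b2 -> b2 <= h1 -> c < d ->
        (avg f (Rect a1 b1 c d) - avg f (Rect a2 b2 c d)) ^+ 2 <=
        (h1 - h0) / (d - c) * En u (Rect h0 h1 c d)) &
      (forall a1 b1 a2 b2 c d h0 h1, h0 <= a1 -> a1 < b1 -> b1 <= h1 ->
        h0 <= a2 -> a2 < b2 -> b2 <= h1 -> c < d ->
        (avg f (Rect c d a1 b1) - avg f (Rect c d a2 b2)) ^+ 2 <=
        (h1 - h0) / (d - c) * En u (Rect c d h0 h1))].

Lemma step_box (f : R * R -> R) g u pr a1 b1 a2 b2 c d h0 h1 :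
  is_weak_gradient setT f g -> loc_square_integrable setT f ->
  mu.-integrable setT (EFin \o u) -> (forall x, (coord pr (g x)) ^+ 2 <= u x) ->
  h0 <= a1 -> a1 < b1 -> b1 <= h1 -> h0 <= a2 -> a2 < b2 -> b2 <= h1 -> c < d ->
  (\int[mu]_(x in box pr `[a1, b1[ `[c, d[) f x / ((b1 - a1) * (d - c)) -
   \int[mu]_(x in box pr `[a2, b2[ `[c, d[) f x / ((b2 - a2) * (d - c))) ^+ 2 <=
  (h1 - h0) / (d - c) * \int[mu]_(x in box pr `[h0, h1[ `[c, d[) u x.
Proof.
move=> wg lf iu gu ha1 hab1 hb1 ha2 hab2 hb2 cd.
have fi s t s' t' : mu.-integrable (box pr `[s, t[ `[s', t'[) (EFin \o f).
  apply: (integrableS _ _ _ (loc_square_integrable_box pr s t s' t' lf)).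
  - by apply: box_measurable; exact: measurable_itv.
  - by apply: box_measurable; exact: measurable_itv.
  - by apply: box_sub; exact: subset_itv_co_cc.
rewrite !(@Rint_open_box f)//.
have mo : measurable (box pr `]h0, h1[ `]c, d[) by apply: box_measurable; exact: measurable_itv.
have mc : measurable (box pr `[h0, h1[ `[c, d[) by apply: box_measurable; exact: measurable_itv.
have := step_integral pr c d wg lf ha1 (ltW hab1) hb1 ha2 (ltW hab2) hb2.
set I1 := \int[mu]_(x in box pr `]a1, b1[ `]c, d[) f x.
set I2 := \int[mu]_(x in box pr `]a2, b2[ `]c, d[) f x.
set G := \int[mu]_(x in box pr `]h0, h1[ `]c, d[) `|coord pr (g x)| => st.
have h01 : h0 < h1 by lra.
have moE : mu (box pr `]h0, h1[ `]c, d[) = ((h1 - h0) * (d - c))%:E.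
  by rewrite box_measure// !lebesgue_measure_itv/= !lte_fin h01 cd.
have ig : mu.-integrable (box pr `]h0, h1[ `]c, d[) (EFin \o (fun x => coord pr (g x))).
  have [g1 g2 _] := wg.
  apply: (@integrableS _ _ _ mu (box pr `[h0, h1] `[c, d])) => //.
  - by apply: box_measurable; exact: measurable_itv.
  - by apply: box_sub; exact: subset_itv_oo_cc.
  - by case: (pr); [exact: (loc_integrable_box _ _ _ _ _ g1)|exact: (loc_integrable_box _ _ _ _ _ g2)].
have cs := cauchy_schwarz_fin mo _ ig (integrableS measurableT mo (@subsetT _ _) iu) gu.
rewrite moE ltry in cs; have {}cs := cs isT; rewrite -/G /= in cs.
have mono : \int[mu]_(x in box pr `]h0, h1[ `]c, d[) u x <=
    \int[mu]_(x in box pr `[h0, h1[ `[c, d[) u x.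
  apply: Rint_mono => //.
  - by apply: box_sub; exact: subset_itv_oo_co.
  - exact: integrableS iu.
  - by move=> x; rewrite (le_trans _ (gu x))// sqr_ge0.
set U' := \int[mu]_(x in box pr `]h0, h1[ `]c, d[) u x in cs mono.
set U := \int[mu]_(x in box pr `[h0, h1[ `[c, d[) u x in mono *.
have p1 : 0 < b1 - a1 by rewrite subr_gt0.
have p2 : 0 < b2 - a2 by rewrite subr_gt0.
have pd : 0 < d - c by rewrite subr_gt0.
have ph : 0 < h1 - h0 by rewrite subr_gt0.
set x1 := b1 - a1 in p1 st *; set x2 := b2 - a2 in p2 st *.
set y := d - c in pd cs *; set z := h1 - h0 in ph cs *.
have -> : I1 / (x1 * y) - I2 / (x2 * y) = (x2 * I1 - x1 * I2) / (x1 * x2 * y).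
  by field; rewrite !gt_eqF.
have G0 : 0 <= G by apply: Rintegral_ge0 => x _.
have : (x2 * I1 - x1 * I2) ^+ 2 <= (x1 * x2 * G) ^+ 2.
  by rewrite -[leLHS]real_normK ?num_real// lerXn2r// nnegrE// !mulr_ge0// ltW.
rewrite expr_div_n ler_pdivrMr ?exprn_gt0 ?mulr_gt0// => /le_trans; apply.
have -> : z / y * U * (x1 * x2 * y) ^+ 2 = (x1 * x2) ^+ 2 * (z * y * U).
  by field; rewrite gt_eqF.
rewrite exprMn ler_wpM2l ?sqr_ge0//; apply: (le_trans cs).
by rewrite ler_wpM2l// mulr_ge0// ltW.
Qed.

Lemma tame_weak (f : R * R -> R) g u :
  is_weak_gradient setT f g -> loc_square_integrable setT f ->
  mu.-integrable setT (EFin \o u) -> (forall x, u x = euclid (g x) ^+ 2) ->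
  tame f u.
Proof.
move=> wg lf iu uE.
have uE' x : u x = (g x).1 ^+ 2 + (g x).2 ^+ 2.
  by rewrite uE sqr_sqrtr// addr_ge0 ?sqr_ge0.
have gu pr x : coord pr (g x) ^+ 2 <= u x.
  by rewrite uE'; case: pr; [rewrite lerDl sqr_ge0|rewrite lerDr sqr_ge0].
split => //.
- by split; [case: lf|move=> x; rewrite uE sqr_ge0].
- by move=> *; exact: loc_square_integrable_box.
- move=> *; rewrite /avg /En /area !rsetE; exact: (step_box wg lf iu (gu true)).
- move=> a1 b1 a2 b2 c d h0 h1 *; rewrite /avg /En /area !rsetE.
  have e s t s' t' : box true `[s, t[ `[s', t'[ = box false `[s', t'[ `[s, t[ :> set T2.
    by rewrite !boxE.
  rewrite /= !e /wd /ht /= !(mulrC (d - c)); exact: (step_box wg lf iu (gu false)).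
Qed.

End Rect.

(** * Dyadic subdivision and a discrete Sobolev inequality *)
Section Dyadic.
Context {R : realType}.
Local Notation mu := (plane_measure R).
Local Notation T2 := (measurableTypeR R * measurableTypeR R)%type.
Implicit Types Q : rect (R := R).

Definition midx Q := (rl Q + rr Q) / 2.
Definition midy Q := (rb Q + rt Q) / 2.

Definition child Q (i j : bool) : rect :=
  Rect (if i then midx Q else rl Q) (if i then rr Q else midx Q)
       (if j then midy Q else rb Q) (if j then rt Q else midy Q).

Definition sum4 (F : rect -> R) Q : R :=
  F (child Q false false) + F (child Q false true) +
  F (child Q true false) + F (child Q true true).

Lemma child_proper Q i j : proper Q -> proper (child Q i j).
Proof. by rewrite /proper /child /midx /midy => -[]; case: i; case: j => /=; lra. Qed.

Lemma child_wd Q i j : wd (child Q i j) = wd Q / 2.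
Proof. by rewrite /wd /child /midx; case: i => /=; lra. Qed.

Lemma child_ht Q i j : ht (child Q i j) = ht Q / 2.
Proof. by rewrite /ht /child /midy; case: j => /=; lra. Qed.

Lemma child_area Q i j : area (child Q i j) = area Q / 4.
Proof. by rewrite /area child_wd child_ht; field. Qed.

(** Bounded eccentricity, inherited by the four quarters; it makes the constants
    below absolute. *)
Definition fat Q := [/\ proper Q, wd Q <= 4 * ht Q & ht Q <= 4 * wd Q].

Lemma child_fat Q i j : fat Q -> fat (child Q i j).
Proof.
by move=> [h1 h2 h3]; split; rewrite ?child_wd ?child_ht; [exact: child_proper|lra|lra].
Qed.

Lemma child_sub Q i j : proper Q -> rset (child Q i j) `<=` rset Q.
Proof.
move=> [h1 h2] x [] /=; rewrite /rset /midx /midy !in_itv/= => /andP[a b] /andP[c d].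
split; rewrite /= in_itv/=; apply/andP; split; move: a b c d; case: i; case: j => /=; lra.
Qed.

Lemma child_in Q x : rset Q x ->
  rset (child Q (midx Q <= x.1) (midy Q <= x.2)) x.
Proof.
move=> [] /=; rewrite !in_itv/= => /andP[a b] /andP[c d].
by split; rewrite /= in_itv/=; [have [h|h] := leP (midx Q) x.1|have [h|h] := leP (midy Q) x.2];
  rewrite ?h ?a ?b ?c ?d.
Qed.

Lemma child_loc Q i j x : proper Q -> rset (child Q i j) x ->
  i = (midx Q <= x.1) /\ j = (midy Q <= x.2).
Proof.
move=> [h1 h2] [] /=; rewrite !in_itv/= => /andP[a b] /andP[c d]; split.
  by case: i a b => a b; rewrite ?a // leNgt b.
by case: j c d => c d; rewrite ?c // leNgt d.
Qed.

Lemma rset_children Q : proper Q -> rset Q =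
  (rset (child Q false false) `|` rset (child Q false true)) `|`
  (rset (child Q true false) `|` rset (child Q true true)).
Proof.
move=> pQ; apply/seteqP; split => x.
  by move/child_in; case: (midx Q <= x.1); case: (midy Q <= x.2) => ?;
    [right; right|right; left|left; right|left; left].
by move=> [[]|[]]; exact: child_sub.
Qed.

Lemma child_disj Q i j i' j' : proper Q -> (i, j) != (i', j') ->
  [disjoint rset (child Q i j) & rset (child Q i' j')].
Proof.
move=> pQ ne; apply/disj_setPS => x [/(child_loc pQ)[e1 e2] /(child_loc pQ)[e3 e4]].
by move: ne; rewrite e1 e2 e3 e4 eqxx.
Qed.

Lemma disjU (A B C : set T2) : [disjoint A & C] -> [disjoint B & C] ->
  [disjoint A `|` B & C].
Proof.
move=> /disj_setPS h1 /disj_setPS h2; apply/disj_setPS => x [[Ax|Bx] Cx].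
  exact: (h1 x).
exact: (h2 x).
Qed.

Lemma disjC (A B : set T2) : [disjoint A & B] -> [disjoint B & A].
Proof. by rewrite disj_set_sym. Qed.

Lemma child_disj4 Q : proper Q ->
  [disjoint rset (child Q false false) `|` rset (child Q false true) &
            rset (child Q true false) `|` rset (child Q true true)].
Proof.
by move=> pQ; apply: disjU; apply: disjC; apply: disjU; exact: child_disj.
Qed.

Lemma ge0_int_children (phi : T2 -> \bar R) Q : proper Q ->
  measurable_fun (rset Q) phi -> (forall x, rset Q x -> 0 <= phi x)%E ->
  (\int[mu]_(x in rset Q) phi x =
   \int[mu]_(x in rset (child Q false false)) phi x +
   \int[mu]_(x in rset (child Q false true)) phi x +
   (\int[mu]_(x in rset (child Q true false)) phi x +
   \int[mu]_(x in rset (child Q true true)) phi x))%E.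
Proof.
move=> pQ mphi p0; have e := rset_children pQ.
have mr := @rset_measurable R.
have sub (A : set T2) : A `<=` rset Q -> measurable A -> measurable_fun A phi.
  by move=> h mA; exact: (measurable_funS (rset_measurable Q) h).
have cs i j := @child_sub Q i j pQ.
rewrite e ge0_integral_setU//; last 5 first.
- exact: measurableU.
- exact: measurableU.
- by rewrite -e.
- by move=> x; rewrite -e; exact: p0.
- exact: child_disj4.
by rewrite !ge0_integral_setU//; (try exact: child_disj);
  (try (apply: sub; [by move=> x []; exact: cs|exact: measurableU]));
  move=> x []/cs; exact: p0.
Qed.

Lemma Rint_children (f : R * R -> R) Q : proper Q ->
  mu.-integrable (rset Q) (EFin \o f) ->
  \int[mu]_(x in rset Q) f x = sum4 (fun Q' => \int[mu]_(x in rset Q') f x) Q.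
Proof.
move=> pQ fi; have e := rset_children pQ.
have mr := @rset_measurable R.
have sub (A : set T2) : A `<=` rset Q -> measurable A -> mu.-integrable A (EFin \o f).
  by move=> h mA; exact: integrableS fi.
have cs i j := @child_sub Q i j pQ.
rewrite {1}e Rintegral_setU//; last 4 first.
- exact: measurableU.
- exact: measurableU.
- by rewrite -e.
- exact: child_disj4.
rewrite !Rintegral_setU//; (try exact: child_disj);
  (try (apply: sub; [by move=> x []; exact: cs|exact: measurableU])).
by rewrite /sum4 !addrA.
Qed.

Section Tame.
Variables f u : R * R -> R.
Hypothesis tfu : tame f u.

Lemma tame_int Q : mu.-integrable (rset Q) (EFin \o f).
Proof.
have [_ fi _ _ _] := tfu.
apply: integrableS (fi (rl Q) (rr Q) (rb Q) (rt Q)).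
- by apply: box_measurable; exact: measurable_itv.
- exact: rset_measurable.
- by rewrite rsetE; apply: box_sub; exact: subset_itv_co_cc.
Qed.

Lemma tame_u_int D : measurable D -> mu.-integrable D (EFin \o u).
Proof. by have [_ _ iu _ _] := tfu => mD; exact: integrableS iu. Qed.

Lemma En_ge0 Q : 0 <= En u Q.
Proof. by have [[_ u0] _ _ _ _] := tfu; apply: Rintegral_ge0 => x _. Qed.

Lemma En_mono Q Q' : rset Q `<=` rset Q' -> En u Q <= En u Q'.
Proof.
have [[_ u0] _ _ _ _] := tfu.
move=> h; apply: Rint_mono => //; try exact: rset_measurable.
by apply: tame_u_int; exact: rset_measurable.
Qed.

Lemma En_children Q : proper Q -> En u Q = sum4 (En u) Q.
Proof.
by move=> pQ; apply: Rint_children => //; apply: tame_u_int; exact: rset_measurable.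
Qed.

(** The horizontal strip of the quarter is an intermediate rectangle: one
    horizontal and one vertical step, with 24 = 2 (8 + 4). *)
Lemma avg_child Q i j : fat Q -> (avg f (child Q i j) - avg f Q) ^+ 2 <= 24 * En u Q.
Proof.
move=> [[h1 h2] h3 h4]; have [_ _ _ sx sy] := tfu.
have pQ : proper Q by [].
set Q1 := Rect (rl Q) (rr Q) (rb (child Q i j)) (rt (child Q i j)).
have cp := child_proper i j pQ; have [c1 c2] := cp.
have hw := child_wd Q i j; have hh := child_ht Q i j.
rewrite /wd in h3 h4 hw; rewrite /ht in h3 h4 hh.
have cb : [/\ rl Q <= rl (child Q i j), rr (child Q i j) <= rr Q,
   rb Q <= rb (child Q i j) & rt (child Q i j) <= rt Q].
  by rewrite /child /midx /midy; case: (i); case: (j) => /=; split; lra.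
have [b1 b2 b3 b4] := cb.
have EQ1 : En u Q1 <= En u Q.
  apply: En_mono => x [] /=; rewrite /rset !in_itv/= => /andP[p q] /andP[r s].
  by split; rewrite /= in_itv/= ?p ?q//=; apply/andP; split; [exact: le_trans b3 r|exact: lt_le_trans s b4].
have s1 : (avg f (child Q i j) - avg f Q1) ^+ 2 <= 8 * En u Q.
  have := sx _ _ (rl Q) (rr Q) (rb (child Q i j)) (rt (child Q i j)) (rl Q) (rr Q) b1 c1 b2 (lexx _) h1 (lexx _) c2.
  move=> /le_trans; apply; apply: ler_pM => //; rewrite ?En_ge0//.
    by rewrite divr_ge0// subr_ge0; lra.
  by rewrite hh ler_pdivrMr; lra.
have s2 : (avg f Q1 - avg f Q) ^+ 2 <= 4 * En u Q.
  have := sy _ _ (rb Q) (rt Q) (rl Q) (rr Q) (rb Q) (rt Q) b3 c2 b4 (lexx _) h2 (lexx _) h1.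
  have -> : Rect (rl Q) (rr Q) (rb Q) (rt Q) = Q by case: (Q).
  move=> /le_trans; apply; apply: ler_pM => //; rewrite ?En_ge0//.
    by rewrite divr_ge0// subr_ge0; lra.
  by rewrite ler_pdivrMr; lra.
have := sqr_ge0 ((avg f (child Q i j) - avg f Q1) - (avg f Q1 - avg f Q)).
nra.
Qed.

(** The mean of f over the rectangle of generation n that contains x. *)
Fixpoint dyad (n : nat) Q (x : R * R) : R :=
  if n is n'.+1 then dyad n' (child Q (midx Q <= x.1) (midy Q <= x.2)) x
  else avg f Q.

Lemma dyadS n Q i j x : proper Q -> rset (child Q i j) x ->
  dyad n.+1 Q x = dyad n (child Q i j) x.
Proof. by move=> pQ /(child_loc pQ)[-> ->]. Qed.

Lemma dyad_measurable n Q : measurable_fun (setT : set T2) (dyad n Q).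
Proof.
elim: n Q => [|n IH] Q; first exact: measurable_cst.
have -> : dyad n.+1 Q = fun x => if midx Q <= x.1 then
   (if midy Q <= x.2 then dyad n (child Q true true) x else dyad n (child Q true false) x)
  else (if midy Q <= x.2 then dyad n (child Q false true) x else dyad n (child Q false false) x).
  by apply/funext => x /=; case: ifP; case: ifP.
have m1 : measurable_fun (setT : set T2) (fun x : T2 => midx Q <= x.1).
  by apply: measurable_fun_ler => //; exact: measurable_fst.
have m2 : measurable_fun (setT : set T2) (fun x : T2 => midy Q <= x.2).
  by apply: measurable_fun_ler => //; exact: measurable_snd.
by apply: measurable_fun_ifT => //; apply: measurable_fun_ifT.
Qed.

Section Weight.
Variables (w : R * R -> R) (J : rect (R := R) -> R) (theta : R).
Hypotheses (mw : measurable_fun (setT : set T2) w) (w0 : forall x, 0 <= w x).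
Hypothesis (th0 : 0 <= theta) (th1 : theta < 1).
Hypothesis Jw : forall Q, proper Q -> (\int[mu]_(x in rset Q) (w x)%:E <= (J Q)%:E)%E.
Hypothesis Jchild : forall Q i j, proper Q -> J (child Q i j) <= theta * J Q.

Definition sobC : R := 96 * (1 + (1 - theta)^-1) / (1 - theta) ^+ 2.

Lemma sobC_gt0 : 0 < sobC.
Proof.
have k0 : 0 < 1 - theta by rewrite subr_gt0.
by rewrite /sobC divr_gt0 ?exprn_gt0// mulr_gt0// addr_gt0// invr_gt0.
Qed.

Lemma J_ge0 Q : proper Q -> 0 <= J Q.
Proof.
move=> pQ; rewrite -lee_fin; apply: le_trans (Jw pQ).
by apply: integral_ge0 => x _; rewrite lee_fin.
Qed.

Lemma wsq_measurable Q n c D : measurable_fun D (fun x : T2 => (w x * (dyad n Q x - c) ^+ 2)%:E).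
Proof.
apply: measurable_funTS; apply/measurable_EFinP; apply: measurable_funM => //.
by apply: measurable_funX; apply: measurable_funB => //; exact: dyad_measurable.
Qed.

(** Each generation costs [24 * En u Q * J Q], while the weights of the quarters
    have dropped by the factor theta.  Splitting the square with the factors
    2 - theta and 1 + 1 / (1 - theta) keeps the recursion contracting, because
    (2 - theta) theta = 1 - (1 - theta)^2. *)
Lemma sobolev_dyad n Q : fat Q ->
  (\int[mu]_(x in rset Q) (w x * (dyad n Q x - avg f Q) ^+ 2)%:E <=
   (sobC * J Q * En u Q)%:E)%E.
Proof.
have k0 : 0 < 1 - theta by rewrite subr_gt0.
elim: n Q => [|n IH] Q fQ; have [pQ _ _] := fQ.
  under eq_integral => x _ do rewrite /= subrr expr0n/= mulr0.
  by rewrite integral0 lee_fin; apply: mulr_ge0 (En_ge0 _); apply: mulr_ge0 (J_ge0 pQ); exact: ltW sobC_gt0.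
have step i j : (\int[mu]_(x in rset (child Q i j)) (w x * (dyad n.+1 Q x - avg f Q) ^+ 2)%:E <=
   ((2 - theta) * (sobC * (theta * J Q) * En u (child Q i j)) +
    (1 + (1 - theta)^-1) * (24 * En u Q * J Q))%:E)%E.
  have fQ' := child_fat i j fQ; have [pQ' _ _] := fQ'.
  have mQ' := rset_measurable (child Q i j).
  set A := (avg f (child Q i j) - avg f Q) ^+ 2.
  have A0 : 0 <= A by exact: sqr_ge0.
  apply: (@le_trans _ _ (\int[mu]_(x in rset (child Q i j))
     ((2 - theta)%:E * (w x * (dyad n (child Q i j) x - avg f (child Q i j)) ^+ 2)%:E +
      ((1 + (1 - theta)^-1) * A)%:E * (w x)%:E))%E).
    apply: ge0_le_integral => //.
    - by move=> x _; rewrite lee_fin mulr_ge0// sqr_ge0.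
    - exact: wsq_measurable.
    - apply: emeasurable_funD; apply: emeasurable_funM => //; first exact: wsq_measurable.
      by apply: measurable_funTS; apply/measurable_EFinP.
    move=> x xQ'; rewrite (dyadS _ pQ xQ') -!EFinM -EFinD lee_fin /A.
    set p := dyad n _ x; set q := avg f (child Q i j); set r := avg f Q.
    have -> : (2 - theta) * (w x * (p - q) ^+ 2) + (1 + (1 - theta)^-1) * (q - r) ^+ 2 * w x
      = w x * ((2 - theta) * (p - q) ^+ 2 + (1 + (1 - theta)^-1) * (q - r) ^+ 2) by ring.
    rewrite ler_wpM2l//.
    have -> : (2 - theta) * (p - q) ^+ 2 + (1 + (1 - theta)^-1) * (q - r) ^+ 2
       = (p - r) ^+ 2 + (1 - theta)^-1 * ((1 - theta) * (p - q) - (q - r)) ^+ 2.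
      by field; rewrite gt_eqF.
    by rewrite lerDl mulr_ge0 ?sqr_ge0// invr_ge0 ltW.
  have th2 : 0 <= 2 - theta by lra.
  have c0 : 0 <= 1 + (1 - theta)^-1 by rewrite addr_ge0// invr_ge0 ltW.
  rewrite ge0_integralD//; last 4 first.
  - move=> x _; rewrite -EFinM lee_fin; apply: mulr_ge0 => //; apply: mulr_ge0 => //; exact: sqr_ge0.
  - by apply: emeasurable_funM => //; exact: wsq_measurable.
  - by move=> x _; rewrite -EFinM lee_fin; apply: mulr_ge0 => //; apply: mulr_ge0 => //; exact: sqr_ge0.
  - by apply: emeasurable_funM => //; apply: measurable_funTS; apply/measurable_EFinP.
  have z1 : (\int[mu]_(x in rset (child Q i j)) ((2 - theta)%:E *
      (w x * (dyad n (child Q i j) x - avg f (child Q i j)) ^+ 2)%:E) =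
      (2 - theta)%:E * \int[mu]_(x in rset (child Q i j))
      (w x * (dyad n (child Q i j) x - avg f (child Q i j)) ^+ 2)%:E)%E.
    rewrite ge0_integralZl_EFin//; last exact: wsq_measurable.
    by move=> x _; rewrite lee_fin mulr_ge0// sqr_ge0.
  have z2 : (\int[mu]_(x in rset (child Q i j)) (((1 + (1 - theta)^-1) * A)%:E *
      (w x)%:E) = ((1 + (1 - theta)^-1) * A)%:E * \int[mu]_(x in rset (child Q i j)) (w x)%:E)%E.
    rewrite ge0_integralZl_EFin//; first last.
    - by rewrite mulr_ge0.
    - by apply: measurable_funTS; apply/measurable_EFinP.
    - by move=> x _; rewrite lee_fin.
  rewrite z1 z2.
  rewrite [X in (_ <= X)%E]EFinD; apply: leeD.
    rewrite [X in (_ <= X)%E]EFinM; apply: lee_wpmul2l; first by rewrite lee_fin.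
    apply: (le_trans (IH _ fQ')); rewrite lee_fin ler_wpM2r ?En_ge0//.
    by apply: ler_wpM2l; [exact: ltW sobC_gt0|exact: Jchild].
  apply: (le_trans (lee_wpmul2l _ (Jw pQ'))); first by rewrite lee_fin mulr_ge0.
  rewrite -EFinM lee_fin -[leLHS]mulrA; apply: ler_wpM2l => //; apply: ler_pM => //.
  - exact: J_ge0.
  - exact: avg_child.
  - by apply: (le_trans (Jchild _ _ pQ)); rewrite ler_piMl ?J_ge0// ltW.
rewrite ge0_int_children//; last 2 first.
- exact: (@wsq_measurable Q n.+1).
- by move=> x _; rewrite lee_fin mulr_ge0// sqr_ge0.
apply: (le_trans (leeD (leeD (step _ _) (step _ _)) (leeD (step _ _) (step _ _)))).
rewrite -!EFinD lee_fin.
have eE := En_children pQ; rewrite /sum4 in eE.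
set e1 := En u (child Q false false) in eE *; set e2 := En u (child Q false true) in eE *.
set e3 := En u (child Q true false) in eE *; set e4 := En u (child Q true true) in eE *.
(* The room left by the contraction pays for the four quarters: 96 = 4 * 24. *)
have hC : sobC * (1 - theta) ^+ 2 = 96 * (1 + (1 - theta)^-1).
  by rewrite /sobC mulfVK// expf_neq0// gt_eqF.
have -> : sobC * J Q * En u Q =
    (2 - theta) * theta * sobC * J Q * En u Q + sobC * (1 - theta) ^+ 2 * J Q * En u Q.
  ring.
rewrite hC le_eqVlt; apply/orP; left; apply/eqP; rewrite eE; ring.
Qed.

End Weight.
End Tame.
End Dyadic.

(** * Integrable functions are determined by their integrals over quadrants *)
Section Uniqueness.
Context {R : realType}.
Local Notation mu := (plane_measure R).
Local Notation T2 := (measurableTypeR R * measurableTypeR R)%type.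
Variable h : T2 -> R.
Hypothesis ih : mu.-integrable setT (EFin \o h).

Let null (A : set T2) := (\int[mu]_(x in A) (h x)%:E = 0)%E.

Let ihS A : measurable A -> mu.-integrable A (EFin \o h).
Proof. by move=> mA; exact: integrableS ih. Qed.

(** The sets whose preimage has integral zero form a Dynkin system, so it is
    enough to look at a generating family stable under intersection.  Carrying
    the fixed set S along allows the use of one coordinate after the other. *)
Lemma null_preimage d (X : measurableType d) (G : set (set X)) (pi : T2 -> X) (S : set T2) :
  measurable_fun setT pi -> measurable S -> @measurable d X = <<s G >> -> setI_closed G ->
  null S -> (forall A, G A -> null (pi @^-1` A `&` S)) ->
  forall A, measurable A -> null (pi @^-1` A `&` S).
Proof.
move=> mpi mS GE GI S0 G0 A mA.
have mp B : measurable B -> measurable (pi @^-1` B `&` S).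
  by move=> mB; apply: measurableI => //; rewrite -[X in measurable X]setTI; exact: mpi.
apply: (@dynkin_induction _ X G (fun B => null (pi @^-1` B `&` S))) => //.
- by rewrite preimage_setT setTI.
- move=> B mB B0.
  have e : S = (pi @^-1` (~` B) `&` S) `|` (pi @^-1` B `&` S).
    by rewrite -setIUl -preimage_setU setvU preimage_setT setTI.
  have := S0; rewrite /null {1}e integral_setU//; first by rewrite B0 adde0.
  + by apply: mp; exact: measurableC.
  + exact: mp.
  + apply/measurable_EFinP; have [/measurable_EFinP mh _] := integrableP _ _ _ ih.
    exact: measurable_funTS.
  + by apply/disj_setPS => x [[nB _] [Bx _]]; exact: nB.
- move=> F mF tF F0; rewrite /null preimage_bigcup setI_bigcupl integral_bigcup//.
  + by rewrite eseries0 // => i _ _; exact: F0.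
  + apply/trivIsetP => i j _ _ ij; rewrite setIACA setIid -preimage_setI.
    by move/trivIsetP : tF => /(_ i j Logic.I Logic.I ij) ->; rewrite preimage_set0 set0I.
  + by move=> k; exact: mp.
  + by apply: ihS; apply: bigcupT_measurable => k; exact: mp.
by rewrite -GE.
Qed.

Definition quadrant (t s : R) : set T2 := [set x | x.1 < t /\ x.2 < s].

Lemma rays_setI : setI_closed (@RGenInftyO.G R).
Proof.
move=> _ _ [t ->] [s ->]; exists (Num.min t s).
apply/seteqP; split => x /=; rewrite !in_itv/= lt_min; first by move=> [-> ->].
by move=> /andP[].
Qed.

Lemma quadrants_null : null setT ->
  (forall s, null [set x | x.2 < s]) -> (forall t, null [set x | x.1 < t]) -> (forall t s, null (quadrant t s)) ->
  ae_eq mu setT (EFin \o h) (cst 0%E).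
Proof.
move=> hT hS hS' hq.
have ms s : measurable ([set x | x.2 < s] : set T2).
  rewrite (_ : mkset _ = snd @^-1` [set` `]-oo, s[]); last first.
    by apply/seteqP; split => x /=; rewrite in_itv.
  rewrite -[X in measurable X]setTI.
  by apply: (@measurable_snd _ _ (measurableTypeR R) (measurableTypeR R)).
have h1 s (A : set (measurableTypeR R)) : measurable A -> null (fst @^-1` A `&` [set x | x.2 < s]).
  apply: (@null_preimage _ (measurableTypeR R) (@RGenInftyO.G R)) => //;
    try exact: RGenInftyO.measurableE; try exact: rays_setI.
  move=> _ [t ->]; rewrite (_ : _ `&` _ = quadrant t s); first exact: hq.
  by apply/seteqP; split => x /=; rewrite in_itv/=.
have mfst (A : set (measurableTypeR R)) : measurable A -> measurable (fst @^-1` A : set T2).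
  by move=> mA; rewrite -[X in measurable X]setTI; exact: measurable_fst.
have h1' (A : set (measurableTypeR R)) : measurable A -> null (fst @^-1` A).
  move=> mA; rewrite -[X in null X]setIT.
  apply: (@null_preimage _ (measurableTypeR R) (@RGenInftyO.G R)) => //;
    try exact: RGenInftyO.measurableE; try exact: rays_setI.
  move=> _ [t ->]; rewrite setIT (_ : _ @^-1` _ = [set x | x.1 < t]); first exact: hS'.
  by apply/seteqP; split => x /=; rewrite in_itv/=.
have h2 (A B : set (measurableTypeR R)) : measurable A -> measurable B ->
    null (snd @^-1` B `&` (fst @^-1` A)).
  move=> mA mB; apply: (@null_preimage _ (measurableTypeR R) (@RGenInftyO.G R)) => //;
    try exact: RGenInftyO.measurableE; try exact: rays_setI; try exact: mfst; try exact: h1'.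
  move=> _ [s ->]; rewrite (_ : _ `&` _ = fst @^-1` A `&` [set x | x.2 < s]); first exact: h1.
  by rewrite setIC; congr (_ `&` _); apply/seteqP; split => x /=; rewrite in_itv/=.
apply: integral_ae_eq => //.
move=> E _ mE; rewrite integral0.
suff : null (id @^-1` E `&` setT) by rewrite setIT.
apply: (@null_preimage _ T2 [set A `*` B | A in @measurable _ (measurableTypeR R) &
    B in @measurable _ (measurableTypeR R)] id) => //.
- exact: measurable_prod_measurableType.
- move=> _ _ [A mA [B mB <-]] [A' mA' [B' mB' <-]].
  exists (A `&` A'); first exact: measurableI.
  by exists (B `&` B'); [exact: measurableI|rewrite setXI].
move=> _ [A mA [B mB <-]]; rewrite setIT.
rewrite (_ : _ @^-1` _ = snd @^-1` B `&` (fst @^-1` A)); first exact: h2.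
by apply/seteqP; split => x [].
Qed.

End Uniqueness.

(** * Almost everywhere convergence of the dyadic means *)
Section DyadCvg.
Context {R : realType}.
Local Notation mu := (plane_measure R).
Local Notation T2 := (measurableTypeR R * measurableTypeR R)%type.
Implicit Types Q : rect (R := R).

(** t is not interior to any of the 2^n equal parts of the interval from a to b:
    a quadrant with such a corner is a union of dyadic pieces inside the
    rectangle. *)
Fixpoint grid (n : nat) (a b t : R) : Prop :=
  if n is n'.+1 then grid n' a ((a + b) / 2) t /\ grid n' ((a + b) / 2) b t
  else t <= a \/ b <= t.

(** The largest number not above t with the property [grid]. *)
Fixpoint gridpt (n : nat) (a b t : R) : R :=
  if n is n'.+1 then
    if t < (a + b) / 2 then gridpt n' a ((a + b) / 2) t else gridpt n' ((a + b) / 2) b t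
  else if (t <= a) || (b <= t) then t else a.

Lemma grid_left n a b t : a <= b -> t <= a -> grid n a b t.
Proof.
elim: n a b => [|n IH] a b ab ta; first by left.
by split; apply: IH => //; lra.
Qed.

Lemma grid_right n a b t : a <= b -> b <= t -> grid n a b t.
Proof.
elim: n a b => [|n IH] a b ab bt; first by right.
by split; apply: IH => //; lra.
Qed.

Lemma gridpt_le n a b t : gridpt n a b t <= t.
Proof.
elim: n a b => [|n IH] a b /=; last by case: ifP.
by case: ifPn => // /norP[]; rewrite -!ltNge => /ltW.
Qed.

Lemma gridpt_ge n a b t : a <= b -> a <= t -> a <= gridpt n a b t.
Proof.
elim: n a b => [|n IH] a b ab at_ /=; first by case: ifP.
case: ifPn; first by move=> _; apply: IH => //; lra.
rewrite -leNgt => ht; apply: (@le_trans _ _ ((a + b) / 2)); first by lra.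
by apply: IH => //; lra.
Qed.

Lemma gridpt_grid n a b t : a <= b -> grid n a b (gridpt n a b t).
Proof.
elim: n a b => [|n IH] a b ab /=.
  by case: ifPn => [/orP[]|_]; [left|right|left].
case: ifPn => [h|]; first split.
- by apply: IH; lra.
- by apply: grid_left; [lra|exact: le_trans (gridpt_le _ _ _ _) (ltW h)].
rewrite -leNgt => h; split; last by apply: IH; lra.
by apply: grid_right; [lra|apply: gridpt_ge => //; lra].
Qed.

Lemma gridpt_near n a b t : a <= b -> t - gridpt n a b t <= (b - a) / 2 ^+ n.
Proof.
elim: n a b => [|n IH] a b ab /=.
  rewrite expr0 divr1; case: ifPn => [_|/norP[]]; first lra.
  by rewrite -!ltNge; lra.
have e : (b - a) / 2 ^+ n.+1 = ((a + b) / 2 - a) / 2 ^+ n.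
  by rewrite exprS; field; rewrite gt_eqF// exprn_gt0.
have e' : (b - a) / 2 ^+ n.+1 = (b - (a + b) / 2) / 2 ^+ n.
  by rewrite exprS; field; rewrite gt_eqF// exprn_gt0.
by case: ifP => _; [rewrite e|rewrite e']; apply: IH; lra.
Qed.

Lemma quadrant_measurable (t s : R) : measurable (quadrant t s).
Proof.
rewrite (_ : quadrant t s = `]-oo, t[ `*` `]-oo, s[).
  by apply: measurableX; exact: measurable_itv.
by apply/seteqP; split => x [] /=; [|]; rewrite ?in_itv//= => a b; split; rewrite /= ?in_itv//= ;
  move: b; rewrite in_itv.
Qed.

Section Tame.
Variables f u : R * R -> R.
Hypothesis tfu : tame f u.

Lemma dyad_bounded n Q : exists M, forall x, `|dyad f n Q x| <= M.
Proof.
elim: n Q => [|n IH] Q; first by exists `|avg f Q| => x.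
have [M1 h1] := IH (child Q false false); have [M2 h2] := IH (child Q false true).
have [M3 h3] := IH (child Q true false); have [M4 h4] := IH (child Q true true).
exists (Num.max (Num.max M1 M2) (Num.max M3 M4)) => x /=; rewrite !le_max.
by case: (_ <= x.1); case: (_ <= x.2); rewrite ?h1 ?h2 ?h3 ?h4 ?orbT.
Qed.

Lemma dyad_int n Q Q' : proper Q' -> mu.-integrable (rset Q') (EFin \o dyad f n Q).
Proof.
move=> pQ; have [M hM] := dyad_bounded n Q.
have fin : (mu (rset Q') < +oo)%E by rewrite rset_measure ?ltry.
have mQ' := rset_measurable Q'.
apply: le_integrable (cst_integrable_fin M mQ' fin) => //.
  by apply/measurable_EFinP; apply: measurable_funTS; exact: dyad_measurable.
by move=> x _ /=; rewrite lee_fin (le_trans (hM x))// ler_norm.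
Qed.

Lemma dyad_mean n Q : proper Q ->
  \int[mu]_(x in rset Q) dyad f n Q x = \int[mu]_(x in rset Q) f x.
Proof.
elim: n Q => [|n IH] Q pQ.
  rewrite [LHS](@Rintegral_cst _ _ _ mu _ (rset_measurable Q) (avg f Q)) [X in fine X](rset_measure pQ) /= /avg divfK//.
  by rewrite gt_eqF// area_gt0.
rewrite (@Rint_children _ f)//; last exact: (tame_int tfu).
rewrite (@Rint_children _ (dyad f n.+1 Q))//; last exact: dyad_int.
have e i j : \int[mu]_(x in rset (child Q i j)) dyad f n.+1 Q x =
    \int[mu]_(x in rset (child Q i j)) f x.
  rewrite -IH; last exact: child_proper.
  by apply: eq_Rintegral => x; rewrite inE => xQ; rewrite (dyadS _ _ pQ xQ).
by rewrite /sum4 !e.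
Qed.

Let patch_int Q g t s : mu.-integrable (rset Q) (EFin \o g) ->
  mu.-integrable (rset Q) (EFin \o (g \_ (quadrant t s) : T2 -> R)).
Proof.
move=> gi; rewrite -restrict_EFin.
have mq := quadrant_measurable t s.
have [mg _] := integrableP _ _ _ gi.
apply: le_integrable gi; first exact: rset_measurable.
- apply: ((measurable_restrict (EFin \o g) mq (rset_measurable Q)).1).
  by apply: (measurable_funS (rset_measurable Q)) mg => x [].
- by move=> x _; rewrite patchE; case: ifP => //= _; rewrite normr0 lee_fin.
Qed.

(** From generation N on, taking means inside the pieces of generation N does not
    change integrals over unions of such pieces. *)
Lemma dyad_grid N n Q t s : proper Q ->
  grid N (rl Q) (rr Q) t -> grid N (rb Q) (rt Q) s ->
  \int[mu]_(x in rset Q `&` quadrant t s) dyad f (N + n) Q x =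
  \int[mu]_(x in rset Q `&` quadrant t s) f x.
Proof.
elim: N Q => [|N IH] Q pQ; rewrite 2!(@Rintegral_mkcondr _ _ _ mu (rset Q)).
  move=> /= h1 h2.
  have [hq|hq] : rset Q `<=` quadrant t s \/ rset Q `&` quadrant t s = set0.
  - case: h1 => h1.
      right; apply/seteqP; split => // x [[]] /=; rewrite !in_itv/= => /andP[p _] _ [q _].
      by move: (le_lt_trans p (lt_le_trans q h1)); rewrite ltxx.
    case: h2 => h2.
      right; apply/seteqP; split => // x [[]] /=; rewrite !in_itv/= => _ /andP[p _] [_ q].
      by move: (le_lt_trans p (lt_le_trans q h2)); rewrite ltxx.
    left => x [] /=; rewrite !in_itv/= => /andP[_ p] /andP[_ q].
    by split; [exact: lt_le_trans p h1|exact: lt_le_trans q h2].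
  - transitivity (\int[mu]_(x in rset Q) dyad f n Q x).
      by apply: eq_Rintegral => x; rewrite inE => /hq xq; rewrite patchE mem_set.
    rewrite dyad_mean//.
    by apply: eq_Rintegral => x; rewrite inE => /hq xq; rewrite patchE mem_set.
  - rewrite -2!(@Rintegral_mkcondr _ _ _ mu (rset Q)) hq !Rintegral_set0//.
move=> /= [a1 a2] [b1 b2].
rewrite (@Rint_children _ (f \_ (quadrant t s)))//; last by apply: patch_int; exact: (tame_int tfu).
rewrite (@Rint_children _ ((dyad f (N.+1 + n) Q) \_ (quadrant t s)))//; last by apply: patch_int; exact: dyad_int.
have e i j : \int[mu]_(x in rset (child Q i j)) ((dyad f (N.+1 + n) Q) \_ (quadrant t s)) x =
    \int[mu]_(x in rset (child Q i j)) (f \_ (quadrant t s)) x.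
  rewrite -[RHS](@Rintegral_mkcondr _ _ _ mu (rset (child Q i j))) -IH; last 3 first.
  - exact: child_proper.
  - by case: (i).
  - by case: (j).
  rewrite (@Rintegral_mkcondr _ _ _ mu (rset (child Q i j))).
  apply: eq_Rintegral => x; rewrite inE => xQ; rewrite !patchE; case: ifP => // _.
  by rewrite addSn (dyadS _ _ pQ xQ).
by rewrite /sum4 !e.
Qed.

(** The squared jump on a piece is at most 24 times its energy, the energies of
    the pieces of one generation add up, and each piece has area 4^-n area Q. *)
Lemma incr_sq n Q : fat Q ->
  (\int[mu]_(x in rset Q) ((dyad f n.+1 Q x - dyad f n Q x) ^+ 2)%:E <=
   (24 * En u Q * area Q / 4 ^+ n)%:E)%E.
Proof.
have md m Q' Q'' D : measurable_fun D (fun x : T2 => ((dyad f m.+1 Q' x - dyad f m Q'' x) ^+ 2)%:E).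
  apply: measurable_funTS; apply/measurable_EFinP.
  by apply: measurable_funX; apply: measurable_funB; exact: dyad_measurable.
elim: n Q => [|n IH] Q fQ; have [pQ _ _] := fQ.
  rewrite expr0 divr1.
  apply: (@le_trans _ _ (\int[mu]_(x in rset Q) (24 * En u Q)%:E)%E).
    apply: ge0_le_integral => //; first exact: rset_measurable.
    - by move=> x _; rewrite lee_fin sqr_ge0.
    by move=> x _; rewrite lee_fin; exact: (avg_child tfu (midx Q <= x.1) (midy Q <= x.2) fQ).
  rewrite integral_cst; last exact: rset_measurable.
  by rewrite [X in (_ * X)%E](rset_measure pQ).
have step i j : (\int[mu]_(x in rset (child Q i j))
     ((dyad f n.+2 Q x - dyad f n.+1 Q x) ^+ 2)%:E <=
   (24 * En u (child Q i j) * (area Q / 4) / 4 ^+ n)%:E)%E.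
  rewrite -(child_area Q i j); apply: le_trans (IH _ (child_fat _ _ fQ)).
  rewrite le_eqVlt; apply/orP; left; apply/eqP; apply: eq_integral => x.
  by rewrite inE => xQ; rewrite !(dyadS _ _ pQ xQ).
rewrite ge0_int_children//; last by move=> x _; rewrite lee_fin sqr_ge0.
apply: (le_trans (leeD (leeD (step _ _) (step _ _)) (leeD (step _ _) (step _ _)))).
rewrite -!EFinD lee_fin (En_children tfu pQ) /sum4.
rewrite le_eqVlt; apply/orP; left; apply/eqP; rewrite exprS; field.
by rewrite gt_eqF// exprn_gt0.
Qed.

Definition incr n Q x := dyad f n.+1 Q x - dyad f n Q x.

Lemma incr_measurable n Q D : measurable_fun D (incr n Q : T2 -> R).
Proof. by apply: measurable_funTS; apply: measurable_funB; exact: dyad_measurable. Qed.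

(** The inequality 2 |y| <= 2^-n + 2^n y^2 turns the decay 4^-n of the squares
    into a summable bound for the jumps themselves. *)
Lemma incr_l1 n Q : fat Q ->
  (\int[mu]_(x in rset Q) `|incr n Q x|%:E <=
   (area Q * (1 + 24 * En u Q) / 2 ^+ n)%:E)%E.
Proof.
move=> fQ; have [pQ _ _] := fQ; have mQ := rset_measurable Q.
have p2 : 0 < 2 ^+ n :> R by rewrite exprn_gt0.
have mi : measurable_fun (rset Q) (fun x : T2 => ((incr n Q x) ^+ 2)%:E).
  by apply/measurable_EFinP; apply: measurable_funX; exact: incr_measurable.
apply: (@le_trans _ _ (\int[mu]_(x in rset Q) ((2 ^+ n)^-1%:E + (2 ^+ n)%:E * (incr n Q x ^+ 2)%:E))%E).
  apply: ge0_le_integral => //.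
  - by apply/measurable_EFinP; apply: measurableT_comp => //; exact: incr_measurable.
  - by apply: emeasurable_funD => //; exact: emeasurable_funM.
  move=> x _; rewrite -EFinM -EFinD lee_fin; set y := incr n Q x.
  rewrite -[y ^+ 2]real_normK ?num_real//.
  have -> : (2 ^+ n)^-1 + 2 ^+ n * `|y| ^+ 2 = 2 * `|y| + (2 ^+ n)^-1 * (2 ^+ n * `|y| - 1) ^+ 2.
    by field; rewrite gt_eqF.
  have := normr_ge0 y; have : 0 <= (2 ^+ n)^-1 * (2 ^+ n * `|y| - 1) ^+ 2.
    by apply: mulr_ge0; [rewrite invr_ge0 ltW|exact: sqr_ge0].
  by lra.
rewrite ge0_integralD//;
  try (by move=> x _; rewrite lee_fin invr_ge0 ltW);
  try (by move=> x _; rewrite -EFinM lee_fin; apply: mulr_ge0; [exact: ltW|exact: sqr_ge0]);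
  try exact: emeasurable_funM.
rewrite ge0_integralZl_EFin//; try exact: ltW;
  try (by move=> x _; rewrite lee_fin sqr_ge0).
rewrite integral_cst// [X in (_ * X + _)%E](rset_measure pQ).
apply: (le_trans (leeD (lexx _) (lee_wpmul2l _ (incr_sq n fQ)))).
  by rewrite lee_fin ltW.
rewrite -!EFinM -EFinD lee_fin le_eqVlt; apply/orP; left; apply/eqP.
have -> : 4 ^+ n = 2 ^+ n * 2 ^+ n :> R by rewrite -exprMn; congr (_ ^+ _); ring.
by field; rewrite gt_eqF.
Qed.

End Tame.
End DyadCvg.

Section DyadLimit.
Context {R : realType}.
Local Notation mu := (plane_measure R).
Local Notation T2 := (measurableTypeR R * measurableTypeR R)%type.
Variables f u : R * R -> R.
Hypothesis tfu : tame f u.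
Variable Q : rect (R := R).
Hypothesis fQ : fat Q.

Let pQ : proper Q. Proof. by case: fQ. Qed.
Let mQ : measurable (rset Q). Proof. exact: rset_measurable. Qed.

(** The total variation of the sequence of dyadic means at x: it dominates the
    whole sequence, and where it is finite the sequence converges. *)
Definition dyad_var (x : T2) : \bar R := (\sum_(0 <= n <oo) `|incr f n Q x|%:E)%E.

Let mincr n : measurable_fun (rset Q) (fun x : T2 => `|incr f n Q x|%:E).
Proof. by apply/measurable_EFinP; apply: measurableT_comp => //; exact: incr_measurable. Qed.

Let dyad_var_measurable : measurable_fun (rset Q) dyad_var.
Proof. by apply: ge0_emeasurable_sum => // n x _ _; rewrite lee_fin. Qed.

Let dyad_var_ge0 x : (0 <= dyad_var x)%E.
Proof. by apply: nneseries_ge0 => n _ _; rewrite lee_fin. Qed.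

Lemma dyad_var_integrable : mu.-integrable (rset Q) dyad_var.
Proof.
apply/integrableP; split => //.
under eq_integral => x _ do rewrite gee0_abs//.
rewrite integral_nneseries//.
set K := area Q * (1 + 24 * En u Q).
have K0 : 0 <= K.
  apply: mulr_ge0; first by rewrite ltW// area_gt0.
  by apply: addr_ge0 => //; apply: mulr_ge0 => //; exact: (En_ge0 tfu).
apply: (@le_lt_trans _ _ (2 * K)%:E); last by rewrite ltry.
apply: lime_le.
  by apply: is_cvg_nneseries => n _ _; apply: integral_ge0 => x _; rewrite lee_fin.
apply: nearW => m.
apply: (@le_trans _ _ (2 * K * (1 - 2^-1 ^+ m))%:E); last first.
  rewrite lee_fin; apply: ler_piMr; first exact: mulr_ge0.
  by rewrite lerBlDr lerDl exprn_ge0// invr_ge0.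
elim: m => [|m IH]; first by rewrite big_nil expr0 subrr mulr0.
rewrite big_nat_recr//=; apply: (le_trans (leeD IH (incr_l1 tfu m fQ))).
rewrite -EFinD lee_fin -/K exprS -exprVn; lra.
Qed.

Let D x := fun n => dyad f n Q x.

Lemma dyad_telescope x n : dyad f n Q x = avg f Q + series (fun k => incr f k Q x) n.
Proof.
rewrite /series /incr /= (@telescope_sumr _ 0 n (fun k => dyad f k Q x))//=.
by rewrite addrC subrK.
Qed.

Lemma dyad_var_cvg x : dyad_var x \is a fin_num -> cvgn (D x).
Proof.
move=> ox.
have h : cvgn (series (fun k => incr f k Q x)).
  suff hh : cvgn (fun n => \sum_(0 <= k < n) `|incr f k Q x|) by apply: normed_cvg; exact: hh.
  apply: nondecreasing_is_cvgn.
    by apply/nondecreasing_seqP => n; rewrite big_nat_recr//= lerDl.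
  exists (fine (dyad_var x)) => _ [n _ <-]; rewrite -lee_fin fineK//.
  rewrite -sumEFin; apply: (@nneseries_lim_ge _ _ xpredT) => k _ _.
  by rewrite lee_fin.
rewrite (_ : D x = (fun n => avg f Q + series (fun k => incr f k Q x) n)).
  by apply: is_cvgD; [exact: is_cvg_cst|exact: h].
by apply/funext => n; exact: dyad_telescope.
Qed.

Lemma dyad_le_var n x : (`|(dyad f n Q x)%:E| <= `|avg f Q|%:E + dyad_var x)%E.
Proof.
rewrite dyad_telescope; apply: (@le_trans _ _ (`|avg f Q| + `|series (fun k => incr f k Q x) n|)%:E).
  by rewrite /= lee_fin ler_normD.
rewrite EFinD leeD2l//.
apply: (@le_trans _ _ (\sum_(0 <= k < n) `|incr f k Q x|)%:E).
  by rewrite lee_fin /series /= ler_norm_sum.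
rewrite -sumEFin; apply: (@nneseries_lim_ge _ _ xpredT) => k _ _.
by rewrite lee_fin.
Qed.

(** The upper limit, chosen because it is measurable and defined everywhere. *)
Definition dlim (x : T2) : \bar R := limn_esup (fun n => (dyad f n Q x)%:E).

Let mD n E : measurable_fun E (fun x : T2 => (dyad f n Q x)%:E).
Proof. by apply/measurable_EFinP; apply: measurable_funTS; exact: dyad_measurable. Qed.

Lemma dlim_measurable E : measurable_fun E dlim.
Proof. by apply: measurable_fun_limn_esup => n; exact: mD. Qed.

Lemma dlim_cvg x : dyad_var x \is a fin_num -> (dyad f n Q x)%:E @[n --> \oo] --> dlim x.
Proof.
move=> /dyad_var_cvg h; have : (dyad f n Q x)%:E @[n --> \oo] --> (limn (D x))%:E.
  by apply: cvg_EFin; [exact: nearW|exact: h].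
by move=> h'; rewrite /dlim is_cvg_limn_esupE; [apply/cvg_ex; eexists; exact: h'|apply/cvg_ex; eexists; exact: h'].
Qed.

Let bnd_int E : measurable E -> E `<=` rset Q ->
  mu.-integrable E (fun x => `|avg f Q|%:E + dyad_var x)%E.
Proof.
move=> mE EQ; apply: (@integrableS _ _ _ mu (rset Q)) => //.
apply: (@integrableD _ _ _ mu (rset Q) mQ (EFin \o fun=> `|avg f Q|) dyad_var); last exact: dyad_var_integrable.
by apply: cst_integrable_fin => //; rewrite rset_measure ?ltry.
Qed.

Lemma dlim_dct E : measurable E -> E `<=` rset Q ->
  mu.-integrable E dlim /\
  (\int[mu]_(x in E) (dyad f n Q x)%:E @[n --> \oo] --> \int[mu]_(x in E) dlim x)%E.
Proof.
move=> mE EQ.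
have ae1 : {ae mu, forall x, E x -> (dyad f n Q x)%:E @[n --> \oo] --> dlim x}.
  have := integrable_ae mQ dyad_var_integrable.
  by apply: filterS => x h /EQ /h; exact: dlim_cvg.
have ae2 : {ae mu, forall x n, E x -> (`|(dyad f n Q x)%:E| <= `|avg f Q|%:E + dyad_var x)%E}.
  by apply: nearW => x n _; exact: dyad_le_var.
by have [] := dominated_convergence mE (fun n => @mD n E) (@dlim_measurable E) ae1 (bnd_int mE EQ) ae2.
Qed.

Let h : T2 -> R := (fun x => fine (dlim x) - f x) \_ (rset Q).

Let dlim_fin : mu.-integrable (rset Q) (EFin \o (fine \o dlim)).
Proof.
have [i1 _] := dlim_dct mQ (@subset_refl _ _).
apply: le_integrable i1 => //.
  apply/measurable_EFinP; apply: (measurableT_comp (fine_measurable measurableT)).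
  exact: dlim_measurable.
by move=> x _ /=; case: (dlim x) => //=; rewrite leey.
Qed.

Let ih0 : mu.-integrable (rset Q) (EFin \o (fun x => fine (dlim x) - f x)).
Proof. exact: (integrableB mQ dlim_fin (tame_int tfu Q)). Qed.

Let ih : mu.-integrable setT (EFin \o h).
Proof. by rewrite /h -restrict_EFin; exact: ((integrable_mkcond _ mQ).1 ih0). Qed.

Let hE A : measurable A ->
  (\int[mu]_(x in A) (h x)%:E = \int[mu]_(x in rset Q `&` A) (fine (dlim x) - f x)%:E)%E.
Proof.
move=> mA; rewrite [LHS]integral_mkcond [RHS]integral_mkcond; apply: eq_integral => x _.
by rewrite /h !patchE [x \in rset Q `&` A]in_setI; case: (x \in A); case: (x \in rset Q).
Qed.

Let fin_dlim A : measurable A -> A `<=` rset Q ->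
  (\int[mu]_(x in A) dlim x = \int[mu]_(x in A) (fine (dlim x))%:E)%E.
Proof.
move=> mA AQ; have [i1 _] := dlim_dct mA AQ.
have [i2 _] := dlim_dct mQ (@subset_refl _ _).
have := integrable_ae mA i1 => ae1.
apply: ae_eq_integral => //; first exact: dlim_measurable.
  apply/measurable_EFinP; apply: (measurableT_comp (fine_measurable measurableT)).
  exact: dlim_measurable.
by apply: filterS ae1 => x hx /hx; move/fineK.
Qed.

Let null_grid N t s : grid N (rl Q) (rr Q) t -> grid N (rb Q) (rt Q) s ->
  (\int[mu]_(x in quadrant t s) (h x)%:E = 0)%E.
Proof.
move=> gt gs; have mq := quadrant_measurable t s.
rewrite hE//; set A := rset Q `&` quadrant t s.
have mA : measurable A by exact: measurableI.
have AQ : A `<=` rset Q by move=> x [].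
rewrite integralB_EFin//; last 2 first.
- exact: (integrableS mQ mA AQ dlim_fin).
- exact: (integrableS mQ mA AQ (tame_int tfu Q)).
rewrite -fin_dlim//.
have [i1 c1] := dlim_dct mA AQ.
have ifA := integrableS mQ mA AQ (tame_int tfu Q).
suff -> : (\int[mu]_(x in A) dlim x = \int[mu]_(x in A) (f x)%:E)%E.
  by rewrite subee//; exact: (integrable_fin_num mA ifA).
rewrite -(cvg_lim _ c1)//.
apply/cvg_lim => //.
have e n : (N <= n)%N -> (\int[mu]_(x in A) (dyad f n Q x)%:E = \int[mu]_(x in A) (f x)%:E)%E.
  move=> Nn; have iD := integrableS mQ mA AQ (dyad_int f n Q pQ).
  rewrite -(fineK (integrable_fin_num mA ifA)) -(fineK (integrable_fin_num mA iD)).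
  have := @dyad_grid R f u tfu N (n - N) Q t s pQ gt gs.
  by rewrite subnKC// /Rintegral => ->.
apply: cvg_near_cst; near=> n; apply/e; near: n; exact: nbhs_infty_ge.
Unshelve. all: by end_near. Qed.

Let null_quadrant t s : (\int[mu]_(x in quadrant t s) (h x)%:E = 0)%E.
Proof.
have [lx ly] := pQ.
pose tn n := gridpt n (rl Q) (rr Q) t; pose sn n := gridpt n (rb Q) (rt Q) s.
have c : (\int[mu]_x (((EFin \o h) \_ (quadrant (tn n) (sn n))) x) @[n --> \oo] -->
    \int[mu]_x (((EFin \o h) \_ (quadrant t s)) x))%E.
  have mh : measurable_fun setT (EFin \o h) by have [] := integrableP _ _ _ ih.
  have mr t' s' : measurable_fun setT ((EFin \o h) \_ (quadrant t' s')).
    apply: ((measurable_restrictT (EFin \o h) (quadrant_measurable t' s')).1).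
    exact: measurable_funTS mh.
  apply: (@dominated_cvg _ _ _ mu setT measurableT _ _ (fun x => `|(h x)%:E|%E)) => //.
  - move=> x _; rewrite !patchE; case: ifPn => hx; last first.
      apply: cvg_near_cst; apply: nearW => n; rewrite patchE ifF//.
      apply/negP; rewrite inE => -[h1 h2]; move: hx; rewrite notin_setE; apply.
      by split; [exact: lt_le_trans h1 (gridpt_le _ _ _ _)|exact: lt_le_trans h2 (gridpt_le _ _ _ _)].
    move: hx; rewrite inE => -[hx1 hx2].
    have pw (d e : R) : 0 < e -> \forall n \near \oo, d / 2 ^+ n < e.
      move=> e0; have : (d * (2^-1) ^+ n) @[n --> \oo] --> d * 0.
        apply: cvgM; first exact: cvg_cst.
        by apply: cvg_expr; rewrite ger0_norm ?invr_ge0// invf_lt1// ltr1n.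
      rewrite mulr0 => /cvgrPdist_lt /(_ e e0); apply: filterS => n.
      rewrite sub0r normrN exprVn; exact: le_lt_trans (ler_norm _).
    have n1 := pw (rr Q - rl Q) (t - x.1); rewrite subr_gt0 in n1; have {}n1 := n1 hx1.
    have n2 := pw (rt Q - rb Q) (s - x.2); rewrite subr_gt0 in n2; have {}n2 := n2 hx2.
    apply: cvg_near_cst; near=> n; rewrite patchE mem_set//.
    have g1 := @gridpt_near R n (rl Q) (rr Q) t (ltW lx).
    have g2 := @gridpt_near R n (rb Q) (rt Q) s (ltW ly).
    have l1 : (rr Q - rl Q) / 2 ^+ n < t - x.1 by near: n.
    have l2 : (rt Q - rb Q) / 2 ^+ n < s - x.2 by near: n.
    split; rewrite /tn /sn; lra.
  - exact: (integrable_abse ih).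
  - by move=> n x _; rewrite patchE; case: ifP => //= _; rewrite normr0 lee_fin.
rewrite integral_mkcond -(cvg_lim _ c)//; apply/cvg_lim => //.
apply: cvg_near_cst; apply: nearW => n; rewrite -integral_mkcond.
by apply: (@null_grid n); exact: gridpt_grid (ltW _).
Unshelve. all: by end_near. Qed.

(** The limit of the dyadic means has the same integrals as f over quadrants with
    grid corners, hence by density over all quadrants, hence equals f.  For tame
    functions this replaces Lebesgue's differentiation theorem. *)
Lemma dyad_cvg : {ae mu, forall x, rset Q x -> dyad f n Q x @[n --> \oo] --> f x}.
Proof.
have mq := @quadrant_measurable R.
have mS s : measurable ([set x | x.2 < s] : set T2).
  rewrite (_ : mkset _ = setT `*` `]-oo, s[); first by apply: measurableX => //; exact: measurable_itv.
  by apply/seteqP; split => x; [move=> p; split; rewrite //= in_itv|move=> [_]; rewrite /= in_itv].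
have mS' s : measurable ([set x | x.1 < s] : set T2).
  rewrite (_ : mkset _ = `]-oo, s[ `*` setT); first by apply: measurableX => //; exact: measurable_itv.
  by apply/seteqP; split => x; [move=> p; split; rewrite //= in_itv|move=> [+ _]; rewrite /= in_itv].
have ae0 : ae_eq mu setT (EFin \o h) (cst 0%E).
  apply: (quadrants_null ih).
  - rewrite hE// setIT -(null_quadrant (rr Q) (rt Q)) hE//; congr (integral _ _ _).
    apply/seteqP; split => x; last by move=> [].
    move=> Qx; split => //; move: Qx => [] /=; rewrite !in_itv/= => /andP[_ p] /andP[_ q].
    by split.
  - move=> s; rewrite hE// -(null_quadrant (rr Q) s) hE//; congr (integral _ _ _).
    apply/seteqP; split => x; last by move=> [Qx [_ ?]]; split.
    move=> [Qx p]; split => //; move: Qx => [] /=; rewrite !in_itv/= => /andP[_ p'] _.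
    by split.
  - move=> t; rewrite hE// -(null_quadrant t (rt Q)) hE//; congr (integral _ _ _).
    apply/seteqP; split => x; last by move=> [Qx [? _]]; split.
    move=> [Qx p]; split => //; move: Qx => [] /=; rewrite !in_itv/= => _ /andP[_ p'].
    by split.
  - by move=> t s; exact: null_quadrant.
have ae1 := integrable_ae mQ dyad_var_integrable.
have [i1 _] := dlim_dct mQ (@subset_refl _ _).
have ae2 := integrable_ae mQ i1.
near=> x => Qx.
have x1 : dyad_var x \is a fin_num by move: Qx; near: x.
have x2 : dlim x \is a fin_num by move: Qx; near: x.
have x0 : (h x)%:E = 0%E by move: (Logic.I); near: x.
have hf : fine (dlim x) = f x.
  by move: x0; rewrite /h patchE mem_set// => -[] /eqP; rewrite subr_eq0 => /eqP.
have := dlim_cvg x1; rewrite -(fineK x2) hf => /fine_cvg.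
by [].
Unshelve. all: by end_near. Qed.
End DyadLimit.

(** * Weighted Sobolev inequality and stopping subdivisions *)
Section Sobolev.
Context {R : realType}.
Local Notation mu := (plane_measure R).
Local Notation T2 := (measurableTypeR R * measurableTypeR R)%type.
Implicit Types Q : rect (R := R).

Lemma limn_einf_ub (v : (\bar R)^nat) (C : \bar R) : (forall n, v n <= C)%E ->
  (limn_einf v <= C)%E.
Proof.
move=> h; rewrite limn_einf_lim; apply: lime_le; first exact: is_cvg_einfs.
apply: nearW => n; apply: (@le_trans _ _ (v n)); last exact: h.
by apply: ereal_inf_lbound; exists n => //=.
Qed.

(** Fatou's lemma carries the dyadic inequality to its almost everywhere limit. *)
Lemma sobolev (f u : R * R -> R) (tfu : tame f u) (w : R * R -> R) (J : rect (R := R) -> R) (theta : R) Q :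
  measurable_fun (setT : set T2) w -> (forall x, 0 <= w x) ->
  0 <= theta -> theta < 1 ->
  (forall Q', proper Q' -> (\int[mu]_(x in rset Q') (w x)%:E <= (J Q')%:E)%E) ->
  (forall Q' i j, proper Q' -> J (child Q' i j) <= theta * J Q') ->
  fat Q ->
  (\int[mu]_(x in rset Q) (w x * (f x - avg f Q) ^+ 2)%:E <=
   (sobC theta * J Q * En u Q)%:E)%E.
Proof.
move=> mw w0 th0 th1 Jw Jc fQ.
have mQ := rset_measurable Q.
have [[mf _] _ _ _ _] := tfu.
pose g n x := (w x * (dyad f n Q x - avg f Q) ^+ 2)%:E.
have mg n : measurable_fun (rset Q) (g n) by exact: wsq_measurable.
have g0 n x : rset Q x -> (0 <= g n x)%E by move=> _; rewrite lee_fin mulr_ge0// sqr_ge0.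
have ae : {ae mu, forall x, rset Q x -> (w x * (f x - avg f Q) ^+ 2)%:E = limn_einf (g^~ x)}.
  have := dyad_cvg tfu fQ; apply: filterS => x h /h {}h.
  have c : g n x @[n --> \oo] --> (w x * (f x - avg f Q) ^+ 2)%:E.
    apply: cvg_EFin; first exact: nearW.
    apply: cvgM; first exact: cvg_cst.
    rewrite expr2; under eq_cvg do rewrite /= expr2.
    by apply: cvgM; apply: cvgB => //; exact: cvg_cst.
  by rewrite (cvg_limn_einf_sup c).1.
have -> : (\int[mu]_(x in rset Q) (w x * (f x - avg f Q) ^+ 2)%:E =
    \int[mu]_(x in rset Q) limn_einf (g^~ x))%E.
  apply: ae_eq_integral => //; last first.
    have m := @measurable_fun_limn_esup _ _ R (rset Q) (fun n x => - g n x)%E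
      (fun n => measurableT_comp (@oppe_measurable R setT) (mg n)).
    exact: (measurableT_comp (@oppe_measurable R setT) m).
  apply: measurable_funTS; apply/measurable_EFinP; apply: measurable_funM => //.
  by apply: measurable_funX; apply: measurable_funB.
apply: (le_trans (fatou mu mQ mg g0)); apply: limn_einf_ub => n.
exact: (sobolev_dyad tfu).
Qed.

Fixpoint vanish (f : R * R -> R) (L : seq (rect (R := R))) : Prop :=
  if L is Q :: L' then avg f Q = 0 /\ vanish f L' else True.

Lemma vanish_cat f L1 L2 : vanish f (L1 ++ L2) -> vanish f L1 /\ vanish f L2.
Proof. by elim: L1 => //= Q L IH [h /IH[h1 h2]]; split. Qed.

(** The constant for which the count in [stop_count] closes. *)
Definition stopK (theta : R) : R := 6 + 3 / (1 - theta).

(** The quantity b - 2 leaves enough slack to pay for up to three quarters whose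
    own count is the minimum 1: if one quarter carries nearly all of b, it has
    still lost 3 by the contraction factor theta. *)
Lemma stop_count (theta b b1 b2 b3 b4 : R) : theta < 1 -> stopK theta < b ->
  b1 <= theta * b -> b2 <= theta * b -> b3 <= theta * b -> b4 <= theta * b ->
  0 <= b1 -> 0 <= b2 -> 0 <= b3 -> 0 <= b4 -> b1 + b2 + b3 + b4 <= b ->
  Num.max 1 (b1 - 2) + Num.max 1 (b2 - 2) + Num.max 1 (b3 - 2) + Num.max 1 (b4 - 2) <= b - 2.
Proof.
move=> th1 hb h1 h2 h3 h4 p1 p2 p3 p4 hs.
have k0 : 0 < 1 - theta by rewrite subr_gt0.
have hb6 : 6 < b.
  by apply: le_lt_trans hb; rewrite /stopK lerDl divr_ge0// ltW.
have e : theta * b <= b - 3.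
  have : 3 <= (1 - theta) * b; last by lra.
  rewrite mulrC -ler_pdivrMr//; apply: ltW; apply: le_lt_trans hb.
  by rewrite /stopK lerDr.
have {h1}h1 := le_trans h1 e; have {h2}h2 := le_trans h2 e.
have {h3}h3 := le_trans h3 e; have {h4}h4 := le_trans h4 e.
by rewrite /Num.max; do 4 (case: ifP => /=; [move=> _|move=> /negbT; rewrite -leNgt => ?]); lra.
Qed.

Section Stopping.
Variables (w : R * R -> R) (J : rect (R := R) -> R) (theta : R).
Hypotheses (mw : measurable_fun (setT : set T2) w) (w0 : forall x, 0 <= w x).
Hypothesis (th0 : 0 <= theta) (th1 : theta < 1).
Hypothesis Jw : forall Q, proper Q -> (\int[mu]_(x in rset Q) (w x)%:E <= (J Q)%:E)%E.
Hypothesis Jchild : forall Q i j, proper Q -> J (child Q i j) <= theta * J Q.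
Hypothesis Jsum : forall Q, proper Q -> sum4 J Q <= J Q.

(** Subdivide until the weight J of every piece is at most delta, which happens
    after finitely many generations, and impose that the mean over each piece is
    zero.  The number of pieces is proportional to J Q / delta because J is
    superadditive; the term -2 is what the induction needs. *)
Lemma stopping (delta : R) Q : 0 < delta -> fat Q ->
  exists L : seq (rect (R := R)),
    (size L)%:R <= Num.max 1 (stopK theta * (J Q / delta) - 2) /\
    forall f u, tame f u -> vanish f L ->
      (\int[mu]_(x in rset Q) (w x * f x ^+ 2)%:E <=
       (sobC theta * delta * En u Q)%:E)%E.
Proof.
move=> d0 fQ.
have C0 := sobC_gt0 th1.
have base Q' : fat Q' -> J Q' <= delta -> exists L : seq (rect (R := R)),
    (size L)%:R <= Num.max 1 (stopK theta * (J Q' / delta) - 2) /\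
    forall f u, tame f u -> vanish f L ->
      (\int[mu]_(x in rset Q') (w x * f x ^+ 2)%:E <=
       (sobC theta * delta * En u Q')%:E)%E.
  move=> fQ' JQ'; exists [:: Q']; split; first by rewrite le_max lexx.
  move=> f u tfu [a0 _]; have := sobolev tfu mw w0 th0 th1 Jw Jchild fQ'.
  under eq_integral => x _ do rewrite a0 subr0.
  move=> /le_trans; apply; rewrite lee_fin ler_wpM2r ?(En_ge0 tfu)//.
  by rewrite ler_wpM2l// ltW.
(* The number of generations after which the weight is small anyway; it only
   drives the induction. *)
have [k hk] : exists k, J Q * theta ^+ k <= delta.
  have : (J Q * theta ^+ k) @[k --> \oo] --> J Q * 0.
    by apply: cvgM; [exact: cvg_cst|apply: cvg_expr; rewrite ger0_norm].
  rewrite mulr0 => /cvgrPdist_lt /(_ delta d0) [k _ /(_ k (leqnn k))] /=.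
  rewrite sub0r normrN => h; exists k; apply: ltW.
  exact: le_lt_trans (ler_norm _) h.
elim: k Q fQ hk => [|k IH] Q fQ hk.
  by apply: base => //; rewrite expr0 mulr1 in hk.
have [h|h] := leP (J Q) delta; first exact: base.
have [pQ _ _] := fQ.
have hc i j : J (child Q i j) * theta ^+ k <= delta.
  apply: le_trans hk; rewrite exprS mulrA ler_wpM2r ?exprn_ge0//.
  by rewrite mulrC Jchild.
have [L1 [s1 H1]] := IH _ (child_fat false false fQ) (hc _ _).
have [L2 [s2 H2]] := IH _ (child_fat false true fQ) (hc _ _).
have [L3 [s3 H3]] := IH _ (child_fat true false fQ) (hc _ _).
have [L4 [s4 H4]] := IH _ (child_fat true true fQ) (hc _ _).
exists ((L1 ++ L2) ++ (L3 ++ L4)); split.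
  rewrite le_max; apply/orP; right.
  rewrite !size_cat !natrD addrA.
  apply: (le_trans (lerD (lerD (lerD s1 s2) s3) s4)).
  set K := stopK theta.
  have K0 : 0 < K by rewrite addr_gt0// divr_gt0// subr_gt0.
  have Jt i j : K * (J (child Q i j) / delta) <= theta * (K * (J Q / delta)).
    rewrite [leRHS]mulrCA ler_pM2l// mulrA ler_pM2r ?invr_gt0//; exact: Jchild.
  have Jpos i j : 0 <= K * (J (child Q i j) / delta).
    apply: mulr_ge0; first exact: ltW.
    by apply: divr_ge0; [apply: (J_ge0 w0 Jw); exact: child_proper|exact: ltW].
  apply: (stop_count th1) => //.
    by rewrite ltr_pMr// ltr_pdivlMr// mul1r.
  rewrite -!mulrDr -!mulrDl ler_pM2l// ler_pM2r ?invr_gt0//; exact: Jsum.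
move=> f u tfu /vanish_cat[/vanish_cat[v1 v2] /vanish_cat[v3 v4]].
have [[mf _] _ _ _ _] := tfu.
rewrite ge0_int_children//; last 2 first.
- apply: measurable_funTS; apply/measurable_EFinP; apply: measurable_funM => //.
  exact: measurable_funX.
- by move=> x _; rewrite lee_fin mulr_ge0// sqr_ge0.
apply: (le_trans (leeD (leeD (H1 _ _ tfu v1) (H2 _ _ tfu v2)) (leeD (H3 _ _ tfu v3) (H4 _ _ tfu v4)))).
rewrite -!EFinD lee_fin (En_children tfu pQ) /sum4 !mulrDr !addrA lexx//.
Qed.

End Stopping.
End Sobolev.

(** * Hoelder weights *)
Section PowerWeight.
Context {R : realType}.
Local Notation mu := (plane_measure R).
Local Notation T2 := (measurableTypeR R * measurableTypeR R)%type.
Implicit Types Q : rect (R := R).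
Variables (p : R) (w : R * R -> R).
Hypothesis p1 : 1 < p.
Hypotheses (mw : measurable_fun (setT : set T2) w) (w0 : forall x, 0 <= w x).
Hypothesis iw : mu.-integrable setT (EFin \o (fun x => w x `^ p)).

Definition pmass Q : R := \int[mu]_(x in rset Q) (w x `^ p).
(** The Hoelder bound for the integral of w over Q in terms of its L^p norm: the
    factor |Q|^(1 - 1/p) makes it contract under subdivision. *)
Definition Jp Q : R := area Q * (pmass Q / area Q) `^ p^-1.
Definition thetap : R := 4 `^ p^-1 / 4.

Let p0 : 0 < p. Proof. exact: lt_trans p1. Qed.

Lemma thetap_ge0 : 0 <= thetap.
Proof. by rewrite divr_ge0// powR_ge0. Qed.

Lemma thetap_lt1 : thetap < 1.
Proof.
rewrite /thetap ltr_pdivrMr// mul1r -[ltRHS]powRr1//.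
rewrite /powR gt_eqF// ltr_expR ltr_pM2r ?invf_lt1//.
by rewrite ln_gt0// ltr1n.
Qed.

(** Young's inequality with second factor 1. *)
Lemma powR_tangent x : 0 <= x -> x <= (1 - p^-1) + x `^ p / p.
Proof.
move=> x0.
have q0 : 0 < (1 - p^-1)^-1 by rewrite invr_gt0 subr_gt0 invf_lt1.
have := @conjugate_powR R x 1 p (1 - p^-1)^-1 x0 ler01 p0 q0.
rewrite invrK mulr1 powR1 mul1r => h; rewrite addrC; apply: h; lra.
Qed.

Lemma root_tangent y : 0 <= y -> y `^ p^-1 <= (1 - p^-1) + y / p.
Proof.
move=> y0; have := powR_tangent (powR_ge0 y p^-1).
by rewrite -powRrM mulVf ?gt_eqF// powRr1.
Qed.

Lemma pmass_ge0 Q : 0 <= pmass Q.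
Proof. by apply: Rintegral_ge0 => x _; exact: powR_ge0. Qed.

Let iwQ Q : mu.-integrable (rset Q) (EFin \o (fun x => w x `^ p)).
Proof. by apply: integrableS iw => //; exact: rset_measurable. Qed.

Lemma pmass_children Q : proper Q -> pmass Q = sum4 pmass Q.
Proof. by move=> pQ; apply: Rint_children. Qed.

Lemma Jp_ge0 Q : proper Q -> 0 <= Jp Q.
Proof. by move=> pQ; rewrite mulr_ge0 ?powR_ge0// ltW// area_gt0. Qed.

(** Hoelder's inequality, by integrating the tangent bound for w / l and taking
    for l the p-mean of w over Q. *)
Lemma Jp_holder Q : proper Q -> (\int[mu]_(x in rset Q) (w x)%:E <= (Jp Q)%:E)%E.
Proof.
move=> pQ; have mQ := rset_measurable Q; have a0 := area_gt0 pQ.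
have key l : 0 < l -> (\int[mu]_(x in rset Q) (w x)%:E <=
    (l * (1 - p^-1) * area Q + l / (l `^ p * p) * pmass Q)%:E)%E.
  move=> l0; have lp0 : 0 < l `^ p by rewrite powR_gt0.
  have fin : (mu (rset Q) < +oo)%E by rewrite rset_measure ?ltry.
  apply: (@le_trans _ _ (\int[mu]_(x in rset Q)
      ((l * (1 - p^-1))%:E + (l / (l `^ p * p) * (w x `^ p))%:E))%E).
    apply: ge0_le_integral => //.
    - by move=> x _; rewrite lee_fin.
    - by apply: measurable_funTS; apply/measurable_EFinP.
    - apply: emeasurable_funD => //; apply: measurable_funTS; apply/measurable_EFinP.
      by apply: measurable_funM => //; exact: measurableT_comp (measurable_powR _) _.
    move=> x _; rewrite -EFinD lee_fin.
    have l0' := ltW l0; have li0 : 0 <= l^-1 by rewrite invr_ge0.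
    have := @powR_tangent (w x / l) (mulr_ge0 (w0 x) li0).
    have e : l^-1 `^ p = (l `^ p)^-1 by rewrite -[l^-1]powR_inv1// -powRrM mulN1r powRN.
    rewrite powRM// e ler_pdivrMr// mulrDl => /le_trans; apply.
    rewrite le_eqVlt; apply/orP; left; apply/eqP; field.
    by rewrite !gt_eqF.
  have i1 : mu.-integrable (rset Q) (EFin \o fun=> l * (1 - p^-1)) by exact: cst_integrable_fin.
  have i2 := integrableZl mQ (l / (l `^ p * p)) (iwQ Q).
  rewrite (integralD_EFin mQ i1 i2) integral_cst// [X in (_ * X + _)%E](rset_measure pQ).
  rewrite EFinD EFinM leeD2l// EFinM /pmass /Rintegral fineK; last first.
    exact: (integrable_fin_num mQ (iwQ Q)).
  by rewrite -(integralZl mQ (iwQ Q)).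
have [M0|M0] := eqVneq (pmass Q) 0.
  rewrite /Jp M0 mul0r powR0 ?invr_neq0 ?gt_eqF// mulr0.
  apply/lee_addgt0Pr => e e0; rewrite add0e.
  have lp : 0 < e / area Q by rewrite divr_gt0.
  apply: (le_trans (key _ lp)); rewrite lee_fin M0 mulr0 addr0 mulrAC divfK ?gt_eqF//.
  by apply: ler_piMr; [exact: ltW|rewrite lerBlDr lerDl invr_ge0 ltW].
have {}M0 : 0 < pmass Q by rewrite lt_neqAle eq_sym M0 pmass_ge0.
have r0 : 0 < pmass Q / area Q by rewrite divr_gt0.
have l0 : 0 < (pmass Q / area Q) `^ p^-1 by rewrite powR_gt0.
apply: (le_trans (key _ l0)); rewrite lee_fin -powRrM mulVf ?gt_eqF// (powRr1 (ltW r0)).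
rewrite /Jp le_eqVlt; apply/orP; left; apply/eqP.
set l := _ `^ _; field; rewrite !gt_eqF//.
Qed.

(** Quartering divides the area by 4 and at worst multiplies the mean of w^p by
    4. *)
Lemma Jp_child Q i j : proper Q -> Jp (child Q i j) <= thetap * Jp Q.
Proof.
move=> pQ; have a0 := area_gt0 pQ.
rewrite /Jp child_area.
have -> : thetap * (area Q * (pmass Q / area Q) `^ p^-1) =
  area Q / 4 * (4 * (pmass Q / area Q)) `^ p^-1.
  rewrite (@powRM _ 4 (pmass Q / area Q))//; last by apply: divr_ge0; [exact: pmass_ge0|exact: ltW].
  by rewrite /thetap; field.
rewrite ler_pM2l ?divr_gt0//; apply: ge0_ler_powR; rewrite ?nnegrE.
- by rewrite invr_ge0 ltW.
- by apply: divr_ge0; [exact: pmass_ge0|apply: divr_ge0 => //; exact: ltW].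
- by apply: mulr_ge0 => //; apply: divr_ge0; [exact: pmass_ge0|exact: ltW].
have -> : pmass (child Q i j) / (area Q / 4) = 4 * (pmass (child Q i j) / area Q).
  by field; rewrite gt_eqF.
rewrite ler_pM2l// ler_pM2r ?invr_gt0//.
by apply: Rint_mono => //; [exact: rset_measurable|exact: rset_measurable|exact: child_sub|
   move=> x; exact: powR_ge0].
Qed.

(** Concavity of the p-th root, used through its tangent at the mean over Q. *)
Lemma Jp_sum Q : proper Q -> sum4 Jp Q <= Jp Q.
Proof.
move=> pQ; have a0 := area_gt0 pQ.
have c0 i j : 0 <= pmass (child Q i j) by exact: pmass_ge0.
have [M0|M0] := eqVneq (pmass Q) 0.
  have e := pmass_children pQ; rewrite M0 /sum4 in e.
  have z i j : pmass (child Q i j) = 0.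
    move: (c0 false false) (c0 false true) (c0 true false) (c0 true true) e.
    by case: i; case: j; move: (pmass (child Q false false)) (pmass (child Q false true))
      (pmass (child Q true false)) (pmass (child Q true true)) => *; lra.
  by rewrite /sum4 /Jp !z M0 !mul0r powR0 ?invr_neq0 ?gt_eqF// !mulr0 !addr0.
have {}M0 : 0 < pmass Q by rewrite lt_neqAle eq_sym M0 pmass_ge0.
have r0 : 0 < pmass Q / area Q by rewrite divr_gt0.
have l0 : 0 < (pmass Q / area Q) `^ p^-1 by rewrite powR_gt0.
have t i j : Jp (child Q i j) <= area Q / 4 * ((pmass Q / area Q) `^ p^-1 *
    ((1 - p^-1) + 4 * pmass (child Q i j) / pmass Q / p)).
  rewrite /Jp child_area ler_pM2l ?divr_gt0//.
  have -> : pmass (child Q i j) / (area Q / 4) =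
     (pmass Q / area Q) * (4 * pmass (child Q i j) / pmass Q).
    by field; rewrite !gt_eqF.
  have y0 : 0 <= 4 * pmass (child Q i j) / pmass Q.
    by apply: divr_ge0; [exact: mulr_ge0|exact: ltW].
  by rewrite (powRM _ (ltW r0) y0) ler_pM2l//; exact: root_tangent.
apply: (le_trans (lerD (lerD (lerD (t _ _) (t _ _)) (t _ _)) (t _ _))).
have e := pmass_children pQ; rewrite /sum4 in e.
rewrite /Jp; set l := _ `^ _ in l0 *.
set m1 := pmass (child Q false false) in e *; set m2 := pmass (child Q false true) in e *.
set m3 := pmass (child Q true false) in e *; set m4 := pmass (child Q true true) in e *.
rewrite le_eqVlt; apply/orP; left; apply/eqP.
transitivity (area Q * l * ((1 - p^-1) + (m1 + m2 + m3 + m4) / pmass Q / p)).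
  by field; rewrite !gt_eqF.
by rewrite -e divff ?gt_eqF//; field; rewrite gt_eqF.
Qed.

End PowerWeight.

(** * A discrete Schroedinger problem on the half-line *)
Section HalfLine.
Context {R : realType}.
Implicit Types (x v D : nat -> R).

Lemma sqr_diff_le x D s k : (forall j, (x j.+1 - x j) ^+ 2 <= D j) ->
  (x (s + k)%N - x s) ^+ 2 <= k%:R * \sum_(s <= j < s + k) D j.
Proof.
move=> hD; elim: k => [|k IH]; first by rewrite addn0 subrr expr0n/= mul0r.
rewrite addnS big_nat_recr ?leq_addr//=.
set S := \sum_(s <= j < s + k) D j in IH *.
set A := x (s + k)%N - x s in IH *.
set a := x (s + k).+1 - x (s + k)%N.
have -> : x (s + k).+1 - x s = A + a by rewrite /A /a; ring.
have ha : a ^+ 2 <= D (s + k)%N by exact: hD.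
case: k => [|k] in S A a IH ha *.
  have A0 : A = 0 by rewrite /A addn0 subrr.
  by rewrite A0 add0r mul1r (le_trans ha)// lerDr /S addn0 big_geq.
set K : R := k.+1%:R in IH *; have K0 : 0 < K by rewrite ltr0n.
have -> : k.+2%:R = K + 1 by rewrite /K -natr1.
rewrite -(ler_pM2l K0).
have := sqr_ge0 (A - K * a).
have : K * (K + 1) * a ^+ 2 <= K * (K + 1) * D (s + k.+1)%N.
  by rewrite ler_wpM2l// mulr_ge0 ?addr_ge0// ltW.
have : (K + 1) * A ^+ 2 <= (K + 1) * (K * S) by rewrite ler_wpM2l// addr_ge0// ltW.
rewrite !expr2; lra.
Qed.

(** The Cauchy-Schwarz inequality in the plane. *)
Lemma sqrt_superadd (a b c d : R) : 0 <= a -> 0 <= b -> 0 <= c -> 0 <= d ->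
  Num.sqrt (a * b) + Num.sqrt (c * d) <= Num.sqrt ((a + c) * (b + d)).
Proof.
move=> a0 b0 c0 d0.
rewrite -[leLHS]ger0_norm ?addr_ge0 ?sqrtr_ge0// -sqrtr_sqr ler_wsqrtr//.
have ab := mulr_ge0 a0 b0; have cd := mulr_ge0 c0 d0.
have ad := mulr_ge0 a0 d0; have cb := mulr_ge0 c0 b0.
have h : 2 * (Num.sqrt (a * b) * Num.sqrt (c * d)) <= a * d + c * b.
  rewrite -sqrtrM//; have -> : a * b * (c * d) = (a * d) * (c * b) by ring.
  rewrite sqrtrM//.
  have := sqr_ge0 (Num.sqrt (a * d) - Num.sqrt (c * b)).
  by rewrite sqrrB !sqr_sqrtr//; lra.
by rewrite sqrrD !sqr_sqrtr// -mulr_natl; lra.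
Qed.

Section Mass.
Variables (v : nat -> R) (eps : R).
Hypotheses (v0 : forall j, 0 <= v j) (e0 : 0 < eps).

Let sqrt_ratio_gt1 (a : R) : eps < a -> 1 < Num.sqrt (a / eps).
Proof.
move=> h; rewrite -[X in X < _]sqrtr1 ltr_sqrt; last by rewrite divr_gt0// (lt_trans e0).
by rewrite ltr_pdivlMr// mul1r.
Qed.

Definition vmass s L : R := \sum_(s <= j < s + L) v j.

Lemma vmass_ge0 s L : 0 <= vmass s L.
Proof. by apply: sumr_ge0. Qed.

(** Starting from a zero, x_j^2 is at most L times the sum of the increments, and
    the mass is spent once. *)
Lemma piece_bound x D s L : (forall j, (x j.+1 - x j) ^+ 2 <= D j) ->
  x s = 0 -> L%:R * vmass s L <= eps ->
  \sum_(s <= j < s + L) v j * x j ^+ 2 <= eps * \sum_(s <= j < s + L) D j.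
Proof.
move=> hD xs hL; have D0 j : 0 <= D j by rewrite (le_trans _ (hD j))// sqr_ge0.
set S := \sum_(s <= j < s + L) D j.
have S0 : 0 <= S by apply: sumr_ge0.
apply: (@le_trans _ _ (\sum_(s <= j < s + L) v j * (L%:R * S))).
  rewrite !big_nat; apply: ler_sum => j /andP[sj jL]; rewrite ler_wpM2l//.
  have := @sqr_diff_le x D s (j - s) hD; rewrite subnKC// xs subr0 => /le_trans; apply.
  apply: ler_pM => //; first exact: sumr_ge0.
    by rewrite ler_nat leq_subLR ltnW.
  by rewrite /S (@big_cat_nat _ _ _ j s (s + L))//= ?lerDl ?sumr_ge0// ltnW.
rewrite -mulr_suml -/(vmass s L) mulrA ler_wpM2r//; by rewrite mulrC.
Qed.

(** Cut off the shortest initial segment that violates the condition of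
    [piece_bound].  Without its last index it is harmless, and at that last index
    x is forced to vanish: two points for a segment whose square root of length
    times mass exceeds that of eps.  Superadditivity adds these up. *)
Lemma greedy L s : exists P : seq nat,
  (size P)%:R <= 2 + 2 * Num.sqrt (L%:R * vmass s L / eps) /\
  forall x D, (forall j, (x j.+1 - x j) ^+ 2 <= D j) -> {in P, forall i, x i = 0} ->
    \sum_(s <= j < s + L) v j * x j ^+ 2 <= eps * \sum_(s <= j < s + L) D j.
Proof.
elim/ltn_ind: L s => L IH s.
have [h|h] := leP (L%:R * vmass s L) eps.
  exists [:: s]; split; first by rewrite /= (@le_trans _ _ 2)// ?ler1n// lerDl mulr_ge0// sqrtr_ge0.
  by move=> x D hD xP; apply: piece_bound => //; apply: xP; rewrite inE.
have ex : exists l, eps < l%:R * vmass s l by exists L.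
(* Minimality makes the segment of length l - 1 admissible. *)
pose l := ex_minn ex.
have [hl lmin] : eps < l%:R * vmass s l /\ forall k, eps < k%:R * vmass s k -> (l <= k)%N.
  by rewrite /l; case: ex_minnP.
have l0 : (0 < l)%N.
  by rewrite lt0n; apply/eqP => e; move: hl; rewrite e mul0r ltNge (ltW e0).
have lL : (l <= L)%N by exact: lmin.
have hl1 : (l.-1)%:R * vmass s l.-1 <= eps.
  rewrite leNgt; apply/negP => /lmin; rewrite -ltnS prednK// ltnn//.
have LlL : (L - l < L)%N by rewrite ltn_subrL l0 (leq_trans l0 lL).
have [P [sP HP]] := IH _ LlL (s + l)%N.
exists [:: s, (s + l.-1)%N & P]; split.
  have sp : vmass s L = vmass s l + vmass (s + l) (L - l).
    rewrite /vmass (@big_cat_nat _ _ _ (s + l)%N s (s + L))//= ?leq_addr ?leq_add2l//.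
    by congr (_ + \sum_(_ <= j < _) _); lia.
  have LE : L%:R = l%:R + (L - l)%:R :> R by rewrite -natrD subnKC.
  have sq := @sqrt_superadd (l%:R) (vmass s l / eps) (L - l)%:R (vmass (s + l) (L - l) / eps).
  rewrite -mulrDl -sp -LE !mulrA in sq.
  have := sq (ler0n _ _) (divr_ge0 (vmass_ge0 _ _) (ltW e0)) (ler0n _ _) (divr_ge0 (vmass_ge0 _ _) (ltW e0)).
  have h1 : 1 < Num.sqrt (l%:R * vmass s l / eps) by exact: sqrt_ratio_gt1.
  have -> : (size [:: s, (s + l.-1)%N & P])%:R = 2 + (size P)%:R :> R by rewrite /= -natrD.
  move: sP; set a := Num.sqrt _; set b := Num.sqrt _ in h1 *; set c := Num.sqrt _; lra.
move=> x D hD xP; have D0 j : 0 <= D j by rewrite (le_trans _ (hD j))// sqr_ge0.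
have xs : x s = 0 by apply: xP; rewrite !inE eqxx.
have xl : x (s + l.-1)%N = 0 by apply: xP; rewrite !inE eqxx orbT.
have b1 := piece_bound hD xs hl1.
have b2 : {in P, forall i, x i = 0} by move=> i iP; apply: xP; rewrite !inE iP !orbT.
have {}b2 := HP x D hD b2.
rewrite (@big_cat_nat _ _ _ (s + l)%N s (s + L))//= ?leq_addr ?leq_add2l//.
rewrite [in leRHS](@big_cat_nat _ _ _ (s + l)%N s (s + L))//= ?leq_addr ?leq_add2l//.
have e : (s + l = (s + l.-1).+1)%N by lia.
have eL : (s + l + (L - l) = s + L)%N by lia.
rewrite eL in b2.
rewrite mulrDr; apply: lerD.
  rewrite e !big_nat_recr ?leq_addr//= xl expr0n/= mulr0 addr0.
  by apply: (le_trans b1); rewrite ler_pM2l// lerDl.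
exact: b2.
Qed.

(** The scale-invariant size of v on the dyadic block from 2^n to 2^(n+1). *)
Definition blockM n : R := (2 ^ n)%:R * vmass (2 ^ n) (2 ^ n).

(** Compare x_j with x at the beginning of the block. *)
Lemma block_good x D n : (forall j, (x j.+1 - x j) ^+ 2 <= D j) ->
  \sum_(2 ^ n <= j < 2 ^ n.+1) v j * x j ^+ 2 <=
  2 * blockM n * (x (2 ^ n)%N ^+ 2 / (2 ^ n)%:R + \sum_(2 ^ n <= j < 2 ^ n.+1) D j).
Proof.
move=> hD; have D0 j : 0 <= D j by rewrite (le_trans _ (hD j))// sqr_ge0.
have e : (2 ^ n.+1 = 2 ^ n + 2 ^ n)%N by rewrite expnS mul2n addnn.
rewrite e; set T := (2 ^ n)%N; set S := \sum_(T <= j < T + T) D j.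
have T0 : 0 < T%:R :> R by rewrite ltr0n expn_gt0.
apply: (@le_trans _ _ (\sum_(T <= j < T + T) v j * (2 * (x T ^+ 2 + T%:R * S)))).
  rewrite !big_nat; apply: ler_sum => j /andP[sj jL]; rewrite ler_wpM2l//.
  have := @sqr_diff_le x D T (j - T) hD; rewrite subnKC// => h.
  have h2 : (x j - x T) ^+ 2 <= T%:R * S.
    apply: (le_trans h); apply: ler_pM => //; first exact: sumr_ge0.
      by rewrite ler_nat leq_subLR ltnW.
    by rewrite /S (@big_cat_nat _ _ _ j T (T + T))//= ?lerDl ?sumr_ge0// ltnW.
  have := sqr_ge0 (x j - x T - x T); move: h2; rewrite !expr2; lra.
rewrite -mulr_suml -/(vmass T T) /blockM -/T le_eqVlt; apply/orP; left; apply/eqP.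
by field; rewrite gt_eqF.
Qed.

(** Hardy's inequality along the powers of 2: each x(2^n)^2 / 2^n is absorbed by
    the next one, the increments making up the difference. *)
Lemma hardy x D N : (forall j, (x j.+1 - x j) ^+ 2 <= D j) ->
  \sum_(n < N) (x (2 ^ n)%N ^+ 2 / (2 ^ n)%:R) + 4 * (x (2 ^ N)%N ^+ 2 / (2 ^ N)%:R) <=
  4 * x 1%N ^+ 2 + 6 * \sum_(1 <= j < 2 ^ N) D j.
Proof.
move=> hD; elim: N => [|N IH].
  by rewrite big_ord0 expn0 add0r divr1 big_geq// mulr0 addr0.
have e : (2 ^ N.+1 = 2 ^ N + 2 ^ N)%N by rewrite expnS mul2n addnn.
have D0 j : 0 <= D j by rewrite (le_trans _ (hD j))// sqr_ge0.
rewrite big_ord_recr /= (@big_cat_nat _ _ _ (2 ^ N)%N 1 (2 ^ N.+1)%N)//=; last 2 first.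
- by rewrite expn_gt0.
- by rewrite leq_exp2l.
have := @sqr_diff_le x D (2 ^ N) (2 ^ N) hD.
rewrite -e; set S := \sum_(2 ^ N <= j < 2 ^ N.+1) D j.
set T : R := (2 ^ N)%:R.
have T0 : 0 < T by rewrite ltr0n expn_gt0.
have -> : (2 ^ N.+1)%:R = 2 * T :> R by rewrite e natrD /T; ring.
set y := x (2 ^ N.+1)%N; set z := x (2 ^ N)%N in IH *; rewrite -/T in IH.
move=> h.
have : 4 * (y ^+ 2 / (2 * T)) <= 3 * (z ^+ 2 / T) + 6 * S.
  rewrite -(ler_pM2r T0).
  have -> : 4 * (y ^+ 2 / (2 * T)) * T = 2 * y ^+ 2 by field; rewrite gt_eqF.
  have -> : (3 * (z ^+ 2 / T) + 6 * S) * T = 3 * z ^+ 2 + 6 * (T * S).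
    by field; rewrite gt_eqF.
  (* Equivalent to 2 y^2 <= 3 z^2 + 6 (y - z)^2. *)
  have := sqr_ge0 (2 * (y - z) - z).
  move: h; rewrite !expr2; lra.
move: IH; rewrite -/z; lra.
Qed.

Definition badcount n : R :=
  if blockM n <= eps then 0 else 4 * Num.sqrt (blockM n / eps).

Lemma block_points n : exists P : seq nat, (size P)%:R <= badcount n /\
  forall x D, (forall j, (x j.+1 - x j) ^+ 2 <= D j) -> {in P, forall i, x i = 0} ->
    \sum_(2 ^ n <= j < 2 ^ n.+1) v j * x j ^+ 2 <=
    2 * eps * (x (2 ^ n)%N ^+ 2 / (2 ^ n)%:R + \sum_(2 ^ n <= j < 2 ^ n.+1) D j).
Proof.
have e : (2 ^ n.+1 = 2 ^ n + 2 ^ n)%N by rewrite expnS mul2n addnn.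
have T0 : 0 < (2 ^ n)%:R :> R by rewrite ltr0n expn_gt0.
rewrite /badcount; have [h|h] := leP (blockM n) eps.
  exists [::]; split => // x D hD _; apply: (le_trans (block_good n hD)).
  have D0 j : 0 <= D j by rewrite (le_trans _ (hD j))// sqr_ge0.
  apply: ler_wpM2r; last by rewrite ler_pM2l.
  by apply: addr_ge0; [apply: divr_ge0; [exact: sqr_ge0|exact: ltW]|exact: sumr_ge0].
have [P [sP HP]] := greedy (2 ^ n) (2 ^ n).
exists P; split.
  apply: (le_trans sP); rewrite -/(blockM n).
  have h1 : 1 < Num.sqrt (blockM n / eps) by exact: sqrt_ratio_gt1.
  lra.
move=> x D hD xP; have := HP x D hD xP; rewrite -e => /le_trans; apply.
have D0 j : 0 <= D j by rewrite (le_trans _ (hD j))// sqr_ge0.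
set S := \sum_(_ <= _ < _) _; have S0 : 0 <= S by exact: sumr_ge0.
have z0 : 0 <= x (2 ^ n)%N ^+ 2 / (2 ^ n)%:R by apply: divr_ge0; [exact: sqr_ge0|exact: ltW].
rewrite -mulrA [leRHS]mulrCA ler_pM2l//; lra.
Qed.

(** Blocks of small size are handled by Hardy's inequality and the others by their
    own points, the sets of points depending on v alone. *)
Lemma half_line_functionals : exists P : nat -> seq nat, (forall n, (size (P n))%:R <= badcount n) /\
  forall x D, (forall j, (x j.+1 - x j) ^+ 2 <= D j) -> x 0%N = 0 ->
    (forall n, {in P n, forall i, x i = 0}) -> forall N,
    \sum_(1 <= j < 2 ^ N) v j * x j ^+ 2 <= 14 * eps * \sum_(0 <= j < 2 ^ N) D j.
Proof.
have [P HP] := choice block_points.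
exists P; split; first by move=> n; have [] := HP n.
move=> x D hD x0 xP N.
have D0 j : 0 <= D j by rewrite (le_trans _ (hD j))// sqr_ge0.
have blocks : \sum_(1 <= j < 2 ^ N) v j * x j ^+ 2 <=
    2 * eps * (\sum_(n < N) (x (2 ^ n)%N ^+ 2 / (2 ^ n)%:R) + \sum_(1 <= j < 2 ^ N) D j).
  elim: N => [|N IH]; first by rewrite expn0 big_geq// big_ord0 big_geq// addr0 mulr0.
  have pN : (0 < 2 ^ N)%N by rewrite expn_gt0.
  have le2 : (2 ^ N <= 2 ^ N.+1)%N by rewrite leq_exp2l.
  rewrite (@big_cat_nat _ _ _ (2 ^ N)%N 1%N (2 ^ N.+1)%N)//= big_ord_recr/=.
  rewrite (@big_cat_nat _ _ _ (2 ^ N)%N 1%N (2 ^ N.+1)%N xpredT D)//=.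
  rewrite addrACA mulrDr; apply: lerD => //.
  by have [_ HN] := HP N; apply: HN.
apply: (le_trans blocks).
have h := hardy N hD.
(* The condition x_0 = 0 removes the boundary term of Hardy's inequality. *)
have d0 : x 1%N ^+ 2 <= D 0%N by have := hD 0%N; rewrite x0 subr0.
have pN : (0 < 2 ^ N)%N by rewrite expn_gt0.
rewrite [in leRHS](@big_cat_nat _ _ _ 1%N 0%N)//= big_nat1.
set S := \sum_(1 <= j < _) _ in h *; have S0 : 0 <= S by exact: sumr_ge0.
have -> : 14 * eps * (D 0%N + S) = 2 * eps * (7 * (D 0%N + S)) by ring.
rewrite ler_pM2l ?mulr_gt0//.
have z0 : 0 <= x (2 ^ N)%N ^+ 2 / (2 ^ N)%:R by apply: divr_ge0; [exact: sqr_ge0|].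
have := D0 0%N; lra.
Qed.

End Mass.
End HalfLine.

(** * Square rings *)
Section Ring.
Context {R : realType}.
Local Notation mu := (plane_measure R).
Local Notation T2 := (measurableTypeR R * measurableTypeR R)%type.
Implicit Types (s t : R).

Definition square t : rect := Rect (- t) t (- t) t.
Definition ring s t : set T2 := rset (square t) `\` rset (square s).

Definition base s t : rect (R := R) := Rect s t s t.

(** The eight rectangles around the hole; the default value makes facts about
    tiles hold for every index. *)
Definition tile s t (n : nat) : rect :=
  nth (base s t)
   [:: base s t; Rect (- s) s s t; Rect (- t) (- s) s t; Rect s t (- s) s;
       Rect s t (- t) (- s); Rect (- t) (- s) (- s) s; Rect (- t) (- s) (- t) (- s);
       Rect (- s) s (- t) (- s)] n.

Lemma ring_measurable s t : measurable (ring s t).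
Proof. by apply: measurableD; exact: rset_measurable. Qed.

Lemma rsetP (Q : rect (R := R)) x :
  rset Q x <-> (rl Q <= x.1 < rr Q) /\ (rb Q <= x.2 < rt Q).
Proof.
split; first by move=> [] /=; rewrite !in_itv.
by move=> [h1 h2]; split; rewrite /= in_itv.
Qed.

Lemma ringP s t x : ring s t x <->
  (- t <= x.1 < t /\ - t <= x.2 < t) /\ ~ (- s <= x.1 < s /\ - s <= x.2 < s).
Proof.
split.
  move=> [/rsetP[h1 h2] h]; split=> // -[h3 h4]; apply: h; exact/rsetP.
move=> [[h1 h2] h]; split; first exact/rsetP.
by move=> /rsetP[h3 h4]; apply: h.
Qed.

Ltac tile_cases n := case: n => [|[|[|[|[|[|[|[|n]]]]]]]].

Section Shape.
Variables s t : R.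
Hypotheses (s0 : 0 < s) (st2 : 2 * s <= t) (st4 : t <= 4 * s).

Lemma tile_fat n : fat (tile s t n).
Proof.
move: (s0) (st2) (st4) => hs0 hst2 hst4.
have hb : fat (base s t) by split; rewrite /proper /wd /ht /=; (try split); lra.
by tile_cases n; rewrite /tile /= ?nth_nil //; split; rewrite /proper /wd /ht /=; (try split); lra.
Qed.

Lemma tile_sub n : rset (tile s t n) `<=` ring s t.
Proof.
move: (s0) (st2) (st4) => hs0 hst2 hst4.
move=> x /rsetP [/andP[a b] /andP[c d]]; apply/ringP.
move: a b c d; have hb : s <= x.1 -> x.1 < t -> s <= x.2 -> x.2 < t ->
  (- t <= x.1 < t /\ - t <= x.2 < t) /\ ~ (- s <= x.1 < s /\ - s <= x.2 < s).
  move=> *; split; first by split; apply/andP; split; lra.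
  by move=> [/andP[? ?] /andP[? ?]]; lra.
by tile_cases n; rewrite /tile /= ?nth_nil //= => *; (split;
  [split; apply/andP; split; lra|move=> [/andP[? ?] /andP[? ?]]; lra]).
Qed.

Lemma tile_cover x : ring s t x -> exists2 n, (n < 8)%N & rset (tile s t n) x.
Proof.
move=> /ringP [[/andP[a b] /andP[c d]] h].
have mk n : (n < 8)%N -> (rl (tile s t n) <= x.1 < rr (tile s t n)) /\
    (rb (tile s t n) <= x.2 < rt (tile s t n)) -> exists2 n, (n < 8)%N & rset (tile s t n) x.
  by move=> n8 hn; exists n => //; apply/rsetP.
have [x1|x1] := leP s x.1; have [x2|x2] := leP s x.2.
- by apply: (mk 0%N) => //=; rewrite x1 x2 b d.
- have [x3|x3] := leP (- s) x.2.
    by apply: (mk 3%N) => //=; rewrite x1 x2 x3 b.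
  by apply: (mk 4%N) => //=; rewrite x1 x3 b c.
- have [x3|x3] := leP (- s) x.1.
    by apply: (mk 1%N) => //=; rewrite x1 x2 x3 d.
  by apply: (mk 2%N) => //=; rewrite x2 x3 a d.
- have [x3|x3] := leP (- s) x.1; have [x4|x4] := leP (- s) x.2.
  + by exfalso; apply: h; rewrite x1 x2 x3 x4.
  + by apply: (mk 7%N) => //=; rewrite x1 x3 x4 c.
  + by apply: (mk 5%N) => //=; rewrite x2 x3 x4 a.
  + by apply: (mk 6%N) => //=; rewrite x3 x4 a c.
Qed.

Lemma ring_tiles (phi : T2 -> R) : measurable_fun setT phi -> (forall x, 0 <= phi x) ->
  (\int[mu]_(x in ring s t) (phi x)%:E <= \sum_(n < 8) \int[mu]_(x in rset (tile s t n)) (phi x)%:E)%E.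
Proof.
move=> mphi p0; have mr := ring_measurable s t.
have mt n := rset_measurable (tile s t n).
have mE : measurable_fun setT (EFin \o phi) by exact/measurable_EFinP.
have mres (A : set T2) (mA : measurable A) : measurable_fun setT ((EFin \o phi) \_ A).
  by apply: ((measurable_restrictT _ mA).1); exact: measurable_funTS.
rewrite integral_mkcond.
under eq_bigr do rewrite integral_mkcond.
rewrite -ge0_integral_sum//; last first.
- by move=> n x _; rewrite patchE; case: ifP => // _; rewrite lee_fin.
- by move=> n; exact: mres.
apply: ge0_le_integral => //.
- by move=> x _; rewrite patchE; case: ifP => // _; rewrite lee_fin.
- exact: (mres (ring s t)).
- by apply: emeasurable_sum => n; exact: mres.
move=> x _; rewrite patchE; case: ifPn => [|_]; last first.
  by apply: sume_ge0 => n _; rewrite patchE; case: ifP => // _; rewrite lee_fin.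
rewrite inE => /tile_cover [n n8 hn].
rewrite (bigD1 (Ordinal n8))//= patchE mem_set// leeDl//.
by apply: sume_ge0 => m _; rewrite patchE; case: ifP => // _; rewrite lee_fin.
Qed.

Section Tame.
Variables f u : R * R -> R.
Hypothesis tfu : tame f u.

Definition Er s t : R := \int[mu]_(x in ring s t) u x.

Lemma En_ring Q : rset Q `<=` ring s t -> En u Q <= Er s t.
Proof.
have [[_ u0] _ _ _ _] := tfu.
move=> h; apply: Rint_mono => //; [exact: rset_measurable|exact: ring_measurable|].
by apply: (tame_u_int tfu); exact: ring_measurable.
Qed.

Lemma Er_ge0 : 0 <= Er s t.
Proof. by have [[_ u0] _ _ _ _] := tfu; apply: Rintegral_ge0 => x _. Qed.

Let row a1 b1 a2 b2 c d : - t <= a1 -> a1 < b1 -> b1 <= t -> - t <= a2 -> a2 < b2 -> b2 <= t ->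
  (c = s /\ d = t) \/ (c = - t /\ d = - s) ->
  (avg f (Rect a1 b1 c d) - avg f (Rect a2 b2 c d)) ^+ 2 <= 8 * Er s t.
Proof.
move: (s0) (st2) (st4) => hs0 hst2 hst4.
have [_ _ _ sx _] := tfu.
move=> h1 h2 h3 h4 h5 h6 h7.
have cd : d - c = t - s by case: h7 => -[-> ->]; lra.
have := sx _ _ _ _ c d _ _ h1 h2 h3 h4 h5 h6; rewrite -subr_gt0 cd => /(_ _)/le_trans; apply; first lra.
apply: ler_pM => //; first by rewrite divr_ge0; lra.
- exact: (En_ge0 tfu).
- by rewrite ler_pdivrMr; lra.
apply: En_ring => x /rsetP /= [/andP[p q] /andP[p' q']]; apply/ringP.
by case: h7 => -[e1 e2]; rewrite e1 in p'; rewrite e2 in q'; (split;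
  [split; apply/andP; split; lra|move=> [/andP[? ?] /andP[? ?]]; lra]).
Qed.

Let col a1 b1 a2 b2 c d : - t <= a1 -> a1 < b1 -> b1 <= t -> - t <= a2 -> a2 < b2 -> b2 <= t ->
  (c = s /\ d = t) \/ (c = - t /\ d = - s) ->
  (avg f (Rect c d a1 b1) - avg f (Rect c d a2 b2)) ^+ 2 <= 8 * Er s t.
Proof.
move: (s0) (st2) (st4) => hs0 hst2 hst4.
have [_ _ _ _ sy] := tfu.
move=> h1 h2 h3 h4 h5 h6 h7.
have cd : d - c = t - s by case: h7 => -[-> ->]; lra.
have := sy _ _ _ _ c d _ _ h1 h2 h3 h4 h5 h6; rewrite -subr_gt0 cd => /(_ _)/le_trans; apply; first lra.
apply: ler_pM => //; first by rewrite divr_ge0; lra.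
- exact: (En_ge0 tfu).
- by rewrite ler_pdivrMr; lra.
apply: En_ring => x /rsetP /= [/andP[p q] /andP[p' q']]; apply/ringP.
by case: h7 => -[e1 e2]; rewrite e1 in p; rewrite e2 in q; (split;
  [split; apply/andP; split; lra|move=> [/andP[? ?] /andP[? ?]]; lra]).
Qed.

(** Every tile is reached from the base tile by at most two steps inside a row or
    a column of the ring; 32 = 2 (8 + 8). *)
Lemma tile_base n : (avg f (tile s t n) - avg f (base s t)) ^+ 2 <= 32 * Er s t.
Proof.
move: (s0) (st2) (st4) => hs0 hst2 hst4.
have E0 := Er_ge0.
have one Q : (avg f Q - avg f (base s t)) ^+ 2 <= 8 * Er s t ->
  (avg f Q - avg f (base s t)) ^+ 2 <= 32 * Er s t.
  by move=> h; apply: (le_trans h); lra.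
have two Q Q' : (avg f Q - avg f Q') ^+ 2 <= 8 * Er s t ->
  (avg f Q' - avg f (base s t)) ^+ 2 <= 8 * Er s t ->
  (avg f Q - avg f (base s t)) ^+ 2 <= 32 * Er s t.
  have := sqr_ge0 ((avg f Q - avg f Q') - (avg f Q' - avg f (base s t))).
  rewrite !expr2; lra.
have zero : (avg f (base s t) - avg f (base s t)) ^+ 2 <= 32 * Er s t.
  by rewrite subrr expr0n/=; lra.
have nt : - t < - s by lra.
have ss : - s < s by lra.
have top : (s = s /\ t = t) \/ (s = - t /\ t = - s) by left.
have bot : (- t = s /\ - s = t) \/ (- t = - t /\ - s = - s) by right.
tile_cases n; rewrite /tile /= ?nth_nil //.
- by apply: one; apply: row => //; lra.
- by apply: one; apply: row => //; lra.
- by apply: one; apply: col => //; lra.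
- by apply: one; apply: col => //; lra.
- apply: (two _ (Rect (- t) (- s) s t)); first by apply: col => //; lra.
  by apply: row => //; lra.
- apply: (two _ (Rect (- t) (- s) s t)); first by apply: col => //; lra.
  by apply: row => //; lra.
- apply: (two _ (Rect s t (- t) (- s))); first by apply: row => //; lra.
  by apply: col => //; lra.
Qed.

End Tame.
End Shape.

(** One horizontal and one vertical step through the rectangle that has the
    width of the outer and the height of the inner base tile. *)
Lemma base_next (f u : R * R -> R) s t t' : tame f u -> 0 < s ->
  2 * s <= t -> t <= 4 * s -> 2 * t <= t' -> t' <= 4 * t ->
  (avg f (base t t') - avg f (base s t)) ^+ 2 <= 20 * (Er u s t + Er u t t').
Proof.
move=> tfu s0 st st4 tt tt4; have [[_ u0] _ _ sx sy] := tfu.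
set Q := Rect t t' s t.
have E1 := Er_ge0 s t tfu; have E2 := Er_ge0 t t' tfu.
have e1 : En u (Rect s t' s t) <= Er u s t + Er u t t'.
  have dec : rset (Rect s t' s t) = rset (base s t) `|` rset Q.
    apply/seteqP; split => x.
      move=> /rsetP /= [/andP[p q] h]; have [x1|x1] := leP t x.1; [right|left]; apply/rsetP => /=.
        by rewrite x1 q.
      by rewrite p x1.
    by move=> [] /rsetP /= [/andP[p q] h]; apply/rsetP; split => //=; apply/andP; split; lra.
  rewrite /En dec Rintegral_setU; try exact: rset_measurable; last 2 first.
  - by apply: (tame_u_int tfu); apply: measurableU; exact: rset_measurable.
  - apply/disj_setPS => x [/rsetP /= [/andP[p q] _] /rsetP /= [/andP[p' q'] _]]; lra.
  apply: lerD; apply: (En_ring tfu) => x /rsetP /= [/andP[p q] /andP[p' q']]; apply/ringP; (split;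
    [split; apply/andP; split; lra|move=> [/andP[? ?] /andP[? ?]]; lra]).
have e2 : En u (Rect t t' s t') <= Er u t t'.
  apply: (En_ring tfu) => x /rsetP /= [/andP[p q] /andP[p' q']]; apply/ringP; split;
    [split; apply/andP; split; lra|move=> [/andP[? ?] /andP[? ?]]; lra].
have st1 : s < t by lra.
have tt1 : t < t' by lra.
have d1 : 0 <= (t' - s) / (t - s).
  by apply: divr_ge0; rewrite subr_ge0 ltW// (lt_trans st1).
have d2 : 0 <= (t' - s) / (t' - t).
  by apply: divr_ge0; rewrite subr_ge0 ltW// (lt_trans st1).
have h1 : (avg f Q - avg f (base s t)) ^+ 2 <= 8 * (Er u s t + Er u t t').
  have h := sx t t' s t s t s t' (ltW st1) tt1 (lexx _) (lexx _) st1 (ltW tt1) st1.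
  apply: (le_trans h); apply: (ler_pM d1 (En_ge0 tfu _) _ e1).
  by rewrite ler_pdivrMr ?subr_gt0//; lra.
have h2 : (avg f (base t t') - avg f Q) ^+ 2 <= 2 * Er u t t'.
  have h := sy t t' s t t t' s t' (ltW st1) tt1 (lexx _) (lexx _) st1 (ltW tt1) tt1.
  apply: (le_trans h); apply: (ler_pM d2 (En_ge0 tfu _) _ e2).
  by rewrite ler_pdivrMr ?subr_gt0//; lra.
have := sqr_ge0 ((avg f (base t t') - avg f Q) - (avg f Q - avg f (base s t))).
rewrite !expr2 in h1 h2 *; lra.
Qed.

End Ring.

(** * Functionals for one ring *)
Section RingFunctionals.
Context {R : realType}.
Local Notation mu := (plane_measure R).
Local Notation T2 := (measurableTypeR R * measurableTypeR R)%type.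
Variables (p : R) (V : R * R -> R) (s t : R).
Hypotheses (p1 : 1 < p) (mV : measurable_fun (setT : set T2) V) (V0 : forall x, 0 <= V x).
Hypotheses (s0 : 0 < s) (st2 : 2 * s <= t) (st4 : t <= 4 * s).

Definition ringV : T2 -> R := V \_ (ring s t).
Hypothesis iV : mu.-integrable setT (EFin \o (fun x => ringV x `^ p)).

Lemma ringV_measurable : measurable_fun setT ringV.
Proof.
apply: ((measurable_restrictT V (ring_measurable s t)).1); exact: measurable_funTS.
Qed.

Lemma ringV_ge0 x : 0 <= ringV x.
Proof. by rewrite /ringV patchE; case: ifP. Qed.

Lemma ringV_on n x : rset (tile s t n) x -> ringV x = V x.
Proof. by move=> /(tile_sub s0 st2 st4) h; rewrite /ringV patchE mem_set. Qed.

(** Eight tiles, a factor 3 for splitting f into three parts, and the 32 of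
    [tile_base]: 8 * 3 * 32 = 768. *)
Definition ringC : R := 24 * sobC (thetap p) + 768.

(** For a small weight, f is split into its deviation from the mean over the tile,
    the difference of the means over the tile and over the base tile, and the mean
    over the base tile; the last part is left to the half-line problem.  For a
    large weight the stopping pieces in the eight tiles are used and the radial
    part disappears. *)
Lemma ring_functionals (delta beta : R) : 0 < delta ->
  (forall n, Jp p ringV (tile s t n) <= beta) ->
  exists L : seq (rect (R := R)),
   (size L)%:R <= (if beta <= delta then 0
                   else 8 * Num.max 1 (stopK (thetap p) * (beta / delta))) /\
   forall f u v, tame f u -> vanish f L -> (\int[mu]_(x in ring s t) (V x)%:E <= v%:E)%E ->
    (\int[mu]_(x in ring s t) (V x * f x ^+ 2)%:E <=
     (ringC * delta * Er u s t + 24 * (avg f (base s t) ^+ 2 * v))%:E)%E.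
Proof.
move=> d0 hb.
have mw := ringV_measurable; have w0 := ringV_ge0.
have th0 := thetap_ge0 p; have th1 := thetap_lt1 p1.
have C0 := sobC_gt0 th1; set C := sobC (thetap p) in C0 *.
have Jh := Jp_holder p1 mw w0 iV; have Jc := Jp_child p1 iV.
have Js := Jp_sum p1 iV.
have mT n := rset_measurable (tile s t n).
have mr := ring_measurable s t.
have mVf (f : R * R -> R) : measurable_fun (setT : set T2) f ->
    measurable_fun (setT : set T2) (fun x : T2 => V x * f x ^+ 2).
  by move=> mf; apply: measurable_funM => //; exact: measurable_funX.
have split8 f u c : tame f u -> (forall n, (n < 8)%N ->
    (\int[mu]_(x in rset (tile s t n)) (ringV x * f x ^+ 2)%:E <= c%:E)%E) ->
    (\int[mu]_(x in ring s t) (V x * f x ^+ 2)%:E <= (8 * c)%:E)%E.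
  move=> [[mf _] _ _ _ _] h.
  apply: (le_trans (ring_tiles s t (mVf _ mf) _)).
    by move=> x; rewrite mulr_ge0// sqr_ge0.
  apply: (@le_trans _ _ (\sum_(n < 8) c%:E)%E).
    apply: lee_sum => n _; apply: le_trans (h n (ltn_ord n)).
    rewrite le_eqVlt; apply/orP; left; apply/eqP; apply: eq_integral => x.
    by rewrite inE => xQ; rewrite (ringV_on xQ).
  by rewrite sumEFin lee_fin sumr_const card_ord -[X in X <= _]mulr_natl.
have [hd|hd] := leP beta delta.
  exists [::]; split => // f u v tfu _ hv.
  have E0 := Er_ge0 s t tfu; have [[mf u0] _ _ _ _] := tfu.
  have v0 : 0 <= v.
    by rewrite -lee_fin; apply: le_trans hv; apply: integral_ge0 => x _; rewrite lee_fin.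
  have -> : ringC * delta * Er u s t + 24 * (avg f (base s t) ^+ 2 * v) =
      8 * (3 * (C * delta * Er u s t) + (96 * Er u s t * delta + 3 * avg f (base s t) ^+ 2 * v)).
    by rewrite /ringC -/C; ring.
  apply: (split8 f u _ tfu) => n n8; set Q := tile s t n.
  have fQ : fat Q by exact: tile_fat.
  have mQ : measurable (rset Q) by exact: rset_measurable.
  have [pQ _ _] := fQ.
  set a := (avg f Q - avg f (base s t)) ^+ 2.
  set b := avg f (base s t) ^+ 2.
  have a0 : 0 <= a by exact: sqr_ge0.
  have b0 : 0 <= b by exact: sqr_ge0.
  have aE : a <= 32 * Er u s t by exact: tile_base.
  have mwQ : measurable_fun (rset Q) (EFin \o ringV).
    by apply: measurable_funTS; apply/measurable_EFinP.
  have mwd : measurable_fun (rset Q) (fun x : T2 => (ringV x * (f x - avg f Q) ^+ 2)%:E).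
    apply: measurable_funTS; apply/measurable_EFinP; apply: measurable_funM => //.
    by apply: measurable_funX; apply: measurable_funB.
  apply: (@le_trans _ _ (\int[mu]_(x in rset Q)
     (3%:E * (ringV x * (f x - avg f Q) ^+ 2)%:E + (3 * a + 3 * b)%:E * (ringV x)%:E))%E).
    apply: ge0_le_integral => //.
    - by move=> x _; rewrite lee_fin; apply: mulr_ge0 => //; exact: sqr_ge0.
    - by apply: measurable_funTS; apply/measurable_EFinP; apply: measurable_funM => //;
        exact: measurable_funX.
    - by apply: emeasurable_funD; apply: emeasurable_funM.
    move=> x _; rewrite -!EFinM -EFinD lee_fin.
    have -> : 3 * (ringV x * (f x - avg f Q) ^+ 2) + (3 * a + 3 * b) * ringV x =
      ringV x * (3 * (f x - avg f Q) ^+ 2 + 3 * a + 3 * b) by ring.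
    apply: ler_wpM2l => //; rewrite /a /b.
    set y1 := f x; set y2 := avg f Q; set y3 := avg f _.
    have := sqr_ge0 ((y1 - y2) - (y2 - y3)); have := sqr_ge0 ((y1 - y2) - y3).
    have := sqr_ge0 ((y2 - y3) - y3); rewrite !expr2; lra.
  have z1 : (\int[mu]_(x in rset Q) (3%:E * (ringV x * (f x - avg f Q) ^+ 2)%:E) =
      3%:E * \int[mu]_(x in rset Q) (ringV x * (f x - avg f Q) ^+ 2)%:E)%E.
    rewrite ge0_integralZl_EFin//.
    by move=> x _; rewrite lee_fin; apply: mulr_ge0 => //; exact: sqr_ge0.
  have ab0 : 0 <= 3 * a + 3 * b by lra.
  have z2 : (\int[mu]_(x in rset Q) ((3 * a + 3 * b)%:E * (ringV x)%:E) =
      (3 * a + 3 * b)%:E * \int[mu]_(x in rset Q) (ringV x)%:E)%E.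
    by rewrite ge0_integralZl_EFin// => x _; rewrite lee_fin.
  rewrite ge0_integralD//; try (by apply: emeasurable_funM => //);
    try (by move=> x _; rewrite -EFinM lee_fin; apply: mulr_ge0 => //; apply: mulr_ge0 => //; exact: sqr_ge0);
    try (by move=> x _; rewrite -EFinM lee_fin; apply: mulr_ge0).
  rewrite z1 z2.
  have EQ : En u Q <= Er u s t by apply: (En_ring tfu); exact: tile_sub.
  have E1 := En_ge0 tfu Q.
  have J0 : 0 <= Jp p ringV Q by exact: Jp_ge0.
  have Jd : Jp p ringV Q <= delta by exact: le_trans (hb n) hd.
  rewrite [X in (_ <= X)%E]EFinD; apply: leeD.
    rewrite [X in (_ <= X)%E]EFinM; apply: lee_wpmul2l; first by rewrite lee_fin.
    apply: (le_trans (sobolev tfu mw w0 th0 th1 Jh Jc fQ)).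
    rewrite lee_fin -/C; apply: ler_pM => //; first by apply: mulr_ge0 => //; exact: ltW.
    by rewrite ler_pM2l.
  have hw1 : (\int[mu]_(x in rset Q) (ringV x)%:E <= delta%:E)%E.
    by apply: (le_trans (Jh _ pQ)); rewrite lee_fin.
  have hw2 : (\int[mu]_(x in rset Q) (ringV x)%:E <= v%:E)%E.
    apply: le_trans hv.
    apply: (@le_trans _ _ (\int[mu]_(x in rset Q) (V x)%:E)%E).
      rewrite le_eqVlt; apply/orP; left; apply/eqP; apply: eq_integral => x.
      by rewrite inE => xQ; rewrite (ringV_on xQ).
    apply: ge0_subset_integral => //.
    - by apply: measurable_funTS; apply/measurable_EFinP.
    - by move=> x _; rewrite lee_fin.
    - exact: tile_sub.
  have a30 : 0 <= 3 * a by apply: mulr_ge0.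
  have b30 : 0 <= 3 * b by apply: mulr_ge0.
  rewrite EFinD ge0_muleDl ?lee_fin//.
  rewrite [X in (_ <= X)%E]EFinD; apply: leeD.
    apply: (le_trans (lee_wpmul2l _ hw1)); first by rewrite lee_fin.
    rewrite -EFinM lee_fin; apply: ler_wpM2r; [exact: ltW|lra].
  apply: (le_trans (lee_wpmul2l _ hw2)); first by rewrite lee_fin.
  by rewrite -EFinM lee_fin.
have K0 : 0 < stopK (thetap p) by rewrite /stopK addr_gt0// divr_gt0// subr_gt0.
have hL n : exists L : seq (rect (R := R)),
    (size L)%:R <= Num.max 1 (stopK (thetap p) * (beta / delta)) /\
    forall f u, tame f u -> vanish f L ->
      (\int[mu]_(x in rset (tile s t n)) (ringV x * f x ^+ 2)%:E <=
       (C * delta * En u (tile s t n))%:E)%E.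
  have [L [sL HL]] := stopping mw w0 th0 th1 Jh Jc Js d0 (tile_fat s0 st2 st4 n).
  exists L; split => //; apply: (le_trans sL).
  rewrite ge_max le_max lexx /= le_max; apply/orP; right.
  apply: (@le_trans _ _ (stopK (thetap p) * (Jp p ringV (tile s t n) / delta))).
    by rewrite lerBlDr lerDl.
  by rewrite ler_pM2l// ler_pM2r ?invr_gt0//; exact: hb.
have hN N : exists L : seq (rect (R := R)),
    (size L)%:R <= N%:R * Num.max 1 (stopK (thetap p) * (beta / delta)) /\
    forall f u, tame f u -> vanish f L -> forall n, (n < N)%N ->
      (\int[mu]_(x in rset (tile s t n)) (ringV x * f x ^+ 2)%:E <=
       (C * delta * En u (tile s t n))%:E)%E.
  elim: N => [|N [L [sL HL]]]; first by exists [::]; split; rewrite ?mul0r.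
  have [L' [sL' HL']] := hL N.
  exists (L ++ L'); split.
    by rewrite size_cat natrD -natr1 mulrDl mul1r lerD.
  move=> f u tfu /vanish_cat[v1 v2] n; rewrite ltnS leq_eqVlt => /orP[/eqP ->|nN].
    exact: HL'.
  exact: HL.
have [L [sL HL]] := hN 8%N.
exists L; split => // f u v tfu vf hv.
have E0 := Er_ge0 s t tfu.
have v0 : 0 <= v.
  by rewrite -lee_fin; apply: le_trans hv; apply: integral_ge0 => x _; rewrite lee_fin.
apply: (@le_trans _ _ (8 * (C * delta * Er u s t))%:E).
  apply: (split8 f u _ tfu) => n n8; apply: (le_trans (HL f u tfu vf n n8)).
  rewrite lee_fin ler_wpM2l//; first by rewrite mulr_ge0// ltW.
  by apply: (En_ring tfu); exact: tile_sub.
rewrite lee_fin; apply: (@le_trans _ _ (ringC * delta * Er u s t)); last first.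
  by rewrite lerDl; apply: mulr_ge0 => //; apply: mulr_ge0 => //; exact: sqr_ge0.
rewrite /ringC -/C -subr_ge0.
have -> : (24 * C + 768) * delta * Er u s t - 8 * (C * delta * Er u s t) =
  (16 * C + 768) * delta * Er u s t by ring.
have h1 : 0 <= 16 * C + 768 by apply: addr_ge0 (ler0n _ _); apply: mulr_ge0 (ler0n _ _) (ltW C0).
exact: (mulr_ge0 (mulr_ge0 h1 (ltW d0)) E0).
Qed.

End RingFunctionals.

(** * Round annuli and square rings *)
Section Annuli.
Context {R : realType}.
Local Notation mu := (plane_measure R).
Local Notation leb := (@lebesgue_measure R).
Local Notation T2 := (measurableTypeR R * measurableTypeR R)%type.

Lemma euclid_measurable : measurable_fun (setT : set T2) (@euclid R).
Proof.
apply: (@measurableT_comp _ _ _ _ _ _ (@Num.sqrt R : measurableTypeR R -> measurableTypeR R)).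
  by apply: continuous_measurable_fun; exact: sqrt_continuous.
by apply: measurable_funD; apply: measurable_funX; [exact: measurable_fst|exact: measurable_snd].
Qed.

Lemma euclid_sqr (x : R * R) : euclid x ^+ 2 = x.1 ^+ 2 + x.2 ^+ 2.
Proof. by rewrite sqr_sqrtr// addr_ge0 ?sqr_ge0. Qed.

Lemma euclid_ge0 (x : R * R) : 0 <= euclid x.
Proof. exact: sqrtr_ge0. Qed.

Definition circle (r : R) : set T2 := [set x | euclid x = r].

Lemma circle_measurable r : measurable (circle r).
Proof.
have -> : circle r = (@euclid R) @^-1` [set r] by [].
by rewrite -[X in measurable X]setTI; apply: euclid_measurable.
Qed.

(** Each vertical line meets a circle in at most two points. *)
Lemma circle_null r : mu (circle r) = 0%E.
Proof.
rewrite /plane_measure /product_measure1 /=.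
apply: integral0_eq => x _ /=.
apply: countable_lebesgue_measure0.
apply: (@sub_countable _ _ _ [set Num.sqrt (r ^+ 2 - x ^+ 2); - Num.sqrt (r ^+ 2 - x ^+ 2)]).
  apply: subset_card_le => y; rewrite /xsection /= inE /circle /= => e.
  have : r ^+ 2 = x ^+ 2 + y ^+ 2 by rewrite -e euclid_sqr.
  move=> ->; rewrite addrAC subrr add0r sqrtr_sqr.
  by case: (ger0P y) => _; rewrite ?opprK; [left|right].
by apply: finite_set_countable; exact: finite_set2.
Qed.

Definition shell (a b : R) : set T2 := [set x | a < euclid x < b].

Lemma shell_measurable a b : measurable (shell a b).
Proof.
have -> : shell a b = (@euclid R) @^-1` [set` `]a, b[].
  by apply/seteqP; split => x /=; rewrite in_itv.
rewrite -[X in measurable X]setTI; apply: euclid_measurable => //; exact: measurable_itv.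
Qed.

Lemma annulusW_measurable n : measurable (@annulusW R n : set T2).
Proof. exact: shell_measurable. Qed.

Lemma annulusU_measurable n : measurable (@annulusU R n : set T2).
Proof. by case: n => [[|k]|k]; exact: shell_measurable. Qed.

(** Three sets suffice below; the null set absorbs the circles that separate
    consecutive open annuli. *)
Lemma int_cover3 (A B1 B2 B3 Z : set T2) (phi : T2 -> R) :
  measurable A -> measurable B1 -> measurable B2 -> measurable B3 -> measurable Z ->
  mu Z = 0%E -> measurable_fun setT phi -> (forall x, 0 <= phi x) ->
  (forall x, A x -> [\/ B1 x, B2 x, B3 x | Z x]) ->
  (\int[mu]_(x in A) (phi x)%:E <= \int[mu]_(x in B1) (phi x)%:E +
    \int[mu]_(x in B2) (phi x)%:E + \int[mu]_(x in B3) (phi x)%:E)%E.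
Proof.
move=> mA m1 m2 m3 mZ Z0 mphi p0 hA.
have mE : measurable_fun setT (EFin \o phi) by exact/measurable_EFinP.
have mS (D : set T2) : measurable_fun D (EFin \o phi) by exact: measurable_funTS.
have mr (D : set T2) (mD : measurable D) : measurable_fun setT ((EFin \o phi) \_ D).
  by apply: ((measurable_restrictT _ mD).1).
have r0 (D : set T2) x : (0 <= ((EFin \o phi) \_ D) x)%E.
  by rewrite patchE; case: ifP => // _; rewrite lee_fin.
have -> : (\int[mu]_(x in A) (phi x)%:E = \int[mu]_(x in A `\` Z) (phi x)%:E)%E.
  by apply: ge0_negligible_integral => // x _; rewrite lee_fin.
have mAZ : measurable (A `\` Z) by exact: measurableD.
rewrite [leLHS]integral_mkcond (integral_mkcond B1) (integral_mkcond B2) (integral_mkcond B3).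
rewrite -!ge0_integralD//; try exact: mr; try (by move=> x _; exact: r0);
  try (by move=> x _; rewrite adde_ge0//; exact: r0); try (by apply: emeasurable_funD; exact: mr).
apply: ge0_le_integral => //; try exact: mr; try (by move=> x _; exact: r0).
  by apply: emeasurable_funD; [apply: emeasurable_funD|]; exact: mr.
move=> x _; rewrite [X in (X <= _)%E]patchE; case: ifPn => [|_]; last first.
  by rewrite !adde_ge0//; exact: r0.
rewrite inE => -[/hA h nZ].
have [h1|h2|h3|//] := h.
- by rewrite [X in (_ <= X + _ + _)%E]patchE mem_set// -addeA leeDl// adde_ge0//; exact: r0.
- rewrite [X in (_ <= _ + X + _)%E]patchE mem_set// addeAC leeDr// adde_ge0//; exact: r0.
- rewrite [X in (_ <= _ + _ + X)%E]patchE mem_set// leeDr// adde_ge0//; exact: r0.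
Qed.

Lemma e_ge2 : 2 <= expR 1 :> R.
Proof. by have := @expR_ge1Dx R 1; rewrite -[1 + 1]/(2%:R). Qed.

(** From exp(-1/2) >= 1/2. *)
Lemma e_le4 : expR 1 <= 4 :> R.
Proof.
have h := @expR_ge1Dx R (- 2^-1).
have h2 : expR (2^-1) <= 2 :> R.
  have e0 := expR_gt0 (2^-1 : R); rewrite expRN in h.
  have : (expR (2^-1))^-1 * expR (2^-1) = 1 :> R by rewrite mulVf// gt_eqF.
  have : (1 + - 2^-1) * expR (2^-1) <= (expR (2^-1))^-1 * expR (2^-1) :> R.
    by rewrite ler_pM2r.
  move=> h3 h4; rewrite h4 in h3; lra.
have -> : (1 : R) = 2^-1 + 2^-1 by lra.
have e0 := expR_ge0 (2^-1 : R).
rewrite expRD; nra.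
Qed.

(** Passing from the sup norm to the Euclidean norm costs a factor sqrt 2 < e, so a
    square ring meets only the annulus of the same index and the next one. *)
Lemma ring_euclid s t (x : R * R) : 0 < s -> s <= t -> ring s t x ->
  s <= euclid x < expR 1 * t.
Proof.
move=> s0 st /ringP [[/andP[a b] /andP[c d]] h].
have e2 := e_ge2; have n0 := euclid_ge0 x; have e := euclid_sqr x.
apply/andP; split.
  rewrite leNgt; apply/negP => ne; apply: h.
  have h1 : `|x.1| < s.
    apply: le_lt_trans ne; rewrite -[leRHS]ger0_norm// -ler_sqr ?nnegrE// !real_normK ?num_real//.
    by rewrite e lerDl sqr_ge0.
  have h2 : `|x.2| < s.
    apply: le_lt_trans ne; rewrite -[leRHS]ger0_norm// -ler_sqr ?nnegrE// !real_normK ?num_real//.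
    by rewrite e lerDr sqr_ge0.
  move: h1 h2; rewrite !ltr_norml => /andP[p q] /andP[p' q'].
  by rewrite (ltW p) (ltW p') q q'.
have t0 : 0 < t by exact: lt_le_trans st.
have x1 : x.1 ^+ 2 <= t ^+ 2.
  by rewrite -[x.1 ^+ 2]real_normK ?num_real// ler_sqr ?nnegrE ?(ltW t0)// ler_norml a (ltW b).
have x2 : x.2 ^+ 2 <= t ^+ 2.
  by rewrite -[x.2 ^+ 2]real_normK ?num_real// ler_sqr ?nnegrE ?(ltW t0)// ler_norml c (ltW d).
have et : 2 * t <= expR 1 * t by rewrite ler_pM2r.
apply: lt_le_trans et; rewrite -ltr_sqr ?nnegrE//; last by rewrite mulr_ge0// ltW.
rewrite e exprMn; have : 0 < t ^+ 2 by rewrite exprn_gt0.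
lra.
Qed.

Definition erad (k : int) : R := expR k%:~R.

Lemma eradS k : erad (k + 1) = expR 1 * erad k.
Proof. by rewrite /erad intrD expRD mulrC. Qed.

Lemma erad_gt0 k : 0 < erad k. Proof. exact: expR_gt0. Qed.

Lemma erad_le k : erad k <= erad (k + 1).
Proof. by rewrite eradS ler_peMl ?(ltW (erad_gt0 _))// (le_trans _ e_ge2)// ler1n. Qed.

Lemma erad2 k : 2 * erad k <= erad (k + 1).
Proof. by rewrite eradS ler_pM2r ?erad_gt0// e_ge2. Qed.

Lemma erad4 k : erad (k + 1) <= 4 * erad k.
Proof. by rewrite eradS ler_pM2r ?erad_gt0// e_le4. Qed.

Lemma ring_W (phi : T2 -> R) k : measurable_fun setT phi -> (forall x, 0 <= phi x) ->
  (\int[mu]_(x in ring (erad k) (erad (k + 1))) (phi x)%:E <=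
   \int[mu]_(x in annulusW k) (phi x)%:E + \int[mu]_(x in annulusW (k + 1)) (phi x)%:E)%E.
Proof.
move=> mphi p0.
have := @int_cover3 (ring (erad k) (erad (k + 1))) (annulusW k) (annulusW (k + 1)) set0
  (circle (erad k) `|` circle (erad (k + 1))) phi.
rewrite integral_set0 adde0; apply => //.
- exact: ring_measurable.
- exact: annulusW_measurable.
- exact: annulusW_measurable.
- by apply: measurableU; exact: circle_measurable.
- by apply/null_set_setU; try exact: circle_measurable; exact: circle_null.
move=> x /(ring_euclid (erad_gt0 k) (erad_le k)) /andP[h1 h2].
rewrite -eradS in h2.
rewrite /annulusW /= -/(erad k) -/(erad (k + 1)) -/(erad (k + 1 + 1)).
move: h1; rewrite le_eqVlt => /orP[/eqP h1|h1]; first by constructor 4; left; rewrite /circle /= h1.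
have [h|h|h] := ltgtP (euclid x) (erad (k + 1)).
- by constructor 1; rewrite h1.
- by constructor 2; rewrite ?h h2.
- by constructor 4; right.
Qed.

Lemma ring_cat (s t r : R) : 0 < s -> s <= t -> t <= r ->
  ring s r = ring s t `|` ring t r /\ [disjoint ring s t & ring t r].
Proof.
move=> s0 st tr.
have sub (a b : R) (x : T2) : a <= b -> rset (square a) x -> rset (square b) x.
  by move=> ab /rsetP /= [/andP[p q] /andP[p' q']]; apply/rsetP => /=; split; apply/andP; split; lra.
split; last by apply/disj_setPS => x [[h _] [_ h']]; exact: h'.
apply/seteqP; split => x.
  move=> [h1 h2]; have [h|h] := pselect (rset (square t) x); [left|right]; by split.
move=> [[h1 h2]|[h1 h2]]; split => //; first exact: sub h1.
by move=> h; apply: h2; exact: sub h.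
Qed.

Lemma int_ring_cat (phi : T2 -> R) (s t r : R) : measurable_fun setT phi -> (forall x, 0 <= phi x) ->
  0 < s -> s <= t -> t <= r ->
  (\int[mu]_(x in ring s r) (phi x)%:E =
   \int[mu]_(x in ring s t) (phi x)%:E + \int[mu]_(x in ring t r) (phi x)%:E)%E.
Proof.
move=> mphi p0 s0 st tr; have [e d] := ring_cat s0 st tr.
have mr := @ring_measurable R.
rewrite e ge0_integral_setU//; last by move=> x _; rewrite lee_fin.
by apply: measurable_funTS; apply/measurable_EFinP.
Qed.

Section Weights.
Variable V : R * R -> R.
Hypotheses (mV : measurable_fun (setT : set T2) V) (V0 : forall x, 0 <= V x).

Lemma logweight_measurable :
  measurable_fun (setT : set T2) (fun x : T2 => V x * (1 + `|ln (euclid x)|)).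
Proof.
apply: measurable_funM => //; apply: measurable_funD => //.
apply: measurableT_comp => //.
by apply: (measurableT_comp (@measurable_ln R)); exact: euclid_measurable.
Qed.

Lemma block_cover (A B1 B2 B3 Z : set T2) (c : R) :
  measurable A -> measurable B1 -> measurable B2 -> measurable B3 -> measurable Z ->
  mu Z = 0%E -> 0 <= c ->
  (forall x, A x -> [\/ B1 x, B2 x, B3 x | Z x]) ->
  (forall x, A x -> c <= 1 + `|ln (euclid x)|) ->
  (c%:E * \int[mu]_(x in A) (V x)%:E <=
    \int[mu]_(x in B1) (V x * (1 + `|ln (euclid x)|))%:E +
    \int[mu]_(x in B2) (V x * (1 + `|ln (euclid x)|))%:E +
    \int[mu]_(x in B3) (V x * (1 + `|ln (euclid x)|))%:E)%E.
Proof.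
move=> mA m1 m2 m3 mZ Z0 c0 hA hc; pose w x := (V x * (1 + `|ln (euclid x)|))%:E.
have mE : measurable_fun A (EFin \o V) by apply: measurable_funTS; apply/measurable_EFinP.
have ml := logweight_measurable.
have l0 x : 0 <= V x * (1 + `|ln (euclid x)|) by rewrite mulr_ge0// addr_ge0.
apply: (@le_trans _ _ (\int[mu]_(x in A) w x)%E); last exact: (int_cover3 mA m1 m2 m3 mZ Z0 ml l0 hA).
rewrite -ge0_integralZl_EFin//; last by move=> x _; rewrite lee_fin.
apply: ge0_le_integral => //.
- by move=> x _; rewrite -EFinM lee_fin mulr_ge0.
- exact: emeasurable_funM.
- by apply: measurable_funTS; apply/measurable_EFinP.
by move=> x Ax; rewrite -EFinM lee_fin mulrC ler_wpM2l// hc.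
Qed.

(** On the rings of a dyadic block the logarithm of |x| is at least 2^n, and the
    change of norm shifts the block by less than one annulus. *)
Lemma pos_block (n : nat) :
  ((2 ^+ n)%:E * \int[mu]_(x in ring (expR (2 ^+ n)) (expR (2 ^+ n.+1))) (V x)%:E <=
   logWeightA V (n.+1)%:Z + logWeightA V (n.+2)%:Z + logWeightA V (n.+3)%:Z)%E.
Proof.
have p0 : 0 < 2 ^+ n :> R by rewrite exprn_gt0.
have p1 : 1 <= 2 ^+ n :> R by rewrite exprn_ege1// ler1n.
have le1 : expR (2 ^+ n) <= expR (2 ^+ n.+1) :> R by rewrite ler_expR exprS; lra.
have bd (x : T2) : ring (expR (2 ^+ n)) (expR (2 ^+ n.+1)) x ->
    expR (2 ^+ n) <= euclid x /\ euclid x < expR (2 ^+ n.+2).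
  move=> hx; have /andP[h1 h2] := ring_euclid (expR_gt0 _) le1 hx; split => //.
  apply: (lt_le_trans h2); rewrite -expRD ler_expR !exprS; lra.
apply: (@block_cover _ _ _ _ (circle (expR (2 ^+ n)) `|` circle (expR (2 ^+ n.+1)))).
- exact: ring_measurable.
- exact: annulusU_measurable.
- exact: annulusU_measurable.
- exact: annulusU_measurable.
- by apply: measurableU; exact: circle_measurable.
- by apply/null_set_setU; try exact: circle_measurable; exact: circle_null.
- exact: ltW.
- move=> x /bd [h1 h2].
  move: h1; rewrite le_eqVlt => /orP[/eqP h1|h1]; first by constructor 4; left; rewrite /circle /= h1.
  have [h|h|h] := ltgtP (euclid x) (expR (2 ^+ n.+1)).
  + by constructor 1; rewrite /= h1.
  + by constructor 2; rewrite /= ?h h2.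
  + by constructor 4; right.
move=> x /bd [h1 h2].
have : 2 ^+ n <= ln (euclid x) by rewrite -ler_expR lnK// posrE (lt_le_trans _ h1)// expR_gt0.
have := ler_norm (ln (euclid x)); lra.
Qed.

(** Inside the unit disc the change of norm costs up to 2 in the logarithm; whence
    the factor 1/2.  For n = 0 and n = 1 the annulus U_0 around the unit circle is
    involved. *)
Lemma neg_block (n : nat) :
  ((2 ^+ n / 2)%:E * \int[mu]_(x in ring (expR (1 - 2 ^+ n.+1)) (expR (1 - 2 ^+ n))) (V x)%:E <=
   logWeightA V (- (n.+1)%:Z) + logWeightA V (- n%:Z) + logWeightA V (1 - n%:Z))%E.
Proof.
have p0 : 0 < 2 ^+ n :> R by rewrite exprn_gt0.
have p1 : 1 <= 2 ^+ n :> R by rewrite exprn_ege1// ler1n.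
have le1 : expR (1 - 2 ^+ n.+1) <= expR (1 - 2 ^+ n) :> R by rewrite ler_expR exprS; lra.
have bd (x : T2) : ring (expR (1 - 2 ^+ n.+1)) (expR (1 - 2 ^+ n)) x ->
    expR (1 - 2 ^+ n.+1) <= euclid x /\ euclid x < expR (2 - 2 ^+ n).
  move=> hx; have /andP[h1 h2] := ring_euclid (expR_gt0 _) le1 hx; split => //.
  apply: (lt_le_trans h2); rewrite -expRD ler_expR; lra.
apply: (@block_cover _ _ _ _ (circle (expR (- 2 ^+ n)) `|` (circle (expR (-1)) `|` circle (expR (-2))))).
- exact: ring_measurable.
- exact: annulusU_measurable.
- exact: annulusU_measurable.
- exact: annulusU_measurable.
- by apply: measurableU; [|apply: measurableU]; exact: circle_measurable.
- have z : mu (circle (expR (-1)) `|` circle (expR (-2))) = 0%E.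
    by apply/null_set_setU; try exact: circle_measurable; exact: circle_null.
  apply/null_set_setU => //; try exact: circle_measurable; try exact: circle_null.
  by apply: measurableU; exact: circle_measurable.
- by rewrite divr_ge0// ltW.
- move=> x /bd [h1 h2].
  case: n p0 p1 le1 bd h1 h2 => [|[|n]] p0 p1 le1 bd h1 h2.
  + rewrite oppr0 subr0; move: h1 h2; rewrite expr1 expr0.
    have -> : (1 - 2 : R) = -1 by lra.
    have -> : (2 - 1 : R) = 1 by lra.
    rewrite le_eqVlt => /orP[/eqP h1|h1] h2; first by constructor 4; right; left; rewrite /circle /= h1.
    by constructor 2; rewrite /= h1.
  + move: h1 h2; rewrite expr1 expr2.
    have -> : (2 - 2 : R) = 0 by lra.
    have -> : (1 - 2 * 2 : R) = -3 by lra.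
    move=> h1 h2; have h3 : expR (-4) < euclid x.
      by apply: lt_le_trans h1; rewrite ltr_expR; lra.
    have h4 : euclid x < expR 1 by apply: (lt_trans h2); rewrite ltr_expR.
    have [h|h|h] := ltgtP (euclid x) (expR (-2)).
    * constructor 1 => /=; rewrite -[- 2 ^+ 1]/(- 2 : R) ?h andbT.
      by have -> : - 2 ^+ 2 = -4 :> R by rewrite expr2; lra.
    * have [h'|h'|h'] := ltgtP (euclid x) (expR (-1)).
      - by constructor 2; rewrite /= expr1 expr0 ?h.
      - by constructor 3; rewrite /= h'.
      - by constructor 4; right; left.
    * by constructor 4; right; right.
  + have [h|h|h] := ltgtP (euclid x) (expR (- 2 ^+ n.+2)).
    * constructor 1 => /=; rewrite ?h andbT; apply: lt_le_trans h1.
      by rewrite ltr_expR; lra.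
    * constructor 2 => /=; rewrite ?h /=; apply: (lt_le_trans h2).
      rewrite ler_expR exprS; have : 2 <= 2 ^+ n.+1 :> R by rewrite exprS ler_peMr// exprn_ege1// ler1n.
      lra.
    * by constructor 4; left.
move=> x /bd [h1 h2].
have e0 : 0 < euclid x by apply: lt_le_trans h1; exact: expR_gt0.
have hl : ln (euclid x) < 2 - 2 ^+ n by rewrite -ltr_expR lnK// posrE.
have := ler_norm (- ln (euclid x)); rewrite normrN.
have := normr_ge0 (ln (euclid x)).
case: n p0 p1 {le1 bd h1 h2} hl => [|n] p0 p1 hl; first by rewrite expr0; lra.
have : 2 <= 2 ^+ n.+1 :> R by rewrite exprS ler_peMr// exprn_ege1// ler1n.
lra.
Qed.

End Weights.

End Annuli.

(** * The weight of a tile in terms of B *)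
Section TileBound.
Context {R : realType}.
Local Notation mu := (plane_measure R).
Local Notation T2 := (measurableTypeR R * measurableTypeR R)%type.
Variables (p : R) (V : R * R -> R) (s t : R).
Hypotheses (p1 : 1 < p) (mV : measurable_fun (setT : set T2) V) (V0 : forall x, 0 <= V x).
Hypotheses (s0 : 0 < s) (st2 : 2 * s <= t) (st4 : t <= 4 * s).

Let p0 : 0 < p. Proof. exact: lt_trans p1. Qed.

Lemma tile_area n : area (tile s t n) <= 9 * s ^+ 2.
Proof.
have h2 : 2 * s <= t by []. have h4 : t <= 4 * s by []. have h0 : 0 < s by [].
have hb (a b : R) : 0 <= a -> a <= 3 * s -> 0 <= b -> b <= 3 * s -> a * b <= 9 * s ^+ 2.
  move=> a0 ha b0 hb; have := ler_pM a0 b0 ha hb.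
  by have -> : 3 * s * (3 * s) = 9 * s ^+ 2 by ring.
have base_ok : area (base s t) <= 9 * s ^+ 2.
  by apply: hb; rewrite /wd /ht /=; lra.
by case: n => [|[|[|[|[|[|[|[|n]]]]]]]]; rewrite /tile /= ?nth_nil //;
  apply: hb; rewrite /wd /ht /=; lra.
Qed.

Lemma V_powR_measurable : measurable_fun (setT : set T2) (fun x : T2 => V x `^ p).
Proof. exact: measurableT_comp (measurable_powR _) _. Qed.

Lemma ringV_powR : (fun x => ringV V s t x `^ p) = (fun x => V x `^ p) \_ (ring s t) :> (T2 -> R).
Proof.
apply/funext => x; rewrite /ringV !patchE; case: ifP => // _.
by rewrite powR0// gt_eqF.
Qed.

Definition weightB (x : R * R) : R := V x `^ p * euclid x `^ (2 * (p - 1)).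

Lemma weightB_ge0 x : 0 <= weightB x.
Proof. by rewrite mulr_ge0 ?powR_ge0. Qed.

Lemma weightB_measurable : measurable_fun (setT : set T2) weightB.
Proof.
apply: measurable_funM; first exact: V_powR_measurable.
by apply: (measurableT_comp (measurable_powR _)); exact: euclid_measurable.
Qed.

Variable b : R.
Hypotheses (b0 : 0 <= b) (hb : (\int[mu]_(x in ring s t) (weightB x)%:E <= (2 * b `^ p)%:E)%E).

Let S : R := (s ^+ 2) `^ (p - 1).

Let S0 : 0 < S. Proof. by rewrite powR_gt0// exprn_gt0. Qed.

(** On the ring |x| is at least s. *)
Lemma ring_power_mass :
  (\int[mu]_(x in ring s t) (V x `^ p)%:E <= (2 * b `^ p / S)%:E)%E.
Proof.
have mr := ring_measurable s t.
have h : (S%:E * \int[mu]_(x in ring s t) (V x `^ p)%:E <= (2 * b `^ p)%:E)%E.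
  apply: le_trans hb.
  rewrite -ge0_integralZl_EFin//; try exact: ltW; last 2 first.
  - by move=> x _; rewrite lee_fin powR_ge0.
  - by apply: measurable_funTS; apply/measurable_EFinP; exact: V_powR_measurable.
  apply: ge0_le_integral => //.
  - by move=> x _; rewrite -EFinM lee_fin mulr_ge0 ?powR_ge0// ltW.
  - by apply: measurable_funTS; apply/measurable_EFinP; apply: measurable_funM => //; exact: V_powR_measurable.
  - by apply: measurable_funTS; apply/measurable_EFinP; exact: weightB_measurable.
  have st : s <= t by have h2 : 2 * s <= t by []; have h0 : 0 < s by []; lra.
  move=> x /(ring_euclid s0 st) /andP[h1 _].
  rewrite -EFinM lee_fin /weightB mulrC ler_wpM2l ?powR_ge0//.
  rewrite /S -powR_mulrn ?(ltW s0)// -powRrM; apply: ge0_ler_powR; rewrite ?nnegrE ?euclid_ge0 ?(ltW s0)//.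
  by rewrite mulr_ge0// subr_ge0 ltW.
by rewrite -lee_pdivlMl// in h; rewrite mulrC EFinM.
Qed.

Lemma ringV_powR_integrable : mu.-integrable setT (EFin \o (fun x => ringV V s t x `^ p)).
Proof.
have mr := ring_measurable s t.
apply/integrableP; split.
  apply/measurable_EFinP; rewrite ringV_powR.
  apply: ((measurable_restrictT _ mr).1); apply: measurable_funTS; exact: V_powR_measurable.
apply: (@le_lt_trans _ _ (2 * b `^ p / S)%:E); last by rewrite ltry.
apply: le_trans ring_power_mass.
rewrite [X in (_ <= X)%E]integral_mkcond le_eqVlt; apply/orP; left; apply/eqP.
apply: eq_integral => x _ /=.
rewrite ger0_norm ?powR_ge0// (congr1 (@^~ x) ringV_powR) !patchE.
by case: ifP.
Qed.

(** Scale invariance of B in dimension two: |Q|^(p-1) is comparable to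
    |x|^(2(p-1)) on the ring. *)
Lemma Jp_tile n : Jp p (ringV V s t) (tile s t n) <= 18 * b.
Proof.
set Q := tile s t n.
have [pQ _ _] := tile_fat s0 st2 st4 n.
have a0 := area_gt0 pQ; rewrite -/Q in a0.
have mr := ring_measurable s t.
have mQ : measurable (rset Q) by exact: rset_measurable.
have hm : pmass p (ringV V s t) Q <= 2 * b `^ p / S.
  rewrite /pmass /Rintegral -lee_fin fineK; last first.
    apply: (integrable_fin_num mQ).
    exact: (integrableS measurableT mQ (@subsetT _ _) ringV_powR_integrable).
  apply: le_trans ring_power_mass.
  apply: (@le_trans _ _ (\int[mu]_(x in rset Q) (V x `^ p)%:E)%E).
    rewrite le_eqVlt; apply/orP; left; apply/eqP; apply: eq_integral => x.
    by rewrite inE => xQ; rewrite (ringV_on V s0 st2 st4 xQ).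
  apply: ge0_subset_integral => //.
  - by apply: measurable_funTS; apply/measurable_EFinP; exact: V_powR_measurable.
  - by move=> x _; rewrite lee_fin powR_ge0.
  - exact: tile_sub.
have aS : area Q `^ (p - 1) <= 9 `^ (p - 1) * S.
  rewrite -powRM ?sqr_ge0//; apply: ge0_ler_powR; rewrite ?nnegrE ?(ltW a0)//.
  - by rewrite subr_ge0 ltW.
  - by rewrite mulr_ge0// sqr_ge0.
  - exact: tile_area.
have aE : area Q * area Q `^ (p - 1) = area Q `^ p by rewrite mulr_powRB1// ltW.
have c18 : 2 * 9 `^ (p - 1) <= 18 `^ p :> R.
  have -> : 18 = 2 * 9 :> R by ring.
  rewrite powRM//; apply: ler_pM (ler0n _ 2) (powR_ge0 _ _) _ _.
    by apply: le1r_powR; rewrite ?ler1n// ltW.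
  by apply: ler_powR; rewrite ?ler1n// gerBl.
set A := area Q `^ (p - 1) in aS aE.
have A0 : 0 < A by rewrite powR_gt0.
have key : pmass p (ringV V s t) Q / area Q <= (18 * b / area Q) `^ p.
  have b18 : 0 <= 18 * b by apply: mulr_ge0.
  have ai0 : 0 <= (area Q)^-1 by rewrite invr_ge0 ltW.
  rewrite (powRM p b18 ai0) (@powRM _ 18 b)//.
  have -> : (area Q)^-1 `^ p = (area Q `^ p)^-1.
    by rewrite -[(area Q)^-1]powR_inv1 ?(ltW a0)// -powRrM mulN1r powRN.
  rewrite -aE; apply: (@le_trans _ _ (2 * b `^ p / S / area Q)).
    by apply: ler_wpM2r.
  have h : 2 / S <= 18 `^ p / A.
    rewrite ler_pdivlMr// mulrAC ler_pdivrMr//.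
    apply: (@le_trans _ _ (2 * (9 `^ (p - 1) * S))); first by rewrite ler_pM2l.
    by rewrite mulrA ler_pM2r.
  have -> : 2 * b `^ p / S / area Q = (b `^ p / area Q) * (2 / S).
    by field; rewrite !gt_eqF.
  have -> : 18 `^ p * b `^ p / (area Q * A) = (b `^ p / area Q) * (18 `^ p / A).
    by field; rewrite !gt_eqF.
  by apply: ler_wpM2l => //; apply: mulr_ge0 => //; exact: powR_ge0.
rewrite /Jp -/Q; apply: (@le_trans _ _ (area Q * (18 * b / area Q))); last first.
  by rewrite mulrCA divff ?gt_eqF// mulr1.
rewrite ler_pM2l//.
have q0 : 0 <= 18 * b / area Q by apply: divr_ge0; [exact: mulr_ge0|exact: ltW].
have pn0 : p != 0 by rewrite gt_eqF.
have -> : 18 * b / area Q = ((18 * b / area Q) `^ p) `^ p^-1.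
  by rewrite -powRrM divff// powRr1.
apply: ge0_ler_powR; rewrite ?nnegrE ?powR_ge0 ?invr_ge0 ?(ltW p0)//.
by apply: divr_ge0; [exact: pmass_ge0|exact: ltW].
Qed.

End TileBound.

(** * Exhaustion of the plane and functions without energy *)
Section Exhaustion.
Context {R : realType}.
Local Notation mu := (plane_measure R).
Local Notation T2 := (measurableTypeR R * measurableTypeR R)%type.

(** Monotone convergence along rings that exhaust the plane without the origin,
    which is a null set. *)
Lemma exhaustion (phi : T2 -> R) (c : \bar R) : measurable_fun setT phi -> (forall x, 0 <= phi x) ->
  (forall m : nat, exists s t : R, [/\ s <= expR (- m%:R), expR m%:R <= t &
    (\int[mu]_(x in ring s t) (phi x)%:E <= c)%E]) ->
  (\int[mu]_x (phi x)%:E <= c)%E.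
Proof.
move=> mphi p0 h.
pose F (m : nat) : set T2 := ring (expR (- m%:R)) (expR m%:R).
have sqsub (a b : R) (x : T2) : a <= b -> rset (square a) x -> rset (square b) x.
  by move=> ab /rsetP /= [/andP[p q] /andP[p' q']]; apply/rsetP => /=; split; apply/andP; split; lra.
have rsub (a b a' b' : R) : a' <= a -> b <= b' -> ring a b `<=` ring a' b'.
  move=> aa bb x [h1 h2]; split; first exact: sqsub h1.
  by move=> h3; apply: h2; exact: sqsub h3.
have mF m : measurable (F m) by exact: ring_measurable.
have mE (D : set T2) : measurable_fun D (EFin \o phi).
  by apply: measurable_funTS; apply/measurable_EFinP.
have Fh : {homo F : n m / (n <= m)%N >-> (n <= m)%O}.
  move=> n m nm; apply/subsetPset; apply: rsub; rewrite ler_expR ?lerN2 ler_nat//.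
have cv := @ge0_nondecreasing_set_cvg_integral _ _ R F (EFin \o phi) mu Fh mF (fun i => mE (F i)) _.
have {}cv := cv (fun i x _ => p0 x).
have Fc m : (\int[mu]_(x in F m) (EFin \o phi) x <= c)%E.
  have [s [t [hs ht hc]]] := h m; apply: le_trans hc.
  apply: ge0_subset_integral => //; first exact: ring_measurable.
    by move=> x _; rewrite /= lee_fin.
  exact: rsub.
have le : (\int[mu]_(x in \bigcup_i F i) (phi x)%:E <= c)%E.
  rewrite -(cvg_lim _ cv)//; apply: lime_le; last exact: nearW.
  by apply/cvg_ex; eexists; exact: cv.
apply: le_trans le.
have mU : measurable (\bigcup_i F i) by exact: bigcupT_measurable.
have := @int_cover3 R setT (\bigcup_i F i) set0 set0 (circle 0) phi.
rewrite !integral_set0 !adde0; apply => //; first exact: circle_measurable.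
  exact: circle_null.
move=> x _; have [x0|x0] := eqVneq (euclid x) 0; first by constructor 4.
constructor 1.
have {x0}e0 : 0 < euclid x by rewrite lt_neqAle eq_sym x0 euclid_ge0.
have [m hm] : exists m : nat, `|ln (euclid x)| + 1 < m%:R.
  by exists (Num.truncn (`|ln (euclid x)| + 1)).+1; rewrite truncnS_gt// ?addr_ge0.
exists m => //.
have h1 : expR (- m%:R) * expR 1 <= euclid x.
  rewrite -expRD -[leRHS]lnK ?posrE// ler_expR.
  have := ler_norm (- ln (euclid x)); rewrite normrN; lra.
have h2 : euclid x < expR m%:R.
  rewrite -[ltLHS]lnK ?posrE// ltr_expR; have := ler_norm (ln (euclid x)); lra.
have eq := euclid_sqr x.
have b1 : `|x.1| <= euclid x.
  rewrite -[leRHS]ger0_norm ?euclid_ge0// -ler_sqr ?nnegrE// !real_normK ?num_real//.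
  by rewrite eq lerDl sqr_ge0.
have b2 : `|x.2| <= euclid x.
  rewrite -[leRHS]ger0_norm ?euclid_ge0// -ler_sqr ?nnegrE// !real_normK ?num_real//.
  by rewrite eq lerDr sqr_ge0.
apply/ringP; split.
  have := le_lt_trans b1 h2; have := le_lt_trans b2 h2.
  by rewrite !ltr_norml => /andP[/ltW -> ->] /andP[/ltW -> ->].
set r := expR (- m%:R) in h1 *; have r0 : 0 < r by exact: expR_gt0.
move=> [/andP[p1 p2] /andP[q1 q2]].
have x1 : x.1 ^+ 2 <= r ^+ 2.
  by rewrite -[x.1 ^+ 2]real_normK ?num_real// ler_sqr ?nnegrE ?(ltW r0)// ler_norml p1 (ltW p2).
have x2 : x.2 ^+ 2 <= r ^+ 2.
  by rewrite -[x.2 ^+ 2]real_normK ?num_real// ler_sqr ?nnegrE ?(ltW r0)// ler_norml q1 (ltW q2).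
have h3 : (r * 2) ^+ 2 <= euclid x ^+ 2.
  rewrite ler_sqr ?nnegrE ?mulr_ge0 ?(ltW r0) ?euclid_ge0//; apply: le_trans h1.
  by rewrite ler_pM2l// e_ge2.
rewrite eq exprMn in h3; have : 0 < r ^+ 2 by rewrite exprn_gt0.
lra.
Qed.

(** Lebesgue measure itself is an admissible weight, with J the area and
    theta = 1/4. *)
Lemma sobolev_unit (f u : R * R -> R) Q : tame f u -> fat Q -> avg f Q = 0 -> En u Q = 0 ->
  (\int[mu]_(x in rset Q) (f x ^+ 2)%:E <= 0)%E.
Proof.
move=> tfu fQ a0 E0; have [pQ _ _] := fQ.
have := @sobolev R f u tfu (fun=> 1) (fun Q => area Q) (4^-1) Q.
rewrite E0 mulr0; under eq_integral => x _ do rewrite a0 subr0 mul1r.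
apply => //.
- by rewrite invf_lt1// ltr1n.
- move=> Q' pQ'; rewrite integral_cst; last exact: rset_measurable.
  by rewrite mul1e [X in (X <= _)%E](rset_measure pQ').
- by move=> Q' i j _; rewrite child_area mulrC.
Qed.

Lemma zero_energy_ring (f u : R * R -> R) (s t : R) : tame f u -> 0 < s ->
  2 * s <= t -> t <= 4 * s -> avg f (base s t) = 0 -> Er u s t = 0 ->
  (\int[mu]_(x in ring s t) (f x ^+ 2)%:E <= 0)%E.
Proof.
move=> tfu s0 st2 st4 a0 E0; have [[mf _] _ _ _ _] := tfu.
apply: le_trans (ring_tiles s t _ _) _.
- exact: measurable_funX.
- by move=> x; exact: sqr_ge0.
apply: (@le_trans _ _ (\sum_(n < 8) 0)%E); last by rewrite big1.
apply: lee_sum => n _.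
have En0 : En u (tile s t n) = 0.
  apply/eqP; rewrite eq_le (En_ge0 tfu) andbT -E0.
  by apply: (En_ring tfu); exact: tile_sub.
apply: (sobolev_unit tfu) => //; first exact: tile_fat.
have := tile_base s0 st2 st4 tfu n; rewrite E0 mulr0 a0 subr0 => h.
by apply/eqP; rewrite -sqrf_eq0 eq_le h sqr_ge0.
Qed.

End Exhaustion.

(** * The two sequences of rings *)
Section Radial.
Context {R : realType}.
Local Notation mu := (plane_measure R).
Local Notation T2 := (measurableTypeR R * measurableTypeR R)%type.

Definition side_index (pos : bool) (j : nat) : int := if pos then j%:Z else - j%:Z.

Definition ringk (k : int) : set T2 := ring (erad k : R) (erad (k + 1)).

Lemma erad_mono (i j : int) : i <= j -> erad i <= erad j :> R.
Proof. by move=> ij; rewrite /erad ler_expR ler_int. Qed.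

(** The union of the rings of indices a, ..., a + L - 1 on one side; on the negative
    side the ring of index -j ends at radius e^(1-j). *)
Definition region (pos : bool) (a L : nat) : set T2 :=
  if pos then ring (erad a%:Z : R) (erad (a + L)%:Z)
  else ring (erad (1 - (a + L)%:Z) : R) (erad (1 - a%:Z)).

Lemma region_measurable pos a L : measurable (region pos a L).
Proof. by case: pos; exact: ring_measurable. Qed.

Lemma region_sum pos (phi : T2 -> R) a L : measurable_fun setT phi -> (forall x, 0 <= phi x) ->
  (\sum_(a <= j < a + L) \int[mu]_(x in ringk (side_index pos j)) (phi x)%:E =
   \int[mu]_(x in region pos a L) (phi x)%:E)%E.
Proof.
move=> mphi p0; elim: L => [|L IH].
  rewrite addn0 big_geq// /region addn0 (_ : (if pos then _ else _) = set0) ?integral_set0//.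
  by case: pos; rewrite /ring setDv.
rewrite addnS big_nat_recr; last exact: leq_addr.
rewrite /= IH /region addnS /ringk /side_index.
case: (pos).
  rewrite (_ : (a + L)%:Z + 1 = (a + L).+1%:Z); last by rewrite -addn1 PoszD.
  rewrite -int_ring_cat// ?erad_gt0//; apply: erad_mono; rewrite lez_nat//.
  exact: leq_addr.
rewrite (_ : - (a + L)%:Z + 1 = 1 - (a + L)%:Z); last by rewrite addrC.
rewrite (_ : - (a + L)%:Z = 1 - (a + L).+1%:Z); last by rewrite -addn1 PoszD; lia.
by rewrite addeC -int_ring_cat// ?erad_gt0//; apply: erad_mono; lia.
Qed.

Section Field.
Variables f u : R * R -> R.
Hypothesis tfu : tame f u.

Definition ring_mean (k : int) : R := avg f (base (erad k) (erad (k + 1))).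
Definition ringk_energy (k : int) : R := Er u (erad k) (erad (k + 1)).
Definition total_energy : R := \int[mu]_x u x.

Lemma ringk_energy_ge0 k : 0 <= ringk_energy k.
Proof. exact: Er_ge0 tfu. Qed.

Lemma ring_mean_next k : (ring_mean (k + 1) - ring_mean k) ^+ 2 <= 20 * (ringk_energy k + ringk_energy (k + 1)).
Proof.
by apply: (base_next tfu); rewrite ?erad_gt0 ?erad2 ?erad4.
Qed.

Lemma ringk_energy_sum pos a L : \sum_(a <= j < a + L) ringk_energy (side_index pos j) <= total_energy.
Proof.
have [[_ u0] _ iu _ _] := tfu.
have mu' : measurable_fun setT (u : T2 -> R).
  by have [/measurable_EFinP] := integrableP _ _ _ iu.
have e k : ((ringk_energy k)%:E = \int[mu]_(x in ringk k) (u x)%:E)%E.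
  rewrite /ringk_energy /Er /Rintegral fineK//; apply: integrable_fin_num; first exact: ring_measurable.
  by apply: (tame_u_int tfu); exact: ring_measurable.
rewrite -lee_fin -sumEFin; under eq_bigr do rewrite e.
rewrite region_sum// /total_energy /Rintegral fineK; last exact: integrable_fin_num.
apply: ge0_subset_integral => //; first exact: region_measurable.
  exact/measurable_EFinP.
by move=> x _; rewrite lee_fin.
Qed.

Lemma side_mean_next pos j : (ring_mean (side_index pos j.+1) - ring_mean (side_index pos j)) ^+ 2 <=
  20 * (ringk_energy (side_index pos j) + ringk_energy (side_index pos j.+1)).
Proof.
case: pos; rewrite /side_index.
  by have := ring_mean_next j%:Z; rewrite (_ : j%:Z + 1 = j.+1%:Z)// -addn1 PoszD.
have := ring_mean_next (- j.+1%:Z).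
rewrite (_ : - j.+1%:Z + 1 = - j%:Z); last by rewrite -addn1 PoszD; lia.
have sq (y z : R) : (y - z) ^+ 2 = (z - y) ^+ 2 by ring.
by move=> h; rewrite sq (addrC (ringk_energy (- j%:Z))); exact: h.
Qed.

End Field.
End Radial.

(** * Counting functionals by A and B *)
Section Counting.
Context {R : realType}.
Local Notation mu := (plane_measure R).
Local Notation T2 := (measurableTypeR R * measurableTypeR R)%type.
Variables (p : R) (V : R * R -> R).
Hypotheses (mV : measurable_fun (setT : set T2) V) (V0 : forall x, 0 <= V x).
Hypothesis locV : forall K : set (R * R), compact K -> (\int[mu]_(x in K) (V x)%:E < +oo)%E.

Definition ringk_mass (k : int) : R := fine (\int[mu]_(x in ringk k) (V x)%:E)%E.

Lemma ring_fin s t : (\int[mu]_(x in ring s t) (V x)%:E < +oo)%E.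
Proof.
apply: le_lt_trans (locV (@box_compact R true (- t) t (- t) t)).
apply: ge0_subset_integral.
- exact: ring_measurable.
- by apply: box_measurable; exact: measurable_itv.
- by apply: measurable_funTS; apply/measurable_EFinP.
- by move=> x _; rewrite lee_fin.
move=> x [/rsetP /= [/andP[a b] /andP[c d]] _]; split; rewrite /= in_itv/=.
  by rewrite a ltW.
by rewrite c ltW.
Qed.

Lemma ringk_massE k : ((ringk_mass k)%:E = \int[mu]_(x in ringk k) (V x)%:E)%E.
Proof.
rewrite fineK// ge0_fin_numE; first exact: ring_fin.
by apply: integral_ge0 => x _; rewrite lee_fin.
Qed.

Lemma ringk_mass_ge0 k : 0 <= ringk_mass k.
Proof. by rewrite fine_ge0// integral_ge0// => x _; rewrite lee_fin. Qed.

Variables a b : int -> R.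
Hypotheses (Aa : forall n, logWeightA V n = (a n)%:E) (Bb : forall n, powerNormB p V n = (b n)%:E).

Lemma a_ge0 n : 0 <= a n.
Proof.
rewrite -lee_fin -Aa; apply: integral_ge0 => x _; rewrite lee_fin.
by apply: mulr_ge0 => //; apply: addr_ge0.
Qed.

Lemma b_ge0 n : 0 <= b n.
Proof. by rewrite -lee_fin -Bb poweR_ge0. Qed.

(** Indices of three annuli U that cover the n-th dyadic block of rings up to a
    null set. *)
Definition annulus_index (pos : bool) (i : nat) (n : nat) : int :=
  if pos then (n + i.+1)%:Z else i%:Z - n.+1%:Z.

Definition side_mass (pos : bool) (j : nat) : R := ringk_mass (side_index pos j).

(** The factor 2 accounts for the loss in [neg_block]. *)
Lemma blockM_le pos n : blockM (side_mass pos) n <=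
  2 * (a (annulus_index pos 0 n) + a (annulus_index pos 1 n) + a (annulus_index pos 2 n)).
Proof.
have p2 : 0 < 2 ^+ n :> R by rewrite exprn_gt0.
have e : ((vmass (side_mass pos) (2 ^ n) (2 ^ n))%:E =
    \int[mu]_(x in region pos (2 ^ n) (2 ^ n)) (V x)%:E)%E.
  rewrite -region_sum// /vmass -sumEFin; apply: eq_bigr => j _; exact: ringk_massE.
have ee : (2 ^ n + 2 ^ n = 2 ^ n.+1)%N by rewrite expnS mul2n addnn.
have s0 : 0 <= a (annulus_index pos 0 n) + a (annulus_index pos 1 n) + a (annulus_index pos 2 n) by rewrite !addr_ge0 ?a_ge0.
rewrite -lee_fin /blockM EFinM e /region ee; case: pos e s0 => e s0; rewrite /annulus_index.
  have := @pos_block R V mV V0 n; rewrite !Aa -!EFinD !addn1 !addn2 !addn3.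
  rewrite /erad -!pmulrn !natrX => h; apply: (le_trans h).
  by rewrite lee_fin; rewrite /annulus_index !addn1 !addn2 !addn3 in s0; lra.
have := @neg_block R V mV V0 n; rewrite !Aa -!EFinD.
rewrite (_ : erad (1 - (2 ^ n.+1)%N%:Z) = expR (1 - 2 ^+ n.+1)); last first.
  by rewrite /erad intrB -pmulrn natrX.
rewrite (_ : erad (1 - (2 ^ n)%N%:Z) = expR (1 - 2 ^+ n)); last first.
  by rewrite /erad intrB -pmulrn natrX.
rewrite natrX => h.
have z2 : (0 <= 2%:E :> \bar R)%E by rewrite lee_fin.
have h2 := lee_wpmul2l z2 h; rewrite muleA -EFinM in h2.
have e2 : 2 * (2 ^+ n / 2) = 2 ^+ n :> R by field.
rewrite e2 in h2; apply: (le_trans h2); rewrite -EFinM lee_fin.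
rewrite le_eqVlt; apply/orP; left; apply/eqP; congr (2 * (a _ + a _ + a _)).
- by rewrite sub0r.
- by rewrite -addn1 PoszD; lia.
- by rewrite -addn1 PoszD; lia.
Qed.

Variable c : R.

(** The terms of the first sum of the theorem, extended by 0. *)
Definition alpha n : R := if c < a n then Num.sqrt (a n) else 0.
Definition beta n : R := if c < b n then b n else 0.

Lemma alpha_ge0 n : 0 <= alpha n.
Proof. by rewrite /alpha; case: ifP => // _; exact: sqrtr_ge0. Qed.

Lemma beta_ge0 n : 0 <= beta n.
Proof. by rewrite /beta; case: ifP => // _; exact: b_ge0. Qed.

(** The largest of the three values of A is at least one sixth of the size of the
    block, hence beyond the threshold c when the block is large. *)
Lemma badcount_le eps pos n : 0 < eps -> 6 * c <= eps ->
  badcount (side_mass pos) eps n <=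
   4 * Num.sqrt (6 / eps) * (alpha (annulus_index pos 0 n) + alpha (annulus_index pos 1 n) + alpha (annulus_index pos 2 n)).
Proof.
move=> e0 ce; rewrite /badcount.
have s0 : 0 <= Num.sqrt (6 / eps) by exact: sqrtr_ge0.
have al0 := alpha_ge0.
case: ifPn => [_|]; first by rewrite !mulr_ge0// !addr_ge0.
rewrite -ltNge => hM; rewrite -mulrA; apply: ler_wpM2l => //.
have hb := blockM_le pos n.
set a1 := a (annulus_index pos 0 n) in hb; set a2 := a (annulus_index pos 1 n) in hb; set a3 := a (annulus_index pos 2 n) in hb.
have one m (am : R) : a m = am -> a1 <= am -> a2 <= am -> a3 <= am ->
    Num.sqrt (blockM (side_mass pos) n / eps) <= Num.sqrt (6 / eps) * alpha m.
  move=> em h1 h2 h3.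
  have hm : blockM (side_mass pos) n <= 6 * am by lra.
  have cm : c < a m.
    by rewrite em -(ltr_pM2l (_ : 0 < 6))//; apply: (le_lt_trans ce); apply: lt_le_trans hm.
  rewrite /alpha cm em -sqrtrM; last by rewrite divr_ge0// ltW.
  apply: ler_wsqrtr; rewrite [leRHS]mulrAC; apply: ler_wpM2r => //.
  by rewrite invr_ge0 ltW.
have fin m : Num.sqrt (blockM (side_mass pos) n / eps) <= Num.sqrt (6 / eps) * alpha m ->
    alpha m <= alpha (annulus_index pos 0 n) + alpha (annulus_index pos 1 n) + alpha (annulus_index pos 2 n) ->
    Num.sqrt (blockM (side_mass pos) n / eps) <=
    Num.sqrt (6 / eps) * (alpha (annulus_index pos 0 n) + alpha (annulus_index pos 1 n) + alpha (annulus_index pos 2 n)).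
  by move=> h h'; apply: (le_trans h); apply: ler_wpM2l.
have [l12|l12] := leP a1 a2.
  have [l23|l23] := leP a2 a3.
    apply: (fin (annulus_index pos 2 n)); first by apply: (one _ a3) => //; exact: le_trans l12 l23.
    by rewrite lerDr addr_ge0.
  apply: (fin (annulus_index pos 1 n)); first by apply: (one _ a2) => //; exact: ltW.
  by rewrite addrAC lerDr addr_ge0.
have [l13|l13] := leP a1 a3.
  apply: (fin (annulus_index pos 2 n)); first by apply: (one _ a3) => //; exact: le_trans (ltW l12) l13.
  by rewrite lerDr addr_ge0.
apply: (fin (annulus_index pos 0 n)); first by apply: (one _ a1) => //; exact: ltW.
by rewrite -addrA lerDl addr_ge0.
Qed.

Hypothesis p1 : 1 < p.

(** A square ring meets two of the annuli W, whence the larger of two values of B. *)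
Lemma ring_weightB k : (\int[mu]_(x in ringk k) (weightB p V x)%:E <=
  (2 * Num.max (b k) (b (k + 1)) `^ p)%:E)%E.
Proof.
have p0 : 0 < p by exact: lt_trans p1.
have e n : (\int[mu]_(x in annulusW n) (weightB p V x)%:E = (b n `^ p)%:E)%E.
  rewrite -poweR_EFin -Bb /powerNormB -poweRrM mulVf ?gt_eqF// poweRe1//.
  by apply: integral_ge0 => x _; rewrite lee_fin; exact: weightB_ge0.
apply: (le_trans (ring_W k (weightB_measurable p mV) (weightB_ge0 p V))).
rewrite !e -EFinD lee_fin mulr_natl mulr2n.
have h n : b n <= Num.max (b k) (b (k + 1)) -> b n `^ p <= Num.max (b k) (b (k + 1)) `^ p.
  move=> hn; apply: ge0_ler_powR; rewrite ?nnegrE ?b_ge0 ?(ltW p0)//.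
  by rewrite le_max b_ge0.
by apply: lerD; apply: h; rewrite le_max lexx ?orbT.
Qed.

(** 144 = 8 * 18: eight tiles and the constant of [Jp_tile]. *)
Definition countB (delta : R) : R := 144 * stopK (thetap p) / delta.

Lemma ring_list k delta : 0 < delta -> 18 * c <= delta ->
  exists L : seq (rect (R := R)), (size L)%:R <= countB delta * (beta k + beta (k + 1)) /\
   forall f u, tame f u -> vanish f L ->
    (\int[mu]_(x in ringk k) (V x * f x ^+ 2)%:E <=
     (ringC p * delta * ringk_energy u k + 24 * (ring_mean f k ^+ 2 * ringk_mass k))%:E)%E.
Proof.
move=> d0 cd.
set m := Num.max (b k) (b (k + 1)).
have m0 : 0 <= m by rewrite le_max b_ge0.
have hm := ring_weightB k; rewrite -/m in hm.
have s0 := @erad_gt0 R k; have st2 := @erad2 R k; have st4 := @erad4 R k.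
have iV := ringV_powR_integrable p1 mV s0 st2 hm.
have hJ := Jp_tile p1 mV s0 st2 st4 m0 hm.
have [L [sL HL]] := ring_functionals p1 mV V0 s0 st2 st4 iV d0 hJ.
have K1 : 1 <= stopK (thetap p).
  rewrite /stopK; have : 0 <= 3 / (1 - thetap p).
    by rewrite divr_ge0// subr_ge0 ltW// thetap_lt1.
  lra.
exists L; split; last first.
  by move=> f u tfu vf; apply: (HL f u (ringk_mass k) tfu vf); rewrite ringk_massE.
apply: (le_trans sL).
have bb := beta_ge0.
case: ifPn => [_|].
  apply: mulr_ge0; last by apply: addr_ge0.
  apply: divr_ge0; last exact: ltW.
  by apply: mulr_ge0 => //; exact: le_trans K1.
rewrite -ltNge => hd.
have mc : c < m by rewrite -(ltr_pM2l (_ : 0 < 18))//; exact: le_lt_trans hd.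
have mb : m <= beta k + beta (k + 1).
  have := bb k; have := bb (k + 1); rewrite /m /beta.
  move: mc; rewrite /m; have [h|h] := leP (b k) (b (k + 1)) => mc.
    by rewrite mc; case: ifP => _; lra.
  by rewrite mc; case: ifP => _; lra.
have q1 : 1 <= stopK (thetap p) * (18 * m / delta).
  have r1 : 1 <= 18 * m / delta by rewrite ler_pdivlMr// mul1r; exact: ltW.
  by apply: (le_trans r1); apply: ler_peMl => //; exact: le_trans r1.
rewrite (max_idPr q1).
have -> : 8 * (stopK (thetap p) * (18 * m / delta)) = countB delta * m.
  by rewrite /countB; field; rewrite gt_eqF.
apply: ler_wpM2l => //; apply: divr_ge0; last exact: ltW.
by apply: mulr_ge0 => //; exact: le_trans K1.
Qed.

End Counting.

(** * Functionals for the whole plane *)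
Section Lists.
Context {R : realType}.

Lemma vanish_bigcat (f : R * R -> R) (F : nat -> seq rect) N :
  vanish f (\big[cat/[::]]_(n < N) F n) -> forall n, (n < N)%N -> vanish f (F n).
Proof.
elim: N => [|N IH] //; rewrite big_ord_recr /= => /vanish_cat[v1 v2] n.
by rewrite ltnS leq_eqVlt => /orP[/eqP ->//|]; exact: IH.
Qed.

Lemma size_bigcat (F : nat -> seq (rect (R := R))) N :
  (size (\big[cat/[::]]_(n < N) F n))%:R = \sum_(n < N) (size (F n))%:R :> R.
Proof.
elim: N => [|N IH]; first by rewrite !big_ord0.
by rewrite !big_ord_recr /= size_cat natrD IH.
Qed.

Lemma vanish_map (T : eqType) (f : R * R -> R) (h : T -> rect) (s : seq T) :
  vanish f (map h s) -> {in s, forall i, avg f (h i) = 0}.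
Proof.
elim: s => //= y s IH [h1 /IH h2] i; rewrite inE => /orP[/eqP ->//|]; exact: h2.
Qed.

End Lists.

Section Indices.

Lemma intD_inj (z : int) : injective (fun n : nat => n%:Z + z).
Proof. by move=> i j; lia. Qed.

Lemma intB_inj (z : int) : injective (fun n : nat => z - n%:Z).
Proof. by move=> i j; lia. Qed.

Lemma side_indexT_inj : injective (side_index true).
Proof. by move=> i j; rewrite /side_index; lia. Qed.

Lemma side_indexF_inj : injective (fun n => side_index false n.+1).
Proof. by move=> i j; rewrite /side_index; lia. Qed.

Lemma side_indexF_next n : side_index false n.+1 + 1 = 0 - n%:Z.
Proof. by rewrite /side_index; lia. Qed.

Lemma annulus_index_inj pos i : injective (annulus_index pos i).
Proof. by move=> m n; rewrite /annulus_index; case: pos; lia. Qed.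

Lemma annulus_index_far pos i n N : (i < 3)%N -> (N.+2 <= n)%N -> (N <= `|annulus_index pos i n|)%N.
Proof. by move=> hi hn; rewrite /annulus_index; case: pos; lia. Qed.

Lemma far_next (k : int) N : (N.+2 <= `|k|)%N -> (N <= `|k|)%N /\ (N <= `|(k + 1)%R|)%N.
Proof. by move=> hk; split; lia. Qed.

Lemma negz_side_index (n N : nat) : (`|Negz n| < N)%N -> (n < N)%N.
Proof. by rewrite NegzE /=; lia. Qed.

Lemma side_index0 pos : side_index pos 0 = 0.
Proof. by case: pos; rewrite /side_index ?oppr0. Qed.

Lemma erad_low (R : realType) m : erad (1 - (2 ^ m.+1)%N%:Z) <= expR (- m%:R) :> R.
Proof.
have pm : (m.+1 < 2 ^ m.+1)%N by exact: ltn_expl.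
rewrite /erad ler_expR (_ : - m%:R = (- m%:Z)%:~R); last by rewrite intrN -pmulrn.
by rewrite ler_int; move: pm; set z := (2 ^ m.+1)%N; lia.
Qed.

Lemma erad_high (R : realType) m : expR m%:R <= erad (2 ^ m.+1)%N%:Z :> R.
Proof.
have pm : (m.+1 < 2 ^ m.+1)%N by exact: ltn_expl.
by rewrite /erad ler_expR -pmulrn ler_nat ltnW// ltnW.
Qed.

Lemma erad_low1 (R : realType) m : erad (1 - (2 ^ m.+1)%N%:Z) <= erad (1 - 0%:Z) :> R.
Proof. by apply: erad_mono; set z := (2 ^ m.+1)%N; lia. Qed.

Lemma erad_high1 (R : realType) m : erad (1 - 0%:Z) <= erad (2 ^ m.+1)%N%:Z :> R.
Proof.
have : (0 < 2 ^ m.+1)%N by rewrite expn_gt0.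
by set z := (2 ^ m.+1)%N => z0; apply: erad_mono; lia.
Qed.

End Indices.

Section Core.
Context {R : realType}.
Local Notation mu := (plane_measure R).
Local Notation T2 := (measurableTypeR R * measurableTypeR R)%type.
Variables (p : R) (V : R * R -> R).
Hypotheses (p1 : 1 < p) (mV : measurable_fun (setT : set T2) V) (V0 : forall x, 0 <= V x).
Hypothesis locV : forall K : set (R * R), compact K -> (\int[mu]_(x in K) (V x)%:E < +oo)%E.
Variables a b : int -> R.
Hypotheses (Aa : forall n, logWeightA V n = (a n)%:E) (Bb : forall n, powerNormB p V n = (b n)%:E).
Variables (c eps delta SA SB : R) (N0 : nat).
Hypotheses (e0 : 0 < eps) (d0 : 0 < delta) (ce : 6 * c <= eps) (cd : 18 * c <= delta).
Hypothesis far : forall n : int, (N0 <= `|n|)%N -> a n <= c /\ b n <= c.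
Hypothesis sumA : forall (phi : nat -> int) N, injective phi -> \sum_(i < N) alpha a c (phi i) <= SA.
Hypothesis sumB : forall (phi : nat -> int) N, injective phi -> \sum_(i < N) beta b c (phi i) <= SB.

Definition radial_base (k : int) : rect := base (erad k : R) (erad (k + 1)).

Let size0 (T : Type) (s : seq T) : (size s)%:R <= 0 :> R -> s = [::].
Proof. by rewrite lern0 => /eqP /size0nil. Qed.

(** The functionals are one mean to fix the origin of both half-lines, those of the
    individual rings and those of the dyadic blocks.  Rings and blocks far from
    index 0 have small A and B and contribute none, which makes the list finite.  The constants: 14 from
    [half_line_functionals], 40 = 2 * 20 from [side_mean_next], 48 = 2 * 24 for the
    two sides and the radial part in [ring_list]. *)
Lemma plane_functionals : exists L : seq (rect (R := R)),
  (size L)%:R <= 1 + 24 * Num.sqrt (6 / eps) * SA + 4 * countB p delta * SB /\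
  forall f u, tame f u -> vanish f L -> ring_mean f 0 = 0 /\
    (\int[mu]_x (V x * f x ^+ 2)%:E <= ((2 * (ringC p * delta) + 48 * (14 * (40 * eps))) * total_energy u)%:E)%E.
Proof.
have [L HL] := choice (fun k => ring_list mV V0 locV Bb p1 k d0 cd).
have vp0 pos j : 0 <= side_mass V pos j by exact: ringk_mass_ge0.
have [Pp [sPp HPp]] := half_line_functionals (vp0 true) e0.
have [Pn [sPn HPn]] := half_line_functionals (vp0 false) e0.
pose P pos := if pos then Pp else Pn.
have sP pos n : (size (P pos n))%:R <= badcount (side_mass V pos) eps n by case: pos.
have HP pos (x D : nat -> R) : (forall j, (x j.+1 - x j) ^+ 2 <= D j) -> x 0%N = 0 ->
    (forall n, {in P pos n, forall i, x i = 0}) -> forall N,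
    \sum_(1 <= j < 2 ^ N) side_mass V pos j * x j ^+ 2 <= 14 * eps * \sum_(0 <= j < 2 ^ N) D j.
  by case: pos; [exact: HPp|exact: HPn].
(* The shift by 2 covers the neighbouring indices used for each ring and block. *)
pose N1 := N0.+2.
have CB0 : 0 <= countB p delta.
  apply: divr_ge0; last exact: ltW.
  apply: mulr_ge0; first exact: ler0n.
  apply: addr_ge0; first exact: ler0n.
  by apply: divr_ge0; [exact: ler0n|rewrite subr_ge0 ltW// thetap_lt1].
have q0 : 0 <= 4 * Num.sqrt (6 / eps) by apply: mulr_ge0; [exact: ler0n|exact: sqrtr_ge0].
have alpha0 n : (N0 <= `|n|)%N -> alpha a c n = 0.
  by move=> /far [h _]; rewrite /alpha ltNge h.
have beta0 n : (N0 <= `|n|)%N -> beta b c n = 0.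
  by move=> /far [_ h]; rewrite /beta ltNge h.
have Lfar k : (N1 <= `|k|)%N -> L k = [::].
  move=> hk; apply: size0; have [h _] := HL k; apply: (le_trans h).
  have [n1 n2] := far_next hk.
  by rewrite (beta0 _ n1) (beta0 _ n2) addr0 mulr0.
have Pfar pos n : (N1 <= n)%N -> P pos n = [::].
  move=> hn; apply: size0; apply: (le_trans (sP pos n)).
  apply: (le_trans (badcount_le mV V0 locV Aa pos n e0 ce)).
  rewrite (alpha0 _ (annulus_index_far pos (i := 0) isT hn)) (alpha0 _ (annulus_index_far pos (i := 1) isT hn)).
  by rewrite (alpha0 _ (annulus_index_far pos (i := 2) isT hn)) !addr0 mulr0.
pose pts pos n := map (fun j => radial_base (side_index pos j)) (P pos n).
(* Rings of indices 0, 1, ... and -1, -2, ..., then blocks of both sides. *)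
pose LL := radial_base 0 ::
  ((\big[cat/[::]]_(n < N1) L (side_index true n) ++ \big[cat/[::]]_(n < N1) L (side_index false n.+1)) ++
   (\big[cat/[::]]_(n < N1) pts true n ++ \big[cat/[::]]_(n < N1) pts false n)).
exists LL; split.
  have sL (phi psi : nat -> int) : injective phi -> injective psi ->
      (forall n, phi n + 1 = psi n) ->
      \sum_(n < N1) (size (L (phi n)))%:R <= 2 * countB p delta * SB.
    move=> i1 i2 h.
    apply: (@le_trans _ _ (\sum_(n < N1) countB p delta * (beta b c (phi n) + beta b c (psi n)))).
      by apply: ler_sum => n _; rewrite -h; have [] := HL (phi n).
    rewrite -mulr_sumr big_split /=.
    apply: (@le_trans _ _ (countB p delta * (SB + SB))).
      by apply: ler_wpM2l => //; apply: lerD; exact: sumB.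
    by rewrite le_eqVlt; apply/orP; left; apply/eqP; ring.
  have sQ pos : \sum_(n < N1) (size (pts pos n))%:R <= 12 * Num.sqrt (6 / eps) * SA.
    apply: (@le_trans _ _ (\sum_(n < N1) 4 * Num.sqrt (6 / eps) *
      (alpha a c (annulus_index pos 0 n) + alpha a c (annulus_index pos 1 n) + alpha a c (annulus_index pos 2 n)))).
      apply: ler_sum => n _; rewrite /pts size_map; apply: (le_trans (sP pos n)).
      exact: (badcount_le mV V0 locV Aa pos n e0 ce).
    rewrite -mulr_sumr !big_split /=.
    apply: (@le_trans _ _ (4 * Num.sqrt (6 / eps) * (SA + SA + SA))).
      by apply: ler_wpM2l => //; apply: lerD; [apply: lerD|]; apply: sumA; exact: annulus_index_inj.
    by rewrite le_eqVlt; apply/orP; left; apply/eqP; ring.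
  have -> : (size LL)%:R = (size (\big[cat/[::]]_(n < N1) L (side_index true n)))%:R +
      (size (\big[cat/[::]]_(n < N1) L (side_index false n.+1)))%:R +
      ((size (\big[cat/[::]]_(n < N1) pts true n))%:R +
       (size (\big[cat/[::]]_(n < N1) pts false n))%:R) + 1 :> R.
    by rewrite -!natrD natr1 -!size_cat.
  rewrite (size_bigcat (fun n => L (side_index true n))) (size_bigcat (fun n => L (side_index false n.+1))) !size_bigcat.
  have h1 := sL (side_index true) (fun n => n%:Z + 1).
  have h2 := sL (fun n => side_index false n.+1) (fun n => 0 - n%:Z).
  have {}h1 : \sum_(n < N1) (size (L (side_index true n)))%:R <= 2 * countB p delta * SB.
    by apply: (h1 side_indexT_inj (@intD_inj 1)).
  have {}h2 : \sum_(n < N1) (size (L (side_index false n.+1)))%:R <= 2 * countB p delta * SB.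
    exact: (h2 side_indexF_inj (@intB_inj 0) side_indexF_next).
  have h3 := sQ true; have h4 := sQ false.
  move: h1 h2 h3 h4.
  set X1 := \sum_(n < N1) _; set X2 := \sum_(n < N1) _; set X3 := \sum_(n < N1) _; set X4 := \sum_(n < N1) _.
  lra.
move=> f u tfu [v0 /vanish_cat[/vanish_cat[w1 w2] /vanish_cat[w3 w4]]].
have [[mf u0] _ iu _ _] := tfu.
have f0 : ring_mean f 0 = 0 by exact: v0.
split => //.
have vL k : vanish f (L k).
  have [hk|hk] := leqP N1 `|k|; first by rewrite Lfar.
  case: k hk => n hn; first exact: (@vanish_bigcat _ f (fun n => L (side_index true n)) N1 w1 n hn).
  rewrite NegzE; exact: (@vanish_bigcat _ f (fun n => L (side_index false n.+1)) N1 w2 n (negz_side_index hn)).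
have vP pos n : {in P pos n, forall j, ring_mean f (side_index pos j) = 0}.
  have [hn|hn] := leqP N1 n; first by rewrite Pfar.
  by case: pos; [apply: (@vanish_map _ _ f _ _ (@vanish_bigcat _ f (pts true) N1 w3 n hn))|apply: (@vanish_map _ _ f _ _ (@vanish_bigcat _ f (pts false) N1 w4 n hn))].
have E0 := ringk_energy_ge0 tfu.
have tot0 : 0 <= total_energy u by apply: Rintegral_ge0 => x _.
have rad pos N : \sum_(1 <= j < 2 ^ N) side_mass V pos j * ring_mean f (side_index pos j) ^+ 2 <= 14 * (40 * eps) * total_energy u.
  have h := HP pos (fun j => ring_mean f (side_index pos j)) _ (side_mean_next tfu pos) _ (vP pos) N.
  apply: (le_trans (h _)); first by rewrite side_index0.
  have s1 := ringk_energy_sum tfu pos 0 (2 ^ N); have s2 := ringk_energy_sum tfu pos 1 (2 ^ N).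
  rewrite add0n in s1; rewrite add1n big_add1 /= in s2.
  rewrite -mulr_sumr big_split /=.
  apply: (@le_trans _ _ (14 * eps * (20 * (total_energy u + total_energy u)))).
    apply: ler_wpM2l; first by apply: mulr_ge0 (ler0n _ _) (ltW e0).
    by apply: ler_wpM2l; [exact: ler0n|exact: (lerD s1 s2)].
  by rewrite le_eqVlt; apply/orP; left; apply/eqP; ring.
have mphi : measurable_fun setT (fun x : T2 => V x * f x ^+ 2).
  by apply: measurable_funM => //; exact: measurable_funX.
have p0 (x : T2) : 0 <= V x * f x ^+ 2 by apply: mulr_ge0 => //; exact: sqr_ge0.
have Cr0 : 0 <= ringC p.
  apply: addr_ge0 (ler0n _ _); apply: mulr_ge0 (ler0n _ _) _.
  by apply: ltW; apply: sobC_gt0; exact: thetap_lt1.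
have Cd0 : 0 <= ringC p * delta by apply: mulr_ge0 => //; exact: ltW.
have half pos a0 T N : (a0 <= 1)%N -> (a0 + T = 2 ^ N)%N ->
    (\int[mu]_(x in region pos a0 T) (V x * f x ^+ 2)%:E <=
     (ringC p * delta * total_energy u + 24 * (14 * (40 * eps) * total_energy u))%:E)%E.
  move=> ha hT; rewrite -region_sum//.
  apply: (@le_trans _ _ (\sum_(a0 <= j < a0 + T) (ringC p * delta * ringk_energy u (side_index pos j) +
      24 * (ring_mean f (side_index pos j) ^+ 2 * ringk_mass V (side_index pos j)))%:E)%E).
    apply: lee_sum => j _; have [_ h] := HL (side_index pos j); exact: (h f u tfu (vL _)).
  rewrite sumEFin lee_fin big_split /= -!mulr_sumr; apply: lerD.
    by apply: ler_wpM2l => //; exact: (ringk_energy_sum tfu pos a0 T).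
  apply: ler_wpM2l; first exact: ler0n.
  apply: le_trans (rad pos N); rewrite hT.
  under [leLHS]eq_bigr => j _ do rewrite mulrC -/(side_mass V pos j).
  case: a0 ha hT => [|[|//]] ha hT //.
  have N2 : (0 < 2 ^ N)%N by rewrite expn_gt0.
  have z0 : side_mass V pos 0 * ring_mean f (side_index pos 0) ^+ 2 = 0 by rewrite side_index0 f0 expr2 mulr0 mulr0.
  rewrite (big_ltn N2).
  rewrite [X in X + _ <= _]z0.
  rewrite add0r.
  exact: lexx.
apply: exhaustion => // m.
exists (erad (1 - (2 ^ m.+1)%N%:Z)), (erad (2 ^ m.+1)%N%:Z).
split; [exact: erad_low|exact: erad_high|].
have pT : (0 < 2 ^ m.+1)%N by rewrite expn_gt0.
rewrite (@int_ring_cat _ _ _ (erad (1 - 0%:Z)))// ?erad_gt0//; last 2 first.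
- exact: erad_low1.
- exact: erad_high1.
have h1 := half false 0%N (2 ^ m.+1)%N m.+1 isT (add0n _).
have h2 := half true 1%N (2 ^ m.+1).-1 m.+1 isT (ltac:(by rewrite add1n prednK)).
rewrite /region add0n in h1; rewrite /region add1n prednK// in h2.
rewrite (_ : erad (1 - 0%:Z) = erad 1%:Z) in h1 *; last by [].
apply: (le_trans (leeD h1 h2)); rewrite -EFinD lee_fin.
by rewrite le_eqVlt; apply/orP; left; apply/eqP; ring.
Qed.

End Core.

(** * From functionals to a bound on dimensions *)
Section Dimension.
Context {R : realType}.
Local Notation mu := (plane_measure R).
Local Notation T2 := (measurableTypeR R * measurableTypeR R)%type.

Lemma subspace_sum (S : set (R * R -> R)) n (g : 'I_n -> R * R -> R) (a : 'I_n -> R) :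
  linear_subspace S -> (forall i, S (g i)) -> S (\sum_(i < n) a i *: g i).
Proof.
move=> [S0 Sl] Sg; elim/big_ind: _ => //.
- by move=> x y Sx Sy; have := Sl 1 x y Sx Sy; rewrite scale1r.
- by move=> i _; have := Sl (a i) (g i) 0 (Sg i) S0; rewrite addr0.
Qed.

Lemma avg_sum n (g : 'I_n -> R * R -> R) (a : 'I_n -> R) Q :
  (forall i, mu.-integrable (rset Q) (EFin \o g i)) ->
  avg (\sum_(i < n) a i *: g i) Q = \sum_(i < n) a i * avg (g i) Q.
Proof.
move=> gi.
have mQ := rset_measurable Q.
suff [_] : mu.-integrable (rset Q) (EFin \o (\sum_(i < n) a i *: g i)) /\
    \int[mu]_(x in rset Q) (\sum_(i < n) a i *: g i) x =
    \sum_(i < n) a i * \int[mu]_(x in rset Q) g i x.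
  rewrite /avg => ->; rewrite mulr_suml; apply: eq_bigr => i _; exact/esym/mulrA.
elim: n g a gi => [|n IH] g a gi.
  rewrite !big_ord0; split; last first.
    by rewrite (@Rintegral_cst _ _ _ mu _ mQ 0) mul0r.
  exact: integrable0.
rewrite !big_ord_recr /=.
have [i1 e1] := IH (fun i => g (widen_ord (leqnSn n) i)) (fun i => a (widen_ord (leqnSn n) i)) (fun i => gi _).
have i2 := integrableZl mQ (a ord_max) (gi ord_max).
split; first exact: (integrableD mQ i1 i2).
by rewrite (RintegralD mQ i1 i2) e1 (RintegralZl (a ord_max) mQ (gi ord_max)).
Qed.

Lemma vanish_nth (f : R * R -> R) (L : seq rect) r0 :
  (forall j, (j < size L)%N -> avg f (nth r0 L j) = 0) -> vanish f L.
Proof.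
elim: L => //= Q L IH h; split; first exact: (h 0%N).
by apply: IH => j hj; exact: (h j.+1).
Qed.

(** The matrix of the means of the given functions has more rows than columns, so a
    non-trivial combination of the functions has all its means zero. *)
Lemma dim_bound (S : set (R * R -> R)) (L : seq rect) n (g : 'I_n -> R * R -> R) :
  linear_subspace S -> (forall F, S F -> forall Q, mu.-integrable (rset Q) (EFin \o F)) ->
  (forall F, S F -> vanish F L -> F = 0 %[ae mu in setT]) ->
  (forall i, S (g i)) -> ae_independent setT g -> (n <= size L)%N.
Proof.
move=> Sl Si S0 Sg ind; rewrite leqNgt; apply/negP => hn.
pose r0 : rect (R := R) := Rect 0 0 0 0.
pose M : 'M[R]_(n, size L) := \matrix_(i, j) avg (g i) (nth r0 L j).
have : kermx M != 0.
  by rewrite -mxrank_eq0 mxrank_ker subn_eq0 -ltnNge (leq_ltn_trans (rank_leq_col M)).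
move=> /rowV0Pn [v /sub_kermxP vM v0].
pose a i := v 0 i.
have av : forall i, a i = 0.
  apply: ind; apply: S0; first exact: subspace_sum.
  apply: (@vanish_nth _ _ r0) => j hj.
  rewrite avg_sum; last by move=> i; exact: Si.
  have := congr1 (fun A : 'rV[R]_(size L) => A 0 (Ordinal hj)) vM.
  by rewrite !mxE => h; rewrite -[RHS]h; apply: eq_bigr => i _; rewrite mxE.
by move/eqP: v0; apply; apply/rowP => i; rewrite mxE; exact: av.
Qed.

End Dimension.

(** * Sums over the indices beyond a threshold *)
Section Sums.
Context {R : realType}.
Implicit Types (A : set int) (h : int -> R) (S : R).

Lemma esum_seq_le A h S (s : seq int) : uniq s -> (forall n, n \in s -> A n) ->
  (\esum_(n in A) (h n)%:E <= S%:E)%E -> \sum_(n <- s) h n <= S.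
Proof.
move=> us sA hS; rewrite -lee_fin -sumEFin; apply: le_trans hS.
apply: esum_ge; exists [set` s]; last by rewrite -fsbig_seq.
by split; [exact: finite_seq|move=> n /= /sA].
Qed.

Lemma esum_partial_le A h S (phi : nat -> int) N :
  (\esum_(n in A) (h n)%:E <= S%:E)%E -> injective phi ->
  \sum_(i < N) (if `[< A (phi i) >] then h (phi i) else 0) <= S.
Proof.
move=> hS ip.
have := @esum_seq_le A h S [seq n <- map phi (iota 0 N) | `[< A n >]] _ _ hS.
rewrite big_filter big_map big_mkcond /=.
rewrite -[X in iota _ X]subn0 -/(index_iota 0 N) big_mkord; apply.
  by rewrite filter_uniq// map_inj_uniq// iota_uniq.
by move=> n; rewrite mem_filter => /andP[/asboolP].
Qed.

(** A convergent sum of terms bounded below has finitely many terms. *)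
Lemma esum_bounded_support A h S (k : R) : 0 < k -> (forall n, A n -> k <= h n) ->
  (\esum_(n in A) (h n)%:E <= S%:E)%E ->
  exists N : nat, forall n : int, (N <= `|n|)%N -> ~ A n.
Proof.
move=> k0 kh hS.
have finA : finite_set A.
  apply: contrapT => /(infinite_set_fset (Num.truncn (S / k)).+1)[B BA cB].
  have := @esum_seq_le A h S (finmap.enum_fset B) (finmap.fset_uniq B) BA hS.
  apply/negP; rewrite -ltNge.
  apply: (@lt_le_trans _ _ (\sum_(n <- finmap.enum_fset B) k)); last first.
    by rewrite !big_seq; apply: ler_sum => n /BA; exact: kh.
  rewrite big_const_seq count_predT iter_addr_0 -mulr_natr mulrC -ltr_pdivrMr//.
  apply: (lt_le_trans (truncnS_gt _)); by rewrite ler_nat.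
have [s eA] := (finite_seqP A).1 finA.
exists (\max_(n <- s) `|n|)%N.+1 => n hn; rewrite eA /= => ns.
have := @leq_bigmax_seq _ s xpredT (fun n : int => `|n|%N) n ns isT.
by rewrite leqNgt hn.
Qed.

Lemma esum_term_le A (h : int -> \bar R) n : A n -> (h n <= \esum_(n in A) h n)%E.
Proof.
move=> An; apply: esum_ge; exists [set n]; last by rewrite fsbig_set1.
by split; [exact: finite_set1|move=> m ->].
Qed.

End Sums.

(** * The bound on Neg *)
Section Form.
Context {R : realType}.
Local Notation mu := (plane_measure R).
Local Notation T2 := (measurableTypeR R * measurableTypeR R)%type.

Lemma form_tame (V f : R * R -> R) : form_domain V setT f ->
  exists u, tame f u /\ dirichlet setT f = (total_energy u)%:E.
Proof.
move=> [lf wf df _].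
have wg : is_weak_gradient setT f (weak_gradient setT f) by exact: xgetPex.
have [[m1 _ _] [m2 _ _] _] := wg.
pose u (x : R * R) := euclid (weak_gradient setT f x) ^+ 2.
have u0 x : 0 <= u x by exact: sqr_ge0.
have mu' : measurable_fun (setT : set T2) u.
  rewrite (_ : u = fun x => (weak_gradient setT f x).1 ^+ 2 + (weak_gradient setT f x).2 ^+ 2).
    by apply: measurable_funD; exact: measurable_funX.
  by apply/funext => x; exact: euclid_sqr.
have iu : mu.-integrable setT (EFin \o u).
  apply/integrableP; split; first exact/measurable_EFinP.
  by under eq_integral => x _ do rewrite /= ger0_norm//.
exists u; split; first exact: (tame_weak wg lf iu).
by rewrite /total_energy /Rintegral fineK//; apply: integrable_fin_num.
Qed.

(** Without energy the means over the rings all agree with the one of index 0, and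
    on each ring the function equals its mean. *)
Lemma zero_energy (f u : R * R -> R) : tame f u -> total_energy u = 0 -> ring_mean f 0 = 0 ->
  f = 0 %[ae mu in setT].
Proof.
move=> tfu t0 f0; have [[mf u0] _ _ _ _] := tfu.
have ek0 pos j : ringk_energy u (side_index pos j) = 0.
  apply/eqP; rewrite eq_le (ringk_energy_ge0 tfu) andbT -t0.
  by have := ringk_energy_sum tfu pos j 1; rewrite addn1 big_nat1.
have fk0 pos j : ring_mean f (side_index pos j) = 0.
  elim: j => [|j IH]; first by rewrite side_index0.
  have := side_mean_next tfu pos j; rewrite !ek0 IH addr0 mulr0 subr0 => h.
  by apply/eqP; rewrite -sqrf_eq0 eq_le h sqr_ge0.
have mf2 : measurable_fun setT (fun x : T2 => f x ^+ 2) by exact: measurable_funX.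
have p2 (x : T2) : 0 <= f x ^+ 2 by exact: sqr_ge0.
have reg pos a L : (\int[mu]_(x in region pos a L) (f x ^+ 2)%:E <= 0)%E.
  rewrite -region_sum//; apply: sume_le0 => j _.
  exact: (zero_energy_ring tfu (erad_gt0 _) (erad2 _) (erad4 _) (fk0 pos j) (ek0 pos j)).
have h : (\int[mu]_x (f x ^+ 2)%:E <= 0)%E.
  apply: exhaustion => // m.
  exists (erad (1 - (2 ^ m.+1)%N%:Z)), (erad (2 ^ m.+1)%N%:Z).
  split; [exact: erad_low|exact: erad_high|].
  rewrite (@int_ring_cat _ _ _ (erad (1 - 0%:Z)))// ?erad_gt0//; last 2 first.
  - exact: erad_low1.
  - exact: erad_high1.
  have h1 := reg false 0%N (2 ^ m.+1)%N.
  have h2 := reg true 1%N (2 ^ m.+1).-1.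
  have pT : (0 < 2 ^ m.+1)%N by rewrite expn_gt0.
  rewrite /region add0n in h1; rewrite /region add1n prednK// in h2.
  rewrite (_ : erad (1 - 0%:Z) = erad 1%:Z) in h1 *; last by [].
  by apply: (le_trans (leeD h1 h2)); rewrite adde0.
have mE : measurable_fun setT (fun x : T2 => (f x ^+ 2)%:E) by exact/measurable_EFinP.
have : (\int[mu]_x `|(f x ^+ 2)%:E| = 0)%E.
  under eq_integral => x _ do rewrite gee0_abs ?lee_fin//.
  by apply/eqP; rewrite eq_le h /=; apply: integral_ge0 => x _; rewrite lee_fin.
move/(ae_eq_integral_abs mu measurableT mE).
apply: filterS => x h0 _; have := h0 I => /= -[] /eqP.
by rewrite sqrf_eq0 => /eqP.
Qed.

End Form.

Section Final.
Context {R : realType}.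
Local Notation mu := (plane_measure R).
Local Notation T2 := (measurableTypeR R * measurableTypeR R)%type.

(** On a function killed by all the means, non-positivity of the form forces the
    energy E to satisfy E <= k E with k < 1. *)
Lemma Neg_le (V : R * R -> R) (L : seq (rect (R := R))) (k : R) : k < 1 ->
  (forall f u, tame f u -> vanish f L -> ring_mean f 0 = 0 /\
    (\int[mu]_x (V x * f x ^+ 2)%:E <= (k * total_energy u)%:E)%E) ->
  (Neg V setT <= (size L)%:R%:E)%E.
Proof.
move=> k1 H; apply: ge_ereal_sup => _ [S [Sl SF Sneg] <-].
apply: ge_ereal_sup => _ [n [g [Sg gi ->]]].
rewrite lee_fin ler_nat; apply: (dim_bound Sl _ _ Sg gi).
- by move=> F /SF /form_tame[u [tFu _]] Q; exact: (tame_int tFu).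
move=> F SFF vF; have [u [tFu dF]] := form_tame (SF _ SFF).
have [F0 hV] := H F u tFu vF.
have [_ u0] := (let: And5 h _ _ _ _ := tFu in h).
have t0 : 0 <= total_energy u by apply: Rintegral_ge0 => x _.
apply: (zero_energy tFu _ F0).
have := Sneg F SFF; rewrite /energy dF => hE.
have {}hE : ((total_energy u)%:E <= (k * total_energy u)%:E)%E.
  apply: le_trans hV; rewrite -sube_le0//.
by rewrite lee_fin in hE; apply/eqP; rewrite eq_le t0 andbT; nra.
Qed.

End Final.

Section Bound.
Context {R : realType}.
Local Notation mu := (plane_measure R).
Local Notation T2 := (measurableTypeR R * measurableTypeR R)%type.

Lemma ringC_gt0 (p : R) : 1 < p -> 0 < ringC p.
Proof.
move=> p1; apply: ltr_wpDr (ler0n _ _) _.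
by apply: mulr_gt0 => //; apply: sobC_gt0; exact: thetap_lt1.
Qed.

Lemma countB_gt0 (p delta : R) : 1 < p -> 0 < delta -> 0 < countB p delta.
Proof.
move=> p1 d0; apply: divr_gt0 => //.
apply: mulr_gt0; first by rewrite ltr0n.
apply: ltr_wpDr; last by rewrite ltr0n.
by apply: divr_ge0; [exact: ler0n|rewrite subr_ge0 ltW// thetap_lt1].
Qed.

(** An infinite term lies beyond any threshold and makes the sum infinite. *)
Lemma threshold_fin (w h : int -> \bar R) (c : R) (A := [set n : int | (c%:E < w n)%E]) :
  (forall n, 0 <= w n)%E -> (forall n, w n = +oo -> h n = +oo)%E ->
  (\esum_(n in A) h n < +oo)%E -> forall n, w n \is a fin_num.
Proof.
move=> w0 wh hA n; rewrite ge0_fin_numE// ltNge leye_eq; apply/negP => /eqP wn.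
have An : A n by rewrite /A /= wn ltry.
by move: hA; rewrite ltNge => /negP; apply; rewrite -(wh n wn); exact: esum_term_le.
Qed.

(** The real-valued case, from which the general one follows because the bound is
    trivial when one of the sums is infinite. *)
Lemma Neg_threshold (p c eps delta : R) (V : R * R -> R) : 1 < p -> 0 < c -> 0 < eps -> 0 < delta ->
  6 * c <= eps -> 18 * c <= delta -> 2 * (ringC p * delta) + 48 * (14 * (40 * eps)) < 1 ->
  potential setT V ->
  (\esum_(n in [set n : int | c%:E < logWeightA V n]) sqrte (logWeightA V n) < +oo)%E ->
  (\esum_(n in [set n : int | c%:E < powerNormB p V n]) powerNormB p V n < +oo)%E ->
  (Neg V setT <=
     1 + (24 * Num.sqrt (6 / eps))%:E *
         (\esum_(n in [set n : int | c%:E < logWeightA V n]) sqrte (logWeightA V n))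
       + (4 * countB p delta)%:E *
         (\esum_(n in [set n : int | c%:E < powerNormB p V n]) powerNormB p V n))%E.
Proof.
move=> p1 c0 e0 d0 ce cd k1 [V0' [mV _ lV]] finA finB.
have V0 x : 0 <= V x by exact: V0'.
have locV K : compact K -> (\int[mu]_(x in K) (V x)%:E < +oo)%E.
  move=> cK; have := lV K (@subsetT _ _) cK.
  by under eq_integral => x _ do rewrite ger0_norm//.
have A0 n : (0 <= logWeightA V n)%E.
  by apply: integral_ge0 => x _; rewrite lee_fin; apply: mulr_ge0 => //; apply: addr_ge0.
have B0 n : (0 <= powerNormB p V n)%E by exact: poweR_ge0.
have fA : forall n, logWeightA V n \is a fin_num.
  by apply: threshold_fin finA => // n ->.
have fB : forall n, powerNormB p V n \is a fin_num.
  exact: threshold_fin finB.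
pose a n := fine (logWeightA V n); pose b n := fine (powerNormB p V n).
have Aa n : logWeightA V n = (a n)%:E by rewrite fineK.
have Bb n : powerNormB p V n = (b n)%:E by rewrite fineK.
have sA0 : (0 <= \esum_(n in [set n : int | c%:E < logWeightA V n]) sqrte (logWeightA V n))%E.
  by apply: esum_ge0 => n _; exact: sqrte_ge0.
have sB0 : (0 <= \esum_(n in [set n : int | c%:E < powerNormB p V n]) powerNormB p V n)%E.
  exact: esum_ge0.
move: finA finB sA0 sB0.
rewrite (_ : [set n : int | (c%:E < logWeightA V n)%E] = [set n | c < a n]); last first.
  by apply/funext => n; apply/propext; rewrite /= Aa lte_fin.
rewrite (_ : [set n : int | (c%:E < powerNormB p V n)%E] = [set n | c < b n]); last first.
  by apply/funext => n; apply/propext; rewrite /= Bb lte_fin.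
rewrite (_ : (fun n => sqrte (logWeightA V n)) = (fun n => (Num.sqrt (a n))%:E)); last first.
  by apply/funext => n; rewrite Aa.
rewrite (_ : (fun n => powerNormB p V n) = (fun n => (b n)%:E)); last first.
  by apply/funext => n; rewrite Bb.
move=> finA finB sA0 sB0.
set EA := (\esum_(n in _) (Num.sqrt _)%:E)%E in finA sA0 *.
set EB := (\esum_(n in _) (b n)%:E)%E in finB sB0 *.
have eA : EA = (fine EA)%:E by rewrite fineK// ge0_fin_numE.
have eB : EB = (fine EB)%:E by rewrite fineK// ge0_fin_numE.
have leA : (EA <= (fine EA)%:E)%E by rewrite -eA.
have leB : (EB <= (fine EB)%:E)%E by rewrite -eB.
have [NA hA] : exists N : nat, forall n : int, (N <= `|n|)%N -> ~ [set n | c < a n] n.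
  apply: (esum_bounded_support (k := Num.sqrt c) _ _ leA); first by rewrite sqrtr_gt0.
  by move=> n /= /ltW cn; exact: ler_wsqrtr.
have [NB hB] : exists N : nat, forall n : int, (N <= `|n|)%N -> ~ [set n | c < b n] n.
  by apply: (esum_bounded_support (k := c) _ _ leB) => // n /ltW.
have far n : (maxn NA NB <= `|n|)%N -> a n <= c /\ b n <= c.
  rewrite geq_max => /andP[h1 h2]; split; rewrite leNgt; apply/negP.
    exact: hA h1.
  exact: hB h2.
have sumA (phi : nat -> int) N : injective phi -> \sum_(i < N) alpha a c (phi i) <= fine EA.
  move=> ip; apply: le_trans (esum_partial_le N leA ip).
  by apply: ler_sum => i _; rewrite /alpha asboolb.
have sumB (phi : nat -> int) N : injective phi -> \sum_(i < N) beta b c (phi i) <= fine EB.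
  move=> ip; apply: le_trans (esum_partial_le N leB ip).
  by apply: ler_sum => i _; rewrite /beta asboolb.
have [L [sL HL]] := plane_functionals p1 mV V0 locV Aa Bb e0 d0 ce cd far sumA sumB.
apply: (le_trans (Neg_le k1 HL)).
by rewrite eA eB -!EFinM -!EFinD lee_fin.
Qed.

Lemma Neg_bound (p : R) : 1 < p ->
  exists C c : R, [/\ 0 < C, 0 < c &
    forall V : R * R -> R, potential setT V ->
      (Neg V setT <=
         1 + C%:E * (\esum_(n in [set n : int | c%:E < logWeightA V n])
                       sqrte (logWeightA V n))
           + C%:E * (\esum_(n in [set n : int | c%:E < powerNormB p V n])
                       powerNormB p V n))%E].
Proof.
move=> p1.
have r0 := ringC_gt0 p1.
pose delta : R := (8 * ringC p)^-1.
have d0 : 0 < delta by rewrite invr_gt0 mulr_gt0.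
(* The two error terms are made 1/4 each. *)
have [eps [e0 eE]] : exists eps : R, 0 < eps /\ 48 * (14 * (40 * eps)) = 4^-1.
  exists (4^-1 / 40 / 14 / 48); split; first by rewrite !divr_gt0// ltr0n.
  by field.
have dE : 2 * (ringC p * delta) = 4^-1.
  by rewrite /delta; field; rewrite gt_eqF.
(* Below this threshold neither a block nor a ring needs functionals. *)
pose c := Num.min (eps / 6) (delta / 18).
have c0 : 0 < c by rewrite lt_min !divr_gt0// ltr0n.
have ce : 6 * c <= eps by rewrite mulrC -ler_pdivlMr ?ltr0n// ge_min lexx.
have cd : 18 * c <= delta by rewrite mulrC -ler_pdivlMr ?ltr0n// ge_min lexx orbT.
have k1 : 2 * (ringC p * delta) + 48 * (14 * (40 * eps)) < 1 by rewrite dE eE; lra.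
pose CA := 24 * Num.sqrt (6 / eps); pose CB := 4 * countB p delta.
have CA0 : 0 < CA.
  by apply: mulr_gt0; rewrite ?ltr0n// sqrtr_gt0 divr_gt0// ltr0n.
have CB0 : 0 < CB by apply: mulr_gt0; rewrite ?ltr0n// countB_gt0.
have C0 : 0 < Num.max CA CB by rewrite lt_max CA0.
exists (Num.max CA CB), c; split=> // V pV.
set EA := (\esum_(n in _) sqrte _)%E; set EB := (\esum_(n in _) powerNormB _ _ _)%E.
have EA0 : (0 <= EA)%E by apply: esum_ge0 => n _; exact: sqrte_ge0.
have EB0 : (0 <= EB)%E by apply: esum_ge0 => n _; exact: poweR_ge0.
have [EAy|EAf] := eqVneq EA +oo%E.
  rewrite EAy gt0_muley ?lte_fin// addey// addye ?leey//.
  by rewrite gt_eqF// (lt_le_trans (ltNyr 0))// mule_ge0// lee_fin ltW.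
have [EBy|EBf] := eqVneq EB +oo%E.
  rewrite EBy gt0_muley ?lte_fin// addey ?leey//.
  by rewrite gt_eqF// (lt_le_trans (ltNyr 0))// adde_ge0// mule_ge0// lee_fin ltW.
rewrite -ltey in EAf; rewrite -ltey in EBf.
apply: (le_trans (Neg_threshold p1 c0 e0 d0 ce cd k1 pV EAf EBf)).
apply: leeD; first apply: leeD => //.
  by apply: lee_wpmul2r => //; rewrite lee_fin le_max lexx.
by apply: lee_wpmul2r => //; rewrite lee_fin le_max lexx orbT.
Qed.

End Bound.

Unset Implicit Arguments.

Theorem theorem1p1 (R : realType) (p : R) (hp : 1 < p) :
  exists C c : R, [/\ 0 < C, 0 < c &
    forall V : R * R -> R, potential setT V ->
      (Neg V setT <=
         1 + C%:E * (\esum_(n in [set n : int | c%:E < logWeightA V n])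
                       sqrte (logWeightA V n))
           + C%:E * (\esum_(n in [set n : int | c%:E < powerNormB p V n])
                       powerNormB p V n))%E].
Proof. exact: Neg_bound. Qed.
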